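(* Let $(\mathcal G_n)_{n\ge 0}\sim\mathscr P(1,\pi,\kappa)$ on the finite attribute space $[K]$, with $\pi_a>0$ and $\kappa_{a,b}>0$ for all $a,b\in[K]$. Then, as $n\to\infty$, $\mathcal G_n$ converges almost surely in the extended fringe sense to $\mathcal T_\infty$, where $\mathcal T_\infty$ is the unique (in law) random sin-tree with fringe distribution $$\varpi_\infty(\cdot)=\mathcal L\big(\mathrm{BP}_A(\tau)\big).$$ Here the type $A$ of the root of the branching process is distributed as $\pi$, and $\tau$ is an exponential random variable with rate $2$, independent of the branching process (and of $A$).
   Context: Model. Fix an integer $K\ge1$, $[K]=\{1,\dots,K\}$, a probability mass function $\pi=(\pi_a)_{a\in[K]}$ and a matrix $\kappa=(\kappa_{a,b})_{a,b\in[K]}$. The random network sequence $(\mathcal G_n)_{n\ge0}\sim\mathscr P(1,\pi,\kappa)$ is built on one probability space as follows. $\mathcal G_0$ is a finite rooted tree whose vertices carry types in $[K]$. Given $\mathcal G_0,\dots,\mathcal G_n$, a new vertex $v_{n+1}$ arrives with $\mathrm{type}(v_{n+1})\sim\pi$, independent of $\mathcal G_0,\dots,\mathcal G_n$, and is attached by a single edge to a vertex of $\mathcal G_n$; given $\mathcal G_n$ and $\mathrm{type}(v_{n+1})=b$, it attaches to $v\in\mathcal G_n$ with probability $$\frac{\kappa_{\mathrm{type}(v),b}\deg(v,n)}{\sum_{v'\in\mathcal G_n}\kappa_{\mathrm{type}(v'),b}\deg(v',n)},$$ where $\deg(v,n)$ is the degree of $v$ in $\mathcal G_n$ (if $\mathcal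 G_0$ is a single vertex its degree is initialized to be $1$ and increases by one with every edge received). Each $\mathcal G_n$ is a tree rooted at the root of $\mathcal G_0$. Derived constants. Let $V_\pi(y)=1-\frac12\sum_{j}\pi_j\big(\log y_j+\log\sum_k y_k\kappa_{k,j}\big)$ for $y$ in the interior of the simplex of probability vectors on $[K]$. It is known to have a unique minimizer $\eta=(\eta_1,\dots,\eta_K)$ there. Set $\nu_b=\pi_b/\sum_l\kappa_{l,b}\eta_l$, $\phi_{a,b}=\kappa_{a,b}\nu_b$, $\phi_a=\sum_b\phi_{a,b}$ (one has $\phi_a=2-\pi_a/\eta_a$). Branching process. For $a\in[K]$, $(\mathrm{BP}_a(t))_{t\ge0}$ is the continuous-time multi-type branching process (without deaths) started at time $0$ from one individual (the root) of type $a$, in which, independently across individuals, an individual of type $a'$ that currently has $N$ children gives birth to a child of type $b$ at rate $\phi_{a',b}(N+1)$. $\mathrm{BP}_a(t)$ is viewed as the rooted, typed family tree of all individuals born by time $t$, and $\mathcal L(\cdot)$ denotes law. Fringe convergence. Let $\mathbb T$ be the countable set of finite rooted trees with vertex types in $[K]$, up to root- and type-preserving isomorphism, together with the empty tree $\emptyset$, with the discrete topology. For a finite rooted typed tree $\mathbf t$ and $v\in\mathbf t$ with path $v=v_0,v_1,\dots,v_h$ to the root: $f_0(v,\mathbf t)$ is the subtree of descendants of $v$ (including $v$), rooted at $v$; for $1\le i\le h$, $f_i(v,\mathbf t)$ is the subtree rooted at $v_i$ of all vertices whose path from the root passes through $v_i$ but not $v_{i-1}$; $f_i=\emptyset$ for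 $i>h$. Put $F_k(v,\mathbf t)=(f_0(v,\mathbf t),\dots,f_k(v,\mathbf t))$. A sin-tree is a locally finite infinite rooted typed tree with a single infinite path $0,1,2,\dots$ from its root $0$, such that removing the edges of the path leaves finite trees $\mathbf t_0,\mathbf t_1,\dots$, with $\mathbf t_i$ rooted at $i$; put $F_k(0,\cdot)=(\mathbf t_0,\dots,\mathbf t_k)$, and let $\bar{\mathbf t}_i$ be the finite tree rooted at $i$ formed by $\mathbf t_0,\dots,\mathbf t_i$ and the path edges between $0$ and $i$. Say $\mathcal G_n$ converges almost surely in the extended fringe sense to a random sin-tree $\mathcal T_\infty$ if for every $k\ge0$, almost surely $\frac{1}{|\mathcal G_n|}\sum_{v\in\mathcal G_n}\delta_{F_k(v,\mathcal G_n)}\to\mathbb P(F_k(0,\mathcal T_\infty)\in\cdot)$ weakly as probability measures on $\mathbb T^{k+1}$. For $\mathbf s,\mathbf t\in\mathbb T$ let $Q(\mathbf s,\mathbf t)$ be the number of children of the root of $\mathbf s$ whose descendant subtree is isomorphic (with types) to $\mathbf t$. A probability measure $\varpi$ on non-empty trees is a fringe distribution if $\sum_{\mathbf s}\varpi(\mathbf s)Q(\mathbf s,\mathbf t)=\varpi(\mathbf t)$ for all $\mathbf t$. The unique random sin-tree with fringe distribution $\varpi$ is the one with law determined by $$\mathbb P\big(\bar{\mathbf t}_0=\mathbf s_0,\dots,\bar{\mathbf t}_i=\mathbf s_i\big)=\varpi(\mathbf s_i)\prod_{j=1}^iQ(\mathbf s_j,\mathbf s_{j-1})\quad\text{for all }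 i\ge0,\ \mathbf s_0,\dots,\mathbf s_i\in\mathbb T .$$ *)

(* Defs.v *)
From HB Require Import structures.
From mathcomp Require Import all_boot all_order all_algebra.
From mathcomp Require Import all_classical all_reals all_analysis.

Set Implicit Arguments.
Unset Strict Implicit.
Unset Printing Implicit Defensive.

Import Order.TTheory GRing.Theory Num.Theory.
Import numFieldNormedType.Exports.

Local Open Scope classical_set_scope.
Local Open Scope ring_scope.

(* Plane trees: they serve as representatives, the order of the children being
   forgotten in [utree] below. *)
Inductive ptree (K : nat) := PNode of 'I_K & seq (ptree K).

Section PlaneTree.
Variable K : nat.
Implicit Types (t u : ptree K) (a : 'I_K).

Definition root_type t : 'I_K := let: PNode a _ := t in a.
Definition subtrees t : seq (ptree K) := let: PNode _ ts := t in ts.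

Fixpoint ptree_encode t : GenTree.tree void :=
  let: PNode a ts := t in GenTree.Node a (map ptree_encode ts).

Fixpoint ptree_decode (g : GenTree.tree void) : option (ptree K) :=
  match g with
  | GenTree.Leaf _ => None
  | GenTree.Node n gs => omap (fun a => PNode a (pmap ptree_decode gs)) (insub n)
  end.

Lemma ptree_encodeK : pcancel ptree_encode ptree_decode.
Proof.
rewrite /pcancel; fix IH 1; case=> a ts /=; rewrite valK /=; congr (Some (PNode a _)).
by elim: ts => [|t ts IHts] //=; rewrite IH /= IHts.
Qed.

HB.instance Definition _ := Countable.copy (ptree K) (pcan_type ptree_encodeK).

Lemma ptree_mem_ind (P : ptree K -> Prop) :
  (forall a ts, (forall t, t \in ts -> P t) -> P (PNode a ts)) ->
  forall t, P t.
Proof.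
move=> H; fix IH 1; case=> a ts; apply: H.
elim: ts => [|t' ts IHts] t; first by clear IH; rewrite in_nil.
by rewrite inE => /orP[/eqP ->|/IHts].
Qed.

Fixpoint tiso t u : bool :=
  let: PNode a ts := t in let: PNode b us := u in
  (a == b) && has (all2 tiso ts) (permutations us).

Lemma tisoP a ts b us :
  reflect (a = b /\ exists2 vs, perm_eq vs us & all2 tiso ts vs)
          (tiso (PNode a ts) (PNode b us)).
Proof.
apply: (iffP andP) => [[/eqP -> /hasP[vs]]|[-> [vs Pvs Avs]]].
  by rewrite mem_permutations => Pvs Avs; split=> //; exists vs.
by split; [|apply/hasP; exists vs; rewrite ?mem_permutations].
Qed.

Lemma all2_perm (T S : eqType) (r : T -> S -> bool) (s s' : seq T) (v : seq S) :
  perm_eq s' s -> all2 r s v -> exists2 v', perm_eq v' v & all2 r s' v'.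
Proof.
case: s => [/perm_nilP -> | x0 s]; first by exists v.
case: v => [//|y0 v] ps rsv.
have sz : size (x0 :: s) = size (y0 :: v).
  by move: rsv; rewrite all2E => /andP[/eqP].
have /(perm_iotaP x0)[Is PIs ->] := ps.
exists (map (nth y0 (y0 :: v)) Is).
  by apply/(perm_iotaP y0); exists Is; rewrite -?sz.
move: rsv; rewrite all2E => /andP[_ /all_nthP rsv].
rewrite all2E !size_map eqxx /=; apply/allP => -[x y].
rewrite zip_map => /mapP[i iIs [-> ->]].
have lti : (i < size (x0 :: s))%N by move: iIs; rewrite (perm_mem PIs) mem_iota.
have := rsv (x0, y0) i; rewrite size_zip -sz minnn => /(_ lti).
by rewrite nth_zip.
Qed.

Lemma all2_in_flip (T S : eqType) (r : T -> S -> bool) (r' : S -> T -> bool) s v :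
  (forall x, x \in s -> forall y, r x y -> r' y x) -> all2 r s v -> all2 r' v s.
Proof.
elim: s v => [|x s IH] [|y v] //= H /andP[rxy rsv].
rewrite H ?mem_head //=; apply: IH => // z zs; apply: H.
by rewrite inE zs orbT.
Qed.

Lemma tiso_refl : reflexive tiso.
Proof.
elim/ptree_mem_ind => a ts IH; apply/tisoP; split=> //; exists ts => //.
elim: ts IH => //= t ts IHts IH; rewrite IH ?mem_head //= IHts // => u uts.
by apply: IH; rewrite inE uts orbT.
Qed.

Lemma tiso_symW t u : tiso t u -> tiso u t.
Proof.
elim/ptree_mem_ind: t u => a ts IH [b us] /tisoP[-> [vs Pvs Avs]].
apply/tisoP; split=> //.
have := all2_in_flip IH Avs; apply: all2_perm.
by rewrite perm_sym.
Qed.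

Lemma tiso_sym : symmetric tiso.
Proof. by move=> t u; apply/idP/idP; apply: tiso_symW. Qed.

Lemma tiso_trans : transitive tiso.
Proof.
move=> u t; elim/ptree_mem_ind: t u => a ts IH [b us] [c ws].
move=> /tisoP[-> [vs Pvs Avs]] /tisoP[-> [xs Pxs Axs]].
apply/tisoP; split=> //.
have [ys Pys Ays] := all2_perm Pvs Axs.
exists ys; first exact: perm_trans Pys Pxs.
elim: ts vs ys IH Avs Ays {us ws Pvs xs Pxs Axs Pys}.
  by move=> [|v vs] [|y ys].
move=> t ts IHts [|v vs] [|y ys] //= IH /andP[tv Av] /andP[vy Ay].
rewrite (IH _ (mem_head _ _) _ _ tv vy) (IHts _ _ _ Av Ay) // => z zts.
by apply: IH; rewrite inE zts orbT.
Qed.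

Canonical tiso_equiv := EquivRel tiso tiso_refl tiso_sym tiso_trans.

End PlaneTree.

(* The non-empty finite typed rooted trees up to isomorphism.  The set of trees
   including the empty one is [option (utree K)], [None] being the empty tree. *)
Definition utree (K : nat) : Type := {eq_quot (@tiso_equiv K)}%qT.

HB.instance Definition _ K := EqQuotient.on (utree K).
HB.instance Definition _ K := Countable.on (utree K).

Section UTree.
Variable K : nat.
Implicit Types (s t : utree K).

Definition tclass (t : ptree K) : utree K := (\pi_(utree K) t)%qT.

Definition Q s t : nat := count (fun c => tclass c == t) (subtrees (repr s)).

(* [graft s t] adds an edge from the root of [s] to the root of [t], the latter
   becoming a child of the former. *)
Definition graft s t : utree K :=
  tclass (PNode (root_type (repr s)) (repr t :: subtrees (repr s))).

(* A tree given by its vertices V, their types [ty] and the sets of children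
   [ch]: [is_shape ty ch t x] says that the subtree of descendants of x is
   finite and isomorphic to t. *)
Section Shape.
Variables (V : eqType) (ty : V -> 'I_K) (ch : V -> set V).

Fixpoint all2P (S T : Type) (r : T -> S -> Prop) (ts : seq T) (xs : seq S) :
    Prop :=
  match ts, xs with
  | [::], [::] => True
  | t :: ts', x :: xs' => r t x /\ all2P r ts' xs'
  | _, _ => False
  end.

Fixpoint is_shape (t : ptree K) (x : V) : Prop :=
  let: PNode a ts := t in
  ty x = a /\
  exists xs : seq V, [/\ uniq xs, ch x = [set` xs] & all2P is_shape ts xs].

(* [None] when x has infinitely many descendants. *)
Definition subtree_at (x : V) : option (utree K) :=
  xget None [set Some (tclass t) | t in [set t | is_shape t x]].

End Shape.

End UTree.

(* The vertices are numbered in an order in which parents precede children;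
   entry i consists of the type and the parent of vertex i.  Vertex 0 is the
   root and the second component of its entry is irrelevant. *)
Definition rtree (K : nat) := seq ('I_K * nat).

Section Network.
Variable K : nat.
Implicit Types (g : rtree K).

Definition vtype g (v : 'I_(size g)) : 'I_K := (tnth (in_tuple g) v).1.

Definition parent g (v : 'I_(size g)) : option 'I_(size g) :=
  if v == 0%N :> nat then None else insub (tnth (in_tuple g) v).2.

Definition wf g : bool :=
  (0 < size g)%N &&
  [forall v : 'I_(size g), (0 < v)%N ==> ((tnth (in_tuple g) v).2 < v)%N].

Definition adjacent g (v w : 'I_(size g)) : bool :=
  (parent v == Some w) || (parent w == Some v).

(* [single] tells whether the initial network is a single vertex, in which case
   the degree of the root is shifted by one. *)
Definition deg (single : bool) g (v : 'I_(size g)) : nat :=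
  #|[set w | adjacent v w]%SET| + (single && (v == 0%N :> nat)).

Definition attach g (v : 'I_(size g)) (b : 'I_K) : rtree K :=
  rcons g (b, nat_of_ord v).

Definition ancestor g (v : 'I_(size g)) (i : nat) : option 'I_(size g) :=
  iter i (obind (@parent g)) (Some v).

Definition children g (x : 'I_(size g)) : set 'I_(size g) :=
  [set y | parent y = Some x].

(* f_i(v, g) for the ancestor line v = v_0, v_1, ...: for i > 0, cutting the edge
   to v_(i-1) leaves the vertices whose path from the root passes through v_i
   but not v_(i-1).  It is empty when v_i does not exist. *)
Definition fringe_part g (v : 'I_(size g)) (i : nat) : option (utree K) :=
  match i with
  | 0 => subtree_at (@vtype g) (@children g) v
  | j.+1 =>
    match ancestor v j.+1, ancestor v j with
    | Some x, Some y =>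
        subtree_at (@vtype g) (fun z => children z `\ y) x
    | _, _ => None
    end
  end.

Definition extended_fringe k g (v : 'I_(size g)) :
    k.+1.-tuple (option (utree K)) :=
  [tuple fringe_part v i | i < k.+1].

End Network.

Section NetworkProcess.
Variables (R : realType) (K : nat) (p : 'I_K -> R) (kappa : 'I_K -> 'I_K -> R).

Definition attach_prob (single : bool) (g : rtree K) (b : 'I_K)
    (v : 'I_(size g)) : R :=
  kappa (vtype v) b * (deg single v)%:R /
  \sum_(v' < size g) kappa (vtype v') b * (deg single v')%:R.

(* The new vertex has type b with probability p b, independently of the past, and
   is then attached to v with probability [attach_prob]; this is written as a
   product formula over all histories h_0, ..., h_n.  The initial tree may be
   random, with any law. *)
Definition network_process d (Omega : measurableType d)
    (P : probability Omega R) (G : nat -> Omega -> rtree K) : Prop :=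
  [/\ forall n g, measurable [set w | G n w = g],
      forall w, wf (G 0%N w)
    & forall n (h : nat -> rtree K) (b : 'I_K) (v : 'I_(size (h n))),
        P [set w | (forall i, (i <= n)%N -> G i w = h i) /\
                   G n.+1 w = attach v b] =
        (P [set w | forall i, (i <= n)%N -> G i w = h i] *
         (p b * attach_prob (size (h 0%N) == 1%N) b v)%:E)%E].

End NetworkProcess.

Section Constants.
Variables (R : realType) (K : nat) (p : 'I_K -> R) (kappa : 'I_K -> 'I_K -> R).

Definition Vpi (y : 'I_K -> R) : R :=
  1 - 2^-1 * \sum_j p j * (ln (y j) + ln (\sum_k y k * kappa k j)).

Definition simplex_interior : set ('I_K -> R) :=
  [set y | (forall a, 0 < y a) /\ \sum_a y a = 1].

Definition Vpi_minimizer (y : 'I_K -> R) : Prop :=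
  simplex_interior y /\ forall z, simplex_interior z -> Vpi y <= Vpi z.

Definition nu (eta : 'I_K -> R) (b : 'I_K) : R :=
  p b / \sum_l kappa l b * eta l.

Definition phi (eta : 'I_K -> R) (a b : 'I_K) : R := kappa a b * nu eta b.

End Constants.

(* Individuals are coded by words: [::] is the root and k :: u is the k-th child
   (from 0) of u.  The clock [clk u a N b] is the time that u, if it has type a,
   waits for a child of type b after it has reached N children; the N-th child
   is born when the first of the K competing clocks rings, and has the type of
   that clock. *)
Section BranchingProcess.
Variables (R : realType) (K : nat).
Variable clk : seq nat -> 'I_K -> nat -> 'I_K -> R.
Variable a : 'I_K.

Fixpoint bp_type (u : seq nat) : 'I_K :=
  match u with
  | [::] => a
  | k :: u' => let c := bp_type u' in
               [arg min_(b < c) clk u' c k b]%O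
  end.

Fixpoint bp_birth (u : seq nat) : R :=
  match u with
  | [::] => 0
  | k :: u' => bp_birth u' +
               \sum_(j < k.+1) clk u' (bp_type u') j (bp_type (nat_of_ord j :: u'))
  end.

Definition bp_children (s : R) (u : seq nat) : set (seq nat) :=
  [set v | exists2 k, v = k :: u & bp_birth v <= s].

(* BP_a(s); by convention the empty tree if it is infinite. *)
Definition BP (s : R) : option (utree K) :=
  subtree_at bp_type (bp_children s) [::].

End BranchingProcess.

Section BranchingLaw.
Variables (R : realType) (K : nat).

Definition independent_events d (Omega : measurableType d)
    (P : probability Omega R) (I : choiceType) (F : I -> set (set Omega)) :=
  forall (J : seq I) (E : I -> set Omega), uniq J ->
    (forall i, i \in J -> F i (E i)) ->
    P (\bigcap_(i in [set` J]) E i) = (\prod_(i <- J) P (E i))%E.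

Definition clock_index : choiceType := (seq nat * 'I_K * nat * 'I_K)%type.

Definition bp_events d (Omega : measurableType d) (P : probability Omega R)
    (A : Omega -> 'I_K) (tau : {RV P >-> R})
    (xi : seq nat -> 'I_K -> nat -> 'I_K -> {RV P >-> R})
    (i : option (option clock_index)) : set (set Omega) :=
  match i with
  | None => [set A @^-1` B | B in [set: set 'I_K]]
  | Some None => [set tau @^-1` B | B in measurable]
  | Some (Some (u, a, N, b)) => [set xi u a N b @^-1` B | B in measurable]
  end.

Definition branching_setup d (Omega : measurableType d)
    (P : probability Omega R) (p : 'I_K -> R) (ph : 'I_K -> 'I_K -> R)
    (A : Omega -> 'I_K) (tau : {RV P >-> R})
    (xi : seq nat -> 'I_K -> nat -> 'I_K -> {RV P >-> R}) : Prop :=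
  [/\ forall a, measurable (A @^-1` [set a]) /\ P (A @^-1` [set a]) = (p a)%:E,
      forall B, measurable B ->
        P (tau @^-1` B) = exponential_prob (2 : R) B,
      forall u a N b B, measurable B ->
        P (xi u a N b @^-1` B) = exponential_prob (ph a b * N.+1%:R) B
    & independent_events P (bp_events A tau xi)].

(* The law of BP_A(tau), as a mass function on the non-empty trees. *)
Definition varpi_infty d (Omega : measurableType d)
    (P : probability Omega R) (A : Omega -> 'I_K) (tau : {RV P >-> R})
    (xi : seq nat -> 'I_K -> nat -> 'I_K -> {RV P >-> R}) (t : utree K) :
    \bar R :=
  P [set w | BP (fun u a N b => xi u a N b w) (A w) (tau w) = Some t].

End BranchingLaw.

(* A sin-tree up to isomorphism: the finite trees t_0, t_1, t_2, ... hanging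
   from its infinite path, t_i being rooted at i. *)
Definition sin_tree (K : nat) := nat -> utree K.

Section SinTree.
Variables (R : realType) (K : nat).

Fixpoint tbar (T : sin_tree K) (i : nat) : utree K :=
  if i is j.+1 then graft (T j.+1) (tbar T j) else T 0%N.

Definition fringe_distribution (varpi : utree K -> \bar R) : Prop :=
  [/\ forall t, (0 <= varpi t)%E,
      (\esum_(t in [set: utree K]) varpi t = 1)%E
    & forall t,
        (\esum_(s in [set: utree K]) (varpi s * (Q s t)%:R%:E) = varpi t)%E].

Definition random_sin_tree d (Omega : measurableType d)
    (T : Omega -> sin_tree K) : Prop :=
  forall i t, measurable [set w | T w i = t].

Definition sin_tree_with_fringe d (Omega : measurableType d)
    (P : probability Omega R) (T : Omega -> sin_tree K)
    (varpi : utree K -> \bar R) : Prop :=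
  random_sin_tree T /\
  forall i (s : nat -> utree K),
    P [set w | forall j, (j <= i)%N -> tbar (T w) j = s j] =
    (varpi (s i) * (\prod_(1 <= j < i.+1) (Q (s j) (s j.-1))%:R)%:E)%E.

Definition sin_tree_cylinders : set (set (sin_tree K)) :=
  [set C | exists i t, C = [set T | T i = t]].

Definition same_law d1 (O1 : measurableType d1) (P1 : probability O1 R)
    (T1 : O1 -> sin_tree K) d2 (O2 : measurableType d2)
    (P2 : probability O2 R) (T2 : O2 -> sin_tree K) : Prop :=
  forall B, <<s sin_tree_cylinders >> B -> P1 (T1 @^-1` B) = P2 (T2 @^-1` B).

Definition extended_fringe_sin k (T : sin_tree K) :
    k.+1.-tuple (option (utree K)) := [tuple Some (T i) | i < k.+1].

(* On a countable discrete space every function is continuous, so that weak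
   convergence is tested on all bounded functions f. *)
Definition extended_fringe_cvg d (Omega : measurableType d)
    (P : probability Omega R) (G : nat -> Omega -> rtree K)
    d' (Omega' : measurableType d') (P' : probability Omega' R)
    (T : Omega' -> sin_tree K) : Prop :=
  forall k, \forall w \ae P,
    forall f : k.+1.-tuple (option (utree K)) -> R,
      (exists M : R, forall x, `|f x| <= M) ->
      (fun n => ((size (G n w))%:R^-1 *
                 \sum_(v < size (G n w)) f (extended_fringe k v))%:E) @ \oo
      --> ('E_P'[fun w' => f (extended_fringe_sin k (T w'))])%E.

End SinTree.

(* Main.v *)
(* Record, for a vertex v of the network, the order in which its descendants arrive
   and attach: the resulting "history" h determines the fringe tree of v, and the
   number N_n(h) of vertices with history h follows a linear stochastic
   recursion, N_n(h) increasing through N_n(h'), h' being h without its last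
   vertex, and decreasing at a rate proportional to the weighted degree of h.  Its
   coefficients converge once the total degree X_n(a) of every type a satisfies
   X_n(a) / n -> 2 eta_a; this follows from a Lyapunov function, the relative
   entropy of X_n / (2 n) with respect to eta, whose drift is controlled by the
   minimality of V_pi(eta).  The noise terms are martingales with bounded
   increments; all that is used of their accumulated value S_n is that
   sum |S_n| / n^2 is almost surely finite, which follows from E S_n^2 = O(n).
   The resulting limit of N_n(h) / n is the probability that the branching process
   has history h at time tau: it is computed by the race of its exponential
   clocks.  Summing over the histories of a given tree, the fringe frequencies are
   asymptotically at least varpi, hence converge to varpi since varpi has mass 1
   (Scheffe), and the fringe equation passes to the limit in the same way.
   Frequencies of extended fringes are products of fringe frequencies with numbers
   of children.  Finally the sin-tree is a Markov chain, which is realised on [0, 1[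
   by iterated subdivision into intervals. *)
Require Import Defs.
From mathcomp Require Import all_boot all_order all_algebra.
From mathcomp Require Import all_classical all_reals all_analysis.
From mathcomp Require Import zify ring lra.

Set Implicit Arguments.
Unset Strict Implicit.
Unset Printing Implicit Defensive.

Import Order.TTheory GRing.Theory Num.Theory.
Import numFieldNormedType.Exports.

Local Open Scope classical_set_scope.
Local Open Scope ring_scope.

(** * Trees up to isomorphism *)

Section TreeClasses.
Variable K : nat.
Implicit Types (s t u : utree K) (x y : ptree K).

Lemma tclassP x y : reflect (tclass x = tclass y) (tiso x y).
Proof. by apply: (iffP idP) => [xy|/eqmodP]; first exact/eqmodP. Qed.

Lemma all2_tisoE (ts us : seq (ptree K)) :
  all2 (@tiso K) ts us = (map (@tclass K) ts == map (@tclass K) us).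
Proof.
elim: ts us => [|t ts IH] [|u us] //=.
rewrite IH eqseq_cons; congr andb.
by apply/idP/eqP => [/tclassP|/tclassP].
Qed.

Lemma tclass_node (a b : 'I_K) (ts us : seq (ptree K)) :
  tclass (PNode a ts) = tclass (PNode b us) <->
  a = b /\ perm_eq (map (@tclass K) ts) (map (@tclass K) us).
Proof.
split=> [/tclassP/tisoP[-> [vs Pvs Avs]]|[-> Pts]].
  split=> //; move: Avs; rewrite all2_tisoE => /eqP ->.
  exact: perm_map.
apply/tclassP/tisoP; split=> //.
have [x0|] := pselect (inhabited (ptree K)); last first.
  move=> nx; case: ts Pts => [|t ts] Pts; last by case: nx.
  case: us Pts => [|u us] Pts; last by case: nx.
  by exists [::].
case: x0 => x0.
have /(perm_iotaP (tclass x0))[Is PIs e] := Pts.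
have sz : size ts = size Is by move: (congr1 size e); rewrite !size_map.
exists (map (nth x0 us) Is).
  by apply/(perm_iotaP x0); exists Is => //; move: PIs; rewrite size_map.
rewrite all2_tisoE e; apply/eqP; rewrite -map_comp; apply/eq_in_map => i iIs /=.
rewrite (nth_map x0) //.
by move: iIs; rewrite (perm_mem PIs) mem_iota size_map add0n.
Qed.

Definition kids s : seq (utree K) := map (@tclass K) (subtrees (repr s)).
Definition root s : 'I_K := root_type (repr s).

Lemma tclass_repr s : tclass (repr s) = s.
Proof. exact: reprK. Qed.

Lemma tclass_subtrees s : tclass (PNode (root s) (subtrees (repr s))) = s.
Proof. by rewrite -[RHS]tclass_repr /root; case: (repr s). Qed.

Lemma utree_eqP s t : s = t <-> root s = root t /\ perm_eq (kids s) (kids t).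
Proof. by rewrite -[in X in X <-> _](tclass_subtrees s) -[in X in X <-> _](tclass_subtrees t) tclass_node. Qed.

Lemma root_tclass x : root (tclass x) = root_type x.
Proof.
have := tclass_subtrees (tclass x); case: x => a ts.
by case/tclass_node.
Qed.

Lemma kids_tclass x : perm_eq (kids (tclass x)) (map (@tclass K) (subtrees x)).
Proof.
have := tclass_subtrees (tclass x); case: x => a ts.
by case/tclass_node.
Qed.

Definition mktree (a : 'I_K) (ts : seq (utree K)) : utree K :=
  tclass (PNode a (map (fun t => repr t) ts)).

Lemma root_mktree a ts : root (mktree a ts) = a.
Proof. exact: root_tclass. Qed.

Lemma kids_mktree a ts : perm_eq (kids (mktree a ts)) ts.
Proof.
apply: perm_trans (kids_tclass _) _.
by rewrite /= -map_comp (eq_map (g := id)) ?map_id//; exact: tclass_repr.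
Qed.

Lemma QE s t : Q s t = count_mem t (kids s).
Proof. by rewrite /Q /kids count_map. Qed.

Lemma root_graft s t : root (graft s t) = root s.
Proof. exact: root_tclass. Qed.

Lemma kids_graft s t : perm_eq (kids (graft s t)) (t :: kids s).
Proof. by apply: perm_trans (kids_tclass _) _; rewrite /= tclass_repr. Qed.

Lemma graft_tclass (x y : ptree K) :
  graft (tclass x) (tclass y) = tclass (PNode (root_type x) (y :: subtrees x)).
Proof.
apply/utree_eqP; split; first by rewrite root_graft !root_tclass.
apply: perm_trans (kids_graft _ _) _; rewrite perm_sym.
by apply: perm_trans (kids_tclass _) _; rewrite /= perm_cons perm_sym kids_tclass.
Qed.

Lemma graft_inj t : injective (fun s => graft s t).
Proof.
move=> s s' e; apply/utree_eqP.
have /eqP := root_graft s t; rewrite e root_graft eq_sym => /eqP ->; split=> //.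
by rewrite -(perm_cons t) -(permPl (kids_graft s t)) e kids_graft.
Qed.

Lemma Q_gt0 s t : (0 < Q s t)%N -> exists u, graft u t = s.
Proof.
rewrite QE -has_count has_pred1 => ts.
exists (mktree (root s) (rem t (kids s))); apply/utree_eqP.
rewrite root_graft root_mktree; split=> //.
apply: perm_trans (kids_graft _ _) _; rewrite perm_sym.
apply: perm_trans (perm_to_rem ts) _; rewrite perm_cons perm_sym.
exact: kids_mktree.
Qed.

Lemma tbar_inj (T T' : sin_tree K) i :
  (forall j, (j <= i)%N -> tbar T j = tbar T' j) <->
  (forall j, (j <= i)%N -> T j = T' j).
Proof.
split=> e j.
  case: j => [|j] ji; first exact: e 0%N ji.
  by have := e _ ji; rewrite /= (e j (ltnW ji)) => /graft_inj.
elim: j => [|j IH] ji; first exact: e.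
by rewrite /= (IH (ltnW ji)) e.
Qed.

End TreeClasses.

Section ShapeTheory.
Variable K : nat.

Lemma all2P_nthP (S T : Type) (r : T -> S -> Prop) (t0 : T) (x0 : S) ts xs :
  all2P r ts xs <-> size ts = size xs /\ forall i, (i < size xs)%N -> r (nth t0 ts i) (nth x0 xs i).
Proof.
elim: ts xs => [|t ts IH] [|x xs] /=; try by split=> // -[].
split=> [[rtx /IH[-> H]]|[[e] H]].
  by split=> // -[|i] //=; exact: H.
split; first exact: (H 0%N).
by apply/IH; split=> // i; exact: (H i.+1).
Qed.

Lemma is_shape_uniq (V : eqType) (ty : V -> 'I_K) (ch : V -> set V) t x :
  is_shape ty ch t x -> forall t', is_shape ty ch t' x -> tclass t = tclass t'.
Proof.
elim/ptree_mem_ind: t x => a ts IH x /= [<- [xs [uxs cx A]]] [b us] /=.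
move=> [<- [ys [uys cy B]]]; apply/tclass_node; split=> //.
have mxy : xs =i ys.
  move=> z; have : ([set` xs] : set V) z <-> ([set` ys] : set V) z by rewrite -cx -cy.
  by move=> /= h; apply/idP/idP => /h.
have pxy : perm_eq xs ys by exact: uniq_perm.
pose t0 := PNode a ts.
have [sA nA] := (all2P_nthP _ t0 x _ _).1 A.
have [sB nB] := (all2P_nthP _ t0 x _ _).1 B.
pose f z := tclass (nth t0 ts (index z xs)).
have -> : map (@tclass K) ts = map f xs.
  apply: (@eq_from_nth _ (tclass t0)); rewrite !size_map// => i its.
  by rewrite (nth_map t0)// (nth_map x) -?sA// /f index_uniq// -sA.
suff -> : map (@tclass K) us = map f ys by exact: perm_map.
apply: (@eq_from_nth _ (tclass t0)); rewrite !size_map// => i ius.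
rewrite (nth_map t0)// (nth_map x) -?sB// /f.
set z := nth x ys i; have zys : z \in ys by rewrite mem_nth -?sB.
have zxs : z \in xs by rewrite mxy.
have lt : (index z xs < size xs)%N by rewrite index_mem.
apply/esym/(IH (nth t0 ts (index z xs)) _ z); first by rewrite mem_nth// sA.
  by have := nA _ lt; rewrite nth_index.
by apply: nB; rewrite -sB.
Qed.

Lemma is_shape_transfer (V W : eqType) (ty : V -> 'I_K) (ch : V -> set V)
    (ty' : W -> 'I_K) (ch' : W -> set W) (D : set V) (f : V -> W) :
  (forall z, D z -> ch z `<=` D) ->
  (forall z z', D z -> D z' -> f z = f z' -> z = z') ->
  (forall z, D z -> ty' (f z) = ty z) ->
  (forall z, D z -> ch' (f z) = f @` ch z) ->
  forall t x, D x -> is_shape ty ch t x -> is_shape ty' ch' t (f x).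
Proof.
move=> Dch finj fty fch; elim/ptree_mem_ind => a ts IH x Dx /= [<- [xs [uxs cx A]]].
split; first exact: fty.
have Dxs z : z \in xs -> D z by move=> zxs; apply: (Dch x) => //; rewrite cx.
exists (map f xs); split.
- rewrite map_inj_in_uniq// => z z' /Dxs Dz /Dxs Dz'; exact: finj.
- rewrite fch// cx; apply/seteqP; split=> w /=.
    by move=> [z zxs <-]; apply: map_f.
  by move=> /mapP[z zxs ->]; exists z.
- have [sA nA] := (all2P_nthP _ (PNode a ts) x _ _).1 A.
  apply/(all2P_nthP _ (PNode a ts) (f x)); rewrite size_map; split=> // i ixs.
  rewrite (nth_map x)//; apply: IH; last exact: nA.
    by rewrite mem_nth ?sA.
  by apply: Dxs; rewrite mem_nth.
Qed.

Lemma is_shape_ex (V : eqType) (ty : V -> 'I_K) (ch : V -> set V) (D : set V)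
    (m : V -> nat) :
  (forall z, D z -> exists2 xs, uniq xs & ch z = [set` xs]) ->
  (forall z y, D z -> ch z y -> D y /\ (m y < m z)%N) ->
  forall x, D x -> exists t, is_shape ty ch t x.
Proof.
move=> Dfin Dch.
suff H n x : (m x < n)%N -> D x -> exists t, is_shape ty ch t x.
  by move=> x; apply: (H (m x).+1).
elim: n x => // n IH x mx Dx; have [xs uxs cx] := Dfin x Dx.
suff [ts A] : exists ts, all2P (is_shape ty ch) ts xs.
  by exists (PNode (ty x) ts) => /=; split=> //; exists xs.
have {uxs} : forall z, z \in xs -> exists t, is_shape ty ch t z.
  move=> z zxs; have [Dz mz] := Dch x z Dx (eq_ind_r (fun A : set V => A z) zxs cx).
  by apply: IH => //; exact: leq_trans mz mx.
elim: xs {cx} => [|z xs IHxs] H; first by exists [::].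
have [t tz] := H z (mem_head _ _).
have [ts A] := IHxs (fun y yxs => H y (@mem_behead _ (z :: xs) y yxs)).
by exists (t :: ts).
Qed.

Lemma subtree_at_shape (V : eqType) (ty : V -> 'I_K) (ch : V -> set V) t x :
  is_shape ty ch t x -> subtree_at ty ch x = Some (tclass t).
Proof.
move=> tx; rewrite /subtree_at; case: xgetP => [_ _ [t' t'x <-]|].
  by rewrite (is_shape_uniq t'x tx).
by move/(_ (Some (tclass t))) => []; exists t.
Qed.

Lemma subtree_at_Some (V : eqType) (ty : V -> 'I_K) (ch : V -> set V) s x :
  subtree_at ty ch x = Some s -> exists2 t, is_shape ty ch t x & tclass t = s.
Proof.
rewrite /subtree_at; case: xgetP => [_ _ [t tx <-] [<-]|_ //].
by exists t.
Qed.

Lemma subtree_at_transfer (V W : eqType) (ty : V -> 'I_K) (ch : V -> set V)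
    (ty' : W -> 'I_K) (ch' : W -> set W) (D : set V) (f : V -> W) x s :
  (forall z, D z -> ch z `<=` D) ->
  (forall z z', D z -> D z' -> f z = f z' -> z = z') ->
  (forall z, D z -> ty' (f z) = ty z) ->
  (forall z, D z -> ch' (f z) = f @` ch z) ->
  D x -> subtree_at ty ch x = Some s -> subtree_at ty' ch' (f x) = Some s.
Proof.
move=> H1 H2 H3 H4 Dx /subtree_at_Some[t tx <-].
exact/subtree_at_shape/(is_shape_transfer H1 H2 H3 H4).
Qed.

Lemma subtree_at_kids (V : eqType) (ty : V -> 'I_K) (ch : V -> set V) x s
    (xs : seq V) :
  subtree_at ty ch x = Some s -> uniq xs -> ch x = [set` xs] ->
  root s = ty x /\
  (forall z, z \in xs -> exists t, subtree_at ty ch z = Some t) /\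
  (forall t, Q s t = count (fun z => subtree_at ty ch z == Some t) xs) /\
  size (kids s) = size xs.
Proof.
move=> /subtree_at_Some[[a ts] /= [<- [ys [uys cy A]]] <-] uxs cx.
have pxy : perm_eq xs ys.
  apply: uniq_perm => // z.
  have : ([set` xs] : set V) z <-> ([set` ys] : set V) z by rewrite -cx -cy.
  by move=> /= h; apply/idP/idP => /h.
have E : map Some (map (@tclass K) ts) = map (subtree_at ty ch) ys.
  elim: ts ys A {uys cy pxy} => [|t ts IH] [|y ys] //= [/subtree_at_shape -> A].
  by rewrite (IH ys).
split; first by rewrite root_tclass.
split=> [z|].
  rewrite (perm_mem pxy) => /(map_f (subtree_at ty ch)).
  by rewrite -E => /mapP[t _ ->]; exists t.
split; last first.
  rewrite (perm_size (kids_tclass _)) (perm_size pxy) /=.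
  by have := congr1 size E; rewrite !size_map.
move=> t; rewrite QE (permP (kids_tclass _)) /= (permP pxy).
transitivity (count (pred1 (Some t)) (map (subtree_at ty ch) ys)).
  rewrite -E [RHS]count_map; apply: eq_count => z /=.
  by apply/eqP/eqP => [->//|[]].
by rewrite count_map.
Qed.

Lemma subtree_at_graft (V : eqType) (ty : V -> 'I_K) (ch : V -> set V)
    (m : V -> nat) x y s t :
  (forall z w, ch z w -> (m z < m w)%N) ->
  (forall z z' w, ch z w -> ch z' w -> z = z') ->
  ch x y ->
  subtree_at ty (fun z => ch z `\ y) x = Some t -> subtree_at ty ch y = Some s ->
  subtree_at ty ch x = Some (graft t s).
Proof.
move=> mlt chf xy /subtree_at_Some[[a ts] /= [<- [xs [uxs cx A]]] <-].
move=> /subtree_at_Some[u uy <-]; rewrite graft_tclass; apply: subtree_at_shape.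
split=> //; exists (y :: xs); split=> /=.
- rewrite uxs andbT; apply/negP => yxs.
  by have : [set` xs] y by []; rewrite -cx => -[_]; apply.
- apply/seteqP; split=> z /=; rewrite inE.
    move=> xz; have [->|zy] := eqVneq z y; first by [].
    suff : [set` xs] z by move=> /= ->.
    by rewrite -cx; split=> //; apply/eqP.
  move=> /predU1P[->//|zxs].
  by have : [set` xs] z by []; rewrite -cx => -[].
- split=> //.
  have H z : z \in xs -> (m x < m z)%N.
    by move=> zxs; have : [set` xs] z by []; rewrite -cx => -[/mlt].
  elim: ts xs A H {uxs cx} => [|v ts IH] [|z xs] //= [vz A] H; split; last first.
    by apply: IH => // w wxs; apply: H; rewrite inE wxs orbT.
  pose D := [set z : V | (m x < m z)%N].
  apply: (@is_shape_transfer V V ty (fun z => ch z `\ y) ty ch D id _ _ _ _ v z) => //.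
  - by move=> w Dw w' [/mlt ww' _]; exact: ltn_trans ww'.
  - move=> w Dw; rewrite image_id; apply/seteqP; split=> w' //=; last by case.
    move=> ww'; split=> // e; move: Dw; rewrite e in ww'.
    by rewrite (chf _ _ _ ww' xy) /D /= ltnn.
  - exact/H/mem_head.
Qed.

End ShapeTheory.

(** * Fringe trees of a network *)

Section Genealogy.
Variables (K : nat) (a0 : 'I_K).
Implicit Types (g h : rtree K) (v w x y : nat).

Definition ty g v : 'I_K := (nth (a0, 0%N) g v).1.
Definition par g v : nat := (nth (a0, 0%N) g v).2.
Definition nch g v : nat := count (fun e : 'I_K * nat => e.2 == v) (behead g).
Definition chl g v : set nat := [set y | (0 < y < size g)%N /\ par g y = v].
Definition vshape g v : option (utree K) := subtree_at (ty g) (chl g) v.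

Lemma wfP g : reflect ((0 < size g)%N /\
    forall v, (0 < v < size g)%N -> (par g v < v)%N) (wf g).
Proof.
rewrite /wf; apply: (iffP andP) => -[g0 H]; split=> //.
  move=> v /andP[v0 vg]; move/forallP/(_ (Ordinal vg))/implyP/(_ v0) : H.
  by rewrite (tnth_nth (a0, 0%N)).
by apply/forallP => v; apply/implyP => v0; rewrite (tnth_nth (a0, 0%N)); apply: H; rewrite v0/=.
Qed.

Lemma ty_rcons g e v : ty (rcons g e) v =
  if (v < size g)%N then ty g v else if v == size g then e.1 else a0.
Proof. by rewrite /ty nth_rcons; case: ifP => //; case: ifP. Qed.

Lemma par_rcons g e v : par (rcons g e) v =
  if (v < size g)%N then par g v else if v == size g then e.2 else 0%N.
Proof. by rewrite /par nth_rcons; case: ifP => //; case: ifP. Qed.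

Lemma nch_rcons g e v : (0 < size g)%N -> nch (rcons g e) v = (nch g v + (e.2 == v))%N.
Proof. by case: g => // e' g _; rewrite /nch/= -cats1 count_cat/= addn0. Qed.

Lemma wf_rcons g e : (0 < size g)%N -> wf (rcons g e) = wf g && (e.2 < size g)%N.
Proof.
move=> g0; apply/wfP/andP => [[_ H]|[/wfP[_ H] eg]].
  split.
    apply/wfP; split=> // v /andP[v0 vg]; have := H v; rewrite size_rcons v0/= ltnS.
    by rewrite par_rcons vg; apply; exact: ltnW.
  by have := H (size g); rewrite size_rcons g0/= ltnSn par_rcons ltnn eqxx; apply.
rewrite size_rcons; split=> // v /andP[v0]; rewrite ltnS leq_eqVlt par_rcons.
case/predU1P => [->|vg]; first by rewrite ltnn eqxx.
by rewrite vg; apply: H; rewrite v0.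
Qed.

Lemma nch_size g v : wf g -> (size g <= v)%N -> nch g v = 0%N.
Proof.
elim/last_ind: g => // g e IH.
have [g0|g0] := posnP (size g); first by case: g IH g0 => [|e' g] //= *; rewrite /nch.
rewrite wf_rcons// size_rcons => /andP[wg eg] gv.
by rewrite nch_rcons// (IH wg (ltnW gv)); have /negbTE -> : e.2 != v by apply/eqP; lia.
Qed.

Lemma nchE g v : nch g v = (\sum_(0 <= w < size g) ((0 < w) && (par g w == v)))%N.
Proof.
elim/last_ind: g => [|g e IH]; first by rewrite big_nil.
rewrite size_rcons big_nat_recr//= par_rcons ltnn eqxx.
have [g0|g0] := posnP (size g).
  by rewrite g0 big_nil; case: g g0 IH => [|e' g] //=; rewrite /nch.
rewrite nch_rcons// IH; congr addn.
by apply: eq_big_nat => w /andP[_ wg]; rewrite par_rcons wg.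
Qed.

Section Ordinals.
Variable g : rtree K.
Hypothesis wg : wf g.
Implicit Types (u z : 'I_(size g)).

Lemma vtypeE u : vtype u = ty g u.
Proof. by rewrite /vtype (tnth_nth (a0, 0%N)). Qed.

Lemma parent_eq u z : (parent u == Some z) = (0 < u)%N && (par g u == z).
Proof.
rewrite /parent (tnth_nth (a0, 0%N)) -/(par g u) lt0n.
have [//|u0] := eqVneq (nat_of_ord u) 0%N; have /wfP[_ H] := wg.
have u0' : (0 < u < size g)%N by rewrite lt0n ltn_ord andbT.
have pg : (par g u < size g)%N := ltn_trans (H _ u0') (ltn_ord u).
by rewrite (insubT (fun i => i < size g)%N pg)/=; apply/eqP/eqP => [[<-]//|e]; congr Some; exact: val_inj.
Qed.

Lemma children_lt u z : children u z -> (u < z)%N.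
Proof.
move=> /eqP; rewrite parent_eq => /andP[z0 /eqP <-].
by have /wfP[_ H] := wg; apply: H; rewrite z0/=.
Qed.

Lemma subtree_at_fin (ch : 'I_(size g) -> set 'I_(size g)) u :
  (forall z, ch z `<=` children z) ->
  exists t, subtree_at (@vtype K g) ch u = Some t.
Proof.
move=> chs.
have [t ut] : exists t, is_shape (@vtype K g) ch t u.
  apply: (@is_shape_ex K _ _ ch setT (fun z => size g - z)%N) => //.
    move=> z _; exists [seq y <- enum 'I_(size g) | y \in ch z].
      by rewrite filter_uniq// enum_uniq.
    apply/seteqP; split=> y /=; first by move=> zy; rewrite mem_filter mem_enum andbT inE.
    by rewrite mem_filter => /andP[]; rewrite inE.
  move=> z y _ /chs /children_lt zy; split=> //.
  have := ltn_ord y; lia.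
by exists (tclass t); exact: subtree_at_shape.
Qed.

Lemma fringe_part0E u : fringe_part u 0 = vshape g u.
Proof.
have [t ut] := @subtree_at_fin (@children K g) u (fun _ => @subset_refl _ _).
rewrite /= ut; apply/esym; move: ut.
apply: (@subtree_at_transfer _ _ _ _ _ _ _ setT) => //.
- by move=> z z' _ _; exact: val_inj.
- by move=> z _; rewrite vtypeE.
- move=> z _; apply/seteqP; split=> y /=.
    move=> [/andP[y0 yg] yz]; exists (Ordinal yg) => //.
    by apply/eqP; rewrite parent_eq y0/= yz.
  by move=> [y' /eqP + <-]; rewrite parent_eq => /andP[y0 /eqP e]; split=> //=; rewrite y0 ltn_ord.
Qed.

Lemma vshape_ex v : (v < size g)%N -> exists t, vshape g v = Some t.
Proof.
move=> vg; have [t ut] := @subtree_at_fin (@children K g) (Ordinal vg) (fun _ => @subset_refl _ _).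
by exists t; rewrite -ut -[LHS](fringe_part0E (Ordinal vg)).
Qed.

Definition fr u : utree K := odflt (mktree a0 [::]) (vshape g u).

Lemma vshape_fr u : vshape g u = Some (fr u).
Proof. by rewrite /fr; have [t ->] := vshape_ex (ltn_ord u). Qed.

Lemma Q_fr u t : Q (fr u) t = #|[set z | (parent z == Some u) && (fr z == t)]%SET|.
Proof.
pose xs := [seq y <- enum 'I_(size g) | parent y == Some u].
have := @subtree_at_kids K _ (@vtype K g) (@children K g) u (fr u) xs.
rewrite -[subtree_at _ _ _]/(fringe_part u 0) fringe_part0E vshape_fr.
case=> //; first by rewrite filter_uniq// enum_uniq.
  apply/seteqP; split=> y /=; rewrite mem_filter mem_enum andbT; first by move=> ->.
  by move=> /eqP.
move=> _ [_ [-> _]]; rewrite cardE /enum_mem size_filter /xs count_filter enumT; apply: eq_count => z.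
rewrite /= !inE -[subtree_at _ _ _]/(fringe_part z 0) fringe_part0E vshape_fr andbC.
by congr andb; apply/eqP/eqP => [[]|->].
Qed.

Fixpoint chain k (s : nat -> utree K) u : bool :=
  (fr u == s 0%N) &&
  if k is k'.+1 then
    if parent u is Some z then chain k' (fun i => s i.+1) z else false
  else true.

Lemma card_chain k s : #|[set u | chain k s u]%SET| =
  (#|[set u | fr u == s k]%SET| * \prod_(1 <= j < k.+1) Q (s j) (s j.-1))%N.
Proof.
elim: k s => [|k IH] s.
  rewrite big_nil muln1; apply: eq_card => u; by rewrite !inE/= andbT.
rewrite big_nat_recl// mulnCA.
under eq_big_nat => j /andP[j0 _] do rewrite -[in X in Q _ (s X)](prednK j0)/=.
rewrite -(IH (fun i => s i.+1)).
rewrite -!sum1dep_card.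
rewrite (partition_big (fun u => odflt u (parent u)) (fun z => chain k (fun i => s i.+1) z))/=; last first.
  by move=> u /andP[_]; case: (parent u).
rewrite mulnC big_distrl/=; apply: eq_bigr => z cz.
have -> : s 1%N = fr z by case: k cz {IH} => [|k] /= /andP[/eqP].
rewrite mul1n Q_fr -sum1dep_card; apply: eq_bigl => u.
case E : (parent u) => [z'|] /=; last by rewrite andbF.
have [zz|nz] := eqVneq z' z; first by rewrite zz eqxx cz !andbT.
by rewrite andbF; apply/esym/negbTE; apply: contra nz => /andP[/eqP[->]].
Qed.

Lemma ancestorS u i : ancestor u i.+1 = obind (fun z => ancestor z i) (parent u).
Proof.
rewrite /ancestor iterSr/=; case: (parent u) => //=.
by elim: i => //= i ->.
Qed.

Lemma chainP k s u : chain k s u <->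
  forall i, (i <= k)%N -> omap fr (ancestor u i) = Some (s i).
Proof.
elim: k s u => [|k IH] s u.
  rewrite /= andbT; split=> [/eqP e [|i]//|/(_ 0%N isT) [->]//].
  by rewrite /= e.
rewrite [chain _ _ _]/=; split.
  move=> /andP[/eqP e]; case E : (parent u) => [z|//] /IH H [|i] ik; first by rewrite /= e.
  by rewrite ancestorS E/= H.
move=> H; have /= [->] := H 0%N isT; rewrite eqxx/=.
case E : (parent u) => [z|]; last by have := H 1%N isT; rewrite ancestorS E.
by apply/IH => i ik; have := H i.+1 ik; rewrite ancestorS E.
Qed.

Lemma fringe_partS u i (y : 'I_(size g)) t : ancestor u i = Some y ->
  omap fr (ancestor u i.+1) = Some (graft t (fr y)) <->
  fringe_part u i.+1 = Some t.
Proof.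
move=> E; rewrite /fringe_part E.
have -> : ancestor u i.+1 = parent y by rewrite /ancestor/= -/(ancestor u i) E.
case Ey : (parent y) => [x|//=].
have [t' Et'] := @subtree_at_fin (fun z => children z `\ y) x (fun z (w : 'I_(size g)) => @proj1 (children z w) (~ [set y] w)).
rewrite Et' /=.
have := @subtree_at_graft K _ (@vtype K g) (@children K g) (@nat_of_ord (size g)) x y (fr y) t' children_lt.
rewrite -[subtree_at _ (@children K g) y]/(fringe_part y 0).
rewrite -[subtree_at _ (@children K g) x]/(fringe_part x 0).
rewrite !fringe_part0E !vshape_fr => H.
have fu z z' (w : 'I_(size g)) : children z w -> children z' w -> z = z'.
  by rewrite /children/= => -> [].
have [->] := H fu Ey Et' erefl.
by split=> [[/graft_inj->]|[->]].
Qed.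

Lemma extended_fringe_chain k (T : sin_tree K) u :
  (extended_fringe k u == extended_fringe_sin k T) = chain k (tbar T) u.
Proof.
have H0 : (extended_fringe k u == extended_fringe_sin k T) <->
    forall i, (i <= k)%N -> fringe_part u i = Some (T i).
  split=> [/eqP e i|H].
    rewrite -ltnS => ik; have := congr1 (fun X : _.-tuple _ => tnth X (Ordinal ik)) e.
    by rewrite !tnth_mktuple.
  by apply/eqP/eq_from_tnth => i; rewrite !tnth_mktuple H// -ltnS.
apply/idP/idP; rewrite chainP H0 => H; elim=> [|i IH] ik.
- by have := H 0%N isT; rewrite fringe_part0E vshape_fr/= => -[->].
- have := IH (ltnW ik); case E : (ancestor u i) => [y|//] [yi].
  by have := (fringe_partS (T i.+1) E).2 (H _ ik); rewrite yi.
- by have := H 0%N isT; rewrite fringe_part0E vshape_fr/= => -[->].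
- have := H _ (ltnW ik); case E : (ancestor u i) => [y|//] [yi].
  by apply/(fringe_partS (T i.+1) E); rewrite yi; exact: H.
Qed.

End Ordinals.
End Genealogy.

(** * Descendants and their histories *)

Section Histories.
Variables (K : nat) (a0 : 'I_K).
Implicit Types (g h : rtree K) (v w x y : nat).
Local Notation ty := (ty a0).
Local Notation par := (par a0).
Local Notation chl := (chl a0).
Local Notation vshape := (vshape a0).

Fixpoint dsc_rev v g : seq nat :=
  if g is e :: g' then
    if size g' == v then [:: v]
    else if e.2 \in dsc_rev v g' then rcons (dsc_rev v g') (size g')
    else dsc_rev v g'
  else [::].

(* The descendants of v, in the order of arrival. *)
Definition dsc v g := dsc_rev v (rev g).

Fixpoint hist_rev v g : rtree K :=
  if g is e :: g' then
    if size g' == v then [:: (e.1, 0%N)]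
    else if e.2 \in dsc_rev v g'
    then rcons (hist_rev v g') (e.1, index e.2 (dsc_rev v g'))
    else hist_rev v g'
  else [::].

(* The network formed by the descendants of v, relabelled by 0, 1, 2, ... in the
   order of arrival. *)
Definition hist v g := hist_rev v (rev g).

Lemma dsc_rcons v g e : dsc v (rcons g e) =
  if size g == v then [:: v]
  else if e.2 \in dsc v g then rcons (dsc v g) (size g) else dsc v g.
Proof. by rewrite /dsc rev_rcons/= size_rev. Qed.

Lemma hist_rcons v g e : hist v (rcons g e) =
  if size g == v then [:: (e.1, 0%N)]
  else if e.2 \in dsc v g then rcons (hist v g) (e.1, index e.2 (dsc v g))
  else hist v g.
Proof. by rewrite /hist /dsc rev_rcons/= size_rev. Qed.

Lemma size_hist v g : size (hist v g) = size (dsc v g).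
Proof.
elim/last_ind: g => // g e IH; rewrite hist_rcons dsc_rcons.
by case: ifP => // _; case: ifP => // _; rewrite !size_rcons IH.
Qed.

Lemma dsc_bound v g x : x \in dsc v g -> (v <= x < size g)%N.
Proof.
elim/last_ind: g x => // g e IH x; rewrite dsc_rcons size_rcons.
case: eqP => [<-|ne]; first by rewrite inE => /eqP ->; rewrite leqnn ltnS/=.
case: ifP => [/IH ed|_ /IH]; last by lia.
by rewrite mem_rcons inE => /predU1P[->|/IH]; lia.
Qed.

Lemma dsc_nil v g : (size g <= v)%N -> dsc v g = [::].
Proof.
move=> gv; case E : (dsc v g) => [//|x s].
by have := @dsc_bound v g x; rewrite E mem_head => /(_ isT); lia.
Qed.

Lemma dsc_uniq v g : uniq (dsc v g).
Proof.
elim/last_ind: g => // g e IH; rewrite dsc_rcons; case: ifP => // _.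
case: ifP => // _; rewrite rcons_uniq IH andbT.
by apply/negP => /dsc_bound; lia.
Qed.

Lemma dsc_head v g : (v < size g)%N -> exists s, dsc v g = v :: s.
Proof.
elim/last_ind: g => // g e IH; rewrite size_rcons dsc_rcons.
case: eqP => [_ _|ne vg]; first by exists [::].
have [|s ->] := IH; first lia.
by case: ifP => _; [exists (rcons s (size g))|exists s].
Qed.

Lemma dsc_self v g : (v < size g)%N -> v \in dsc v g.
Proof. by move=> /dsc_head[s ->]; exact: mem_head. Qed.

Lemma dsc_nested v v' w g : (v < v')%N -> w \in dsc v g -> w \in dsc v' g ->
  {subset dsc v' g <= dsc v g}.
Proof.
move=> vv'; elim/last_ind: g w => // g e IH w; rewrite !dsc_rcons.
have [gv|gv] := eqVneq (size g) v.
  have -> : (size g == v') = false by apply/eqP; lia.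
  rewrite (@dsc_nil v' g); last by lia.
  by rewrite in_nil.
have [gv'|gv'] := eqVneq (size g) v'.
  by move=> wd; rewrite inE => /eqP wv'; move=> x; rewrite inE => /eqP ->; rewrite -wv'.
have ng u : size g \notin dsc u g by apply/negP => /dsc_bound; lia.
have sub x u : x \in (if e.2 \in dsc u g then rcons (dsc u g) (size g) else dsc u g) ->
   x \in dsc u g \/ x = size g /\ e.2 \in dsc u g.
  by case: ifP => ed; [rewrite mem_rcons inE => /predU1P[->|]|]; auto.
move=> /sub wv /sub wv'.
have {wv wv'} H : {subset dsc v' g <= dsc v g}.
  case: wv => [wv|[we ev]]; case: wv' => [wv'|[we' ev']].
  - exact: IH wv wv'.
  - by rewrite we' (negbTE (ng _)) in wv.
  - by rewrite we (negbTE (ng _)) in wv'.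
  - exact: IH ev ev'.
move=> x /sub[/H xv|[-> /H ->]]; last by rewrite mem_rcons mem_head.
by case: ifP => //; rewrite mem_rcons inE xv orbT.
Qed.

Lemma dsc_size_inj v v' w g : w \in dsc v g -> w \in dsc v' g ->
  size (dsc v g) = size (dsc v' g) -> v = v'.
Proof.
wlog vv' : v v' / (v < v')%N.
  move=> H wv wv' e; have [vv'|vv'|//] := ltngtP v v'; first exact: H.
  by apply/esym/H.
move=> wv wv' e; have vg : (v < size g)%N by have := dsc_bound wv; lia.
have vd : v \notin dsc v' g by apply/negP => /dsc_bound; lia.
have := @uniq_leq_size _ (v :: dsc v' g) (dsc v g).
rewrite /= vd dsc_uniq e ltnn => /(_ isT)/=; suff: {subset v :: dsc v' g <= dsc v g} by move=> s /(_ s).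
move=> x; rewrite inE => /predU1P[->|]; first exact: dsc_self.
exact: dsc_nested wv wv' _.
Qed.

Lemma sum_dsc_le1 n w g (I : pred nat) :
  (forall v, I v -> size (dsc v g) = n) ->
  (\sum_(0 <= v < size g) (I v && (w \in dsc v g)) <= 1)%N.
Proof.
move=> In; have [[v /andP[vI wv]]|no] := pselect (exists v, I v && (w \in dsc v g)).
  rewrite (eq_bigr (fun v' => if v' == v then 1%N else 0%N)).
    rewrite -big_mkcond/= big_nat1_eq; by case: ifP.
  move=> v' _; case: eqP => [->|ne]; first by rewrite vI wv.
  apply/eqP; rewrite eqb0; apply/negP => /andP[v'I wv']; apply: ne.
  by apply: (dsc_size_inj wv' wv); rewrite !In.
rewrite big1// => v _; apply/eqP; rewrite eqb0; apply/negP => H; apply: no.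
by exists v.
Qed.

Definition cnt h g : nat := (\sum_(0 <= v < size g) (hist v g == h))%N.

Lemma cnt_rcons h g e :
  (cnt h (rcons g e) + \sum_(0 <= v < size g) ((hist v g == h) && (e.2 \in dsc v g)) =
   cnt h g + ([:: (e.1, 0%N)] == h) +
   \sum_(0 <= v < size g)
      ((rcons (hist v g) (e.1, index e.2 (dsc v g)) == h) && (e.2 \in dsc v g)))%N.
Proof.
rewrite /cnt size_rcons big_nat_recr//= hist_rcons eqxx.
rewrite addnAC [RHS]addnAC; congr addn.
rewrite -!big_split/=; apply: eq_big_nat => v /andP[_ vg].
rewrite hist_rcons gtn_eqF//.
by case: ifP => _; rewrite ?andbT ?andbF ?addn0// addnC.
Qed.

Section Relabelling.
Variable g : rtree K.
Hypothesis wg : wf g.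

Lemma dsc_closed v y : (0 < y < size g)%N -> par g y \in dsc v g -> y \in dsc v g.
Proof.
elim/last_ind: g wg y => // g' e IH; have [g0|g0] := posnP (size g').
  by move=> _ y; rewrite size_rcons g0; lia.
rewrite wf_rcons// size_rcons => /andP[wg' eg'] y /andP[y0 yg].
rewrite par_rcons !dsc_rcons.
have [yg'|ng] := ltnP y (size g').
  have /(wfP a0)[_ H] := wg'; have py : (par g' y < y)%N by apply: H; rewrite y0.
  case: eqP => [gv|gv]; first by rewrite inE => /eqP; lia.
  case: ifP => _; last by apply: IH; rewrite // y0.
  rewrite !mem_rcons !inE => /predU1P[|pd]; first lia.
  by rewrite IH ?orbT// y0.
have -> : y = size g' by lia.
rewrite eqxx; case: eqP => [gv|gv]; first by rewrite inE => /eqP; lia.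
case: ifP => [ed _|ed]; first by rewrite mem_rcons mem_head.
by rewrite ed.
Qed.

Lemma hist_ty v i : (i < size (dsc v g))%N -> ty (hist v g) i = ty g (nth 0%N (dsc v g) i).
Proof.
elim/last_ind: g i => // g' e IH i; rewrite hist_rcons dsc_rcons.
case: eqP => [<-|gv].
  by case: i => // _; rewrite /= ty_rcons ltnn eqxx.
have lt x : x \in dsc v g' -> (x < size g')%N by move=> /dsc_bound /andP[].
case: ifP => ed; rewrite ?size_rcons => idx.
  rewrite !ty_rcons nth_rcons size_hist.
  have [lti|] := ltnP i (size (dsc v g')); first by rewrite lt ?mem_nth// IH.
  move=> ge; have -> : i = size (dsc v g') by lia.
  by rewrite eqxx ltnn eqxx.
by rewrite [RHS]ty_rcons lt ?mem_nth// IH.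
Qed.

Lemma hist_par v i : (0 < i < size (dsc v g))%N ->
  (par (hist v g) i < i)%N /\
  par g (nth 0%N (dsc v g) i) = nth 0%N (dsc v g) (par (hist v g) i).
Proof.
elim/last_ind: g i => [i|g' e IH i]; first by rewrite ltn0 andbF.
 rewrite hist_rcons dsc_rcons.
case: eqP => [<-|gv] /=; first lia.
have lt x : x \in dsc v g' -> (x < size g')%N by move=> /dsc_bound /andP[].
case: ifP => ed; rewrite ?size_rcons => /andP[i0 idx].
  rewrite !par_rcons !nth_rcons size_hist.
  have [lti|gei] := ltnP i (size (dsc v g')).
    have [|pi ->] := IH i; first by rewrite i0.
    by rewrite lt ?mem_nth// (ltn_trans pi lti).
  have -> : i = size (dsc v g') by lia.
  by rewrite eqxx ltnn eqxx index_mem ed nth_index.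
have [|pi e'] := IH i; first by rewrite i0.
by rewrite par_rcons lt ?mem_nth.
Qed.

Lemma hist_wf v : (v < size g)%N -> wf (hist v g).
Proof.
move=> vg; apply/(wfP a0); rewrite size_hist; split.
  by have [s ->] := dsc_head vg.
by move=> i /hist_par[].
Qed.

Lemma hist_chl v i : (i < size (dsc v g))%N ->
  chl g (nth 0%N (dsc v g) i) = nth 0%N (dsc v g) @` chl (hist v g) i.
Proof.
move=> idx; apply/seteqP; split=> y /=.
  move=> [yg py].
  have yd : y \in dsc v g by apply: dsc_closed => //; rewrite py mem_nth.
  exists (index y (dsc v g)); last by rewrite nth_index.
  have iy : (index y (dsc v g) < size (dsc v g))%N by rewrite index_mem.
  have i0 : (0 < index y (dsc v g))%N.
    rewrite lt0n; apply/negP => /eqP e0.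
    have yv : y = v.
      have [s E] : exists s, dsc v g = v :: s.
        by apply: dsc_head; have := dsc_bound yd; lia.
      by rewrite -(nth_index 0%N yd) e0 E.
    have /(wfP a0)[_ H] := wg; have := H _ yg; rewrite py yv.
    by have /andP[vi _] := dsc_bound (mem_nth 0%N idx); rewrite ltnNge vi.
  have i0' : (0 < index y (dsc v g) < size (dsc v g))%N by rewrite i0.
  split; first by rewrite size_hist.
  have [pi] := hist_par i0'; rewrite nth_index// py => /eqP.
  rewrite nth_uniq ?dsc_uniq// => [/eqP ->//|]; exact: ltn_trans pi iy.
move=> [j [jh pj] <-]; rewrite size_hist in jh.
have [_ e] := hist_par jh; split; last by rewrite e pj.
have /andP[j0 jd] := jh.
have /dsc_bound/andP[_ ->] := mem_nth 0%N jd; rewrite andbT.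
have [s E] : exists s, dsc v g = v :: s.
  by apply: dsc_head; have := dsc_bound (mem_nth 0%N jd); lia.
have : nth 0%N (dsc v g) j != nth 0%N (dsc v g) 0.
  by rewrite nth_uniq ?dsc_uniq// -?lt0n// (ltn_trans j0 jd).
rewrite {2}E/= => ne; rewrite lt0n; apply: contra ne => /eqP e0.
by have /andP[+ _] := dsc_bound (mem_nth 0%N jd); rewrite e0 leqn0 => /eqP ->.
Qed.

End Relabelling.

Lemma hist_nch g v i : wf g -> (i < size (dsc v g))%N -> nch (hist v g) i = nch g (nth 0%N (dsc v g) i).
Proof.
elim/last_ind: g i => // g' e IH i wg'; rewrite hist_rcons dsc_rcons.
have [g0|g0] := posnP (size g').
  case: g' g0 {IH wg'} => //= _; case: ifP => //= _.
move: wg'; rewrite wf_rcons// => /andP[wg' eg'].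
case: eqP => [<-|gv].
  by case: i => // _; rewrite /= nch_rcons// [in RHS](nch_size a0)// ltn_eqF.
have lt x : x \in dsc v g' -> (x < size g')%N by move=> /dsc_bound /andP[].
case: ifP => ed; rewrite ?size_rcons => idx; last first.
  rewrite nch_rcons// IH//; case: eqP => [e'|_]; last by rewrite addn0.
  by rewrite e' mem_nth in ed.
have h0 : (0 < size (hist v g'))%N by rewrite size_hist; case: (dsc v g') ed.
have vg : (v < size g')%N by have := dsc_bound ed; lia.
rewrite !nch_rcons// nth_rcons; have [lti|gei] := ltnP i (size (dsc v g')).
  rewrite IH//=; congr addn; congr nat_of_bool.
  apply/eqP/eqP => [<-|->]; first by rewrite nth_index.
  by rewrite index_uniq ?dsc_uniq.
have -> : i = size (dsc v g') by lia.
have -> : nch (hist v g') (size (dsc v g')) = 0%N.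
  by rewrite (nch_size a0) ?size_hist//; exact: hist_wf.
rewrite eqxx (nch_size a0 wg' (leqnn _)) !add0n [in RHS]ltn_eqF//=.
by rewrite ltn_eqF ?index_mem.
Qed.

Section Relabelling2.
Variable g : rtree K.
Hypothesis wg : wf g.

Lemma hist_shape v : (v < size g)%N -> vshape (hist v g) 0 = vshape g v.
Proof.
move=> vg; have [s E] := dsc_head vg.
have [t ht] : exists t, vshape (hist v g) 0 = Some t.
  by apply: (vshape_ex a0 (hist_wf wg vg)); rewrite size_hist E.
rewrite ht; apply/esym; rewrite -[v in LHS]/(nth 0%N (v :: s) 0) -E.
apply: (@subtree_at_transfer K _ _ (ty (hist v g)) (chl (hist v g)) _ _
  [set i | (i < size (dsc v g))%N] (nth 0%N (dsc v g))) ht => //=.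
- by move=> i _ y /= [+ _]; rewrite size_hist => /andP[].
- by move=> i j id jd /eqP; rewrite nth_uniq ?dsc_uniq// => /eqP.
- by move=> i id; rewrite hist_ty.
- by move=> i id; rewrite hist_chl.
- by rewrite E.
Qed.

Lemma size_dsc0 : size (dsc 0 g) = size g.
Proof.
have H y : (y < size g)%N -> y \in dsc 0 g.
  elim/ltn_ind: y => y IH yg; have [->|y0] := posnP y.
    by apply: dsc_self; case: g wg.
  apply: (dsc_closed wg); first by rewrite y0.
  have /(wfP a0)[_ P] := wg; have py : (par g y < y)%N by apply: P; rewrite y0.
  by apply: IH => //; exact: ltn_trans yg.
apply/eqP; rewrite eqn_leq; apply/andP; split.
  rewrite -[leqRHS](size_iota 0); apply: uniq_leq_size (dsc_uniq _ _) _ => x /dsc_bound.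
  by rewrite mem_iota.
rewrite -[leqLHS](size_iota 0); apply: uniq_leq_size (iota_uniq _ _) _ => x.
by rewrite mem_iota => /H.
Qed.

End Relabelling2.

Definition cls h : utree K := odflt (mktree a0 [::]) (vshape h 0).

Lemma shape_cls h : wf h -> vshape h 0 = Some (cls h).
Proof.
move=> wh; have /(wfP a0)[h0 _] := wh.
by rewrite /cls; have [t ->] := vshape_ex a0 wh h0.
Qed.

Lemma fr_hist g (u : 'I_(size g)) : wf g -> fr a0 u = cls (hist u g).
Proof. by move=> wg; rewrite /cls hist_shape. Qed.

Lemma size_kids_cls h : wf h -> size (kids (cls h)) = nch h 0.
Proof.
move=> wh; pose xs := [seq y <- iota 0 (size h) | (0 < y)%N && (par h y == 0%N)].
have [||_ [_ [_ ->]]] := subtree_at_kids (shape_cls wh) (xs := xs).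
- by rewrite filter_uniq// iota_uniq.
- apply/seteqP; split=> y /=; rewrite mem_filter mem_iota/= add0n.
    by move=> [/andP[-> ->] ->].
  by move=> /andP[/andP[y0 /eqP e] yh]; split=> //; rewrite y0.
rewrite (nchE a0) /xs size_filter -sum1_count big_mkcond/= /index_iota subn0.
by apply: eq_bigr => y _; case: ifP.
Qed.

End Histories.

(** * Probabilities of histories *)

Section Decay.
Variable R : realType.

Lemma harmonic_unbounded (M : R) : exists n, M <= \sum_(0 <= i < n) i.+1%:R^-1.
Proof.
have H : series (@harmonic R) @ \oo --> +oo.
  apply: nondecreasing_dvgn_lt; last exact: dvg_harmonic.
  by apply: nondecreasing_series => n _ _; exact: harmonic_ge0.
have /cvgryPge/(_ M) [n _ /(_ n (leqnn n))] := H.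
by exists n.
Qed.

Lemma harmonic_decay (u : nat -> R) (k : R) : 0 < k ->
  (forall n, 0 <= u n) -> (forall n, u n.+1 <= u n * (1 - k / n.+1%:R)) ->
  u @ \oo --> (0 : R).
Proof.
move=> k0 u0 us; pose H n : R := \sum_(0 <= i < n) i.+1%:R^-1.
have H0 n : 0 <= H n by apply: sumr_ge0 => i _; rewrite invr_ge0.
have uH n : u n * (1 + k * H n) <= u 0%N.
  elim: n => [|n IH]; first by rewrite /H big_nil mulr0 addr0 mulr1.
  apply: le_trans IH; rewrite /H big_nat_recr//= -/(H n) -[_%:R^-1]/(n.+1%:R^-1).
  set x : R := n.+1%:R^-1; have x0 : 0 < x by rewrite invr_gt0.
  have := us n; rewrite -/x => un.
  have kH : 0 <= k * H n by rewrite mulr_ge0// ltW.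
  apply: (@le_trans _ _ (u n * (1 - k * x) * (1 + k * (H n + x)))).
    by apply: ler_wpM2r => //; rewrite mulrDr addrA addr_ge0 ?addr_ge0// mulr_ge0// ltW.
  rewrite -mulrA ler_wpM2l//.
  have : 0 <= k * x * (k * H n) + (k * x) ^+ 2.
    by rewrite addr_ge0 ?sqr_ge0// mulr_ge0// mulr_ge0// ltW.
  lra.
have un n m : (n <= m)%N -> u m <= u n.
  move=> nm; elim: m nm => [|m IH]; first by rewrite leqn0 => /eqP ->.
  rewrite leq_eqVlt => /predU1P[->//|/IH]; apply: le_trans.
  by apply: le_trans (us m) _; rewrite ler_piMr// lerBlDr lerDl divr_ge0// ltW.
apply/cvgrPdist_le => e e0; have [n Hn] := harmonic_unbounded (u 0%N / (k * e)).
exists n => // m /= nm; rewrite sub0r normrN ger0_norm//.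
apply: le_trans (un _ _ nm) _.
have h : u 0%N <= e * (1 + k * H n).
  rewrite mulrDr mulr1; apply: ler_wpDl; first exact: ltW.
  by move: Hn; rewrite -/(H n) ler_pdivrMr ?mulr_gt0//; lra.
have p : 0 < 1 + k * H n by have := mulr_ge0 (ltW k0) (H0 n); lra.
by rewrite -(ler_pM2r p); apply: le_trans (uH n) h.
Qed.

End Decay.

Section HistoryWeights.
Variables (R : realType) (K : nat) (a0 : 'I_K).
Variables (p : 'I_K -> R) (phi : 'I_K -> 'I_K -> R).
Implicit Types (g h : rtree K).
Local Notation ty := (ty a0).

Lemma wf_ind (Pr : rtree K -> Prop) :
  (forall e, Pr [:: e]) ->
  (forall h b j, wf h -> (j < size h)%N -> Pr h -> Pr (rcons h (b, j))) ->
  forall h, wf h -> Pr h.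
Proof.
move=> P1 PS; elim/last_ind => [//|h [b j] IH].
have [h0|h0] := posnP (size h); first by case: h h0 {IH} => // _ _; exact: P1.
by rewrite wf_rcons// => /andP[wh jh]; apply: PS => //; exact: IH.
Qed.

Definition dsum (F : 'I_K -> R) h : R :=
  \sum_(0 <= v < size h) F (ty h v) * (nch h v).+1%:R.

Lemma dsum1 F e : dsum F [:: e] = F e.1.
Proof. by rewrite /dsum big_nat1 /= mulr1. Qed.

Lemma dsum_rcons F h b j : wf h -> (j < size h)%N ->
  dsum F (rcons h (b, j)) = dsum F h + F (ty h j) + F b.
Proof.
move=> wh jh; have h0 : (0 < size h)%N by case: h wh jh.
rewrite /dsum size_rcons big_nat_recr//= nch_rcons// (nch_size a0)//= (ltn_eqF jh).
rewrite ty_rcons ltnn eqxx mulr1; congr (_ + _).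
transitivity (\sum_(0 <= v < size h) (F (ty h v) * (nch h v).+1%:R + (if v == j then F (ty h v) else 0))).
  apply: eq_big_nat => v /andP[_ vh].
  rewrite nch_rcons// ty_rcons vh /= eq_sym; case: eqP => _; last by rewrite addn0 addr0.
  by rewrite addn1 -[in LHS]natr1 mulrDr mulr1.
by rewrite big_split/= -big_mkcond/= big_nat1_eq jh.
Qed.

(* The rate at which vertex j gets a child of type b when the history is h, and
   the sum of these rates. *)
Definition rt h j b : R := phi (ty h j) b * (nch h j).+1%:R.
Definition lam h : R := dsum (fun a => \sum_b phi a b) h.

Lemma lamE h : lam h = \sum_(0 <= j < size h) \sum_b rt h j b.
Proof. by apply: eq_bigr => j _; rewrite mulr_suml. Qed.

Fixpoint rho_rev h : R :=
  match h with
  | [::] => 0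
  | e :: h' => if h' is [::] then p e.1
               else rho_rev h' * rt (rev h') e.2 e.1 / (2 + lam (rev h'))
  end.

(* The probability that the branching process with a root of random type passes
   through the history h before an independent exponential time of rate 2. *)
Definition rho h : R := rho_rev (rev h).

Lemma rho1 e : rho [:: e] = p e.1. Proof. by []. Qed.

Lemma rho_rcons h e : (0 < size h)%N ->
  rho (rcons h e) = rho h * rt h e.2 e.1 / (2 + lam h).
Proof.
rewrite /rho rev_rcons -size_rev /=; case E : (rev h) => [//|x s] _.
by rewrite -E revK.
Qed.

(* The probability that this process has history h at that time; it will also be
   the limiting frequency of the vertices v with [hist v g = h]. *)
Definition vph h : R := 2 * rho h / (2 + lam h).

Fixpoint hs n : seq (rtree K) :=
  if n is n'.+1 then [seq rcons h e | h <- hs n', e <- [seq (b, j) | b <- enum 'I_K, j <- iota 0 n]]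
  else [seq [:: (a, 0%N)] | a <- enum 'I_K].

Lemma hsS n : hs n.+1 =
  [seq rcons h e | h <- hs n, e <- [seq (b, j) | b <- enum 'I_K, j <- iota 0 n.+1]].
Proof. by []. Qed.

Lemma mem_hs n h : h \in hs n <-> [/\ wf h, size h = n.+1 & par a0 h 0 = 0%N].
Proof.
elim: n h => [|n IH] h.
  split=> [/mapP[a _ ->]|[_]].
    by split=> //; apply/(wfP a0); split=> // v; case: v.
  case: h => [//|[a k] [|//]] _; rewrite /par/= => ->; apply/mapP; exists a => //; exact: mem_enum.
rewrite hsS; split.
  move=> /allpairsP[[h' e] [he eb ->]].
  have {he} [/= wh sh ph] := (IH h').1 he.
  have /allpairsP[[b j] [_ jn]] := eb; rewrite [(h', e).2]/= => ->.
  move: jn; rewrite mem_iota add0n /= => jn; split; last by rewrite par_rcons sh.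
    by rewrite wf_rcons ?sh// wh.
  by rewrite size_rcons sh.
case/lastP: h => [[]//|h [b j]]; rewrite size_rcons => -[wh [sh]].
move: wh; rewrite wf_rcons ?sh// => /andP[wh jh]; rewrite par_rcons sh => ph.
apply: allpairs_f; first exact/IH.
by apply: (allpairs_f pair); rewrite ?mem_enum// mem_iota.
Qed.

Lemma uniq_hs n : uniq (hs n).
Proof.
elim: n => [|n IH]; first by rewrite map_inj_uniq ?enum_uniq// => a b [].
apply: allpairs_uniq => //; last by move=> [h e] [h' e'] _ _ /= /rcons_inj[-> ->].
by apply: allpairs_uniq; rewrite ?enum_uniq ?iota_uniq// => -[b j] [b' j'] _ _ [-> ->].
Qed.

Lemma sum_hsS n (F : rtree K -> R) : \sum_(h <- hs n.+1) F h =
  \sum_(h <- hs n) \sum_(0 <= j < size h) \sum_b F (rcons h (b, j)).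
Proof.
rewrite hsS big_allpairs_dep; apply: eq_big_seq => h /mem_hs[_ sh _].
rewrite big_allpairs_dep exchange_big /index_iota sh subn0; apply: eq_bigr => j _.
by rewrite big_enum.
Qed.

Hypotheses (p_gt0 : forall a, 0 < p a) (phi_gt0 : forall a b, 0 < phi a b).

Lemma rt_gt0 h j b : 0 < rt h j b.
Proof. by rewrite mulr_gt0. Qed.

Lemma lam_ge0 h : 0 <= lam h.
Proof. by rewrite lamE; do 2 apply: sumr_ge0 => ? _; exact/ltW/rt_gt0. Qed.

Lemma rho_ge0 h : wf h -> 0 <= rho h.
Proof.
elim/wf_ind=> [e|h' b j wh jh IH]; first by rewrite rho1 ltW.
rewrite rho_rcons; last by case: h' jh {wh IH}.
by rewrite divr_ge0 ?addr_ge0 ?lam_ge0// mulr_ge0// ltW// rt_gt0.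
Qed.

Lemma lam_le : exists2 C : R, 0 < C & forall h, wf h -> lam h <= C * (size h)%:R.
Proof.
pose M := \sum_a \sum_b phi a b.
have M0 : 0 <= M by apply: sumr_ge0 => a _; apply: sumr_ge0 => b _; exact: ltW.
have PM a : \sum_b phi a b <= M.
  rewrite /M [leRHS](bigD1 a)//= lerDl; apply: sumr_ge0 => a' _; apply: sumr_ge0 => b _; exact: ltW.
exists (2 * M + 1); first lra.
apply: wf_ind => [e|h b j wh jh IH].
  by rewrite /lam dsum1 mulr1; have := PM e.1; lra.
rewrite /lam dsum_rcons// -/(lam h) size_rcons -natr1.
have := PM (ty h j); have := PM b; lra.
Qed.

Lemma sum_hs_cvg (w kap : rtree K -> R) (k0 : R) : 0 < k0 ->
  (forall h, wf h -> 0 <= w h) -> (forall h, wf h -> k0 <= kap h) ->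
  (forall h, wf h ->
    \sum_(0 <= j < size h) \sum_b rt h j b * w (rcons h (b, j)) =
    w h * (lam h + 2 - kap h)) ->
  (fun n => \sum_(0 <= m < n) \sum_(h <- hs m) rho h * w h * kap h / (2 + lam h))
    @ \oo --> \sum_a p a * w [:: (a, 0%N)].
Proof.
move=> k00 w0 kk wE; pose A n := \sum_(h <- hs n) rho h * w h.
have A0 n : 0 <= A n.
  by rewrite /A big_seq; apply: sumr_ge0 => h /mem_hs[wh _ _]; rewrite mulr_ge0 ?rho_ge0 ?w0.
have lam2 h : 0 < 2 + lam h by have := lam_ge0 h; lra.
have AS n : A n.+1 = A n - \sum_(h <- hs n) rho h * w h * kap h / (2 + lam h).
  rewrite /A sum_hsS -sumrB; apply: eq_big_seq => h /mem_hs[wh sh _].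
  transitivity (rho h / (2 + lam h) *
      \sum_(0 <= j < size h) \sum_b rt h j b * w (rcons h (b, j))).
    rewrite mulr_sumr; apply: eq_bigr => j _; rewrite mulr_sumr; apply: eq_bigr => b _.
    by rewrite rho_rcons ?sh//=; field; rewrite gt_eqF.
  by rewrite wE//; field; rewrite gt_eqF.
have AE n : \sum_(0 <= m < n) \sum_(h <- hs m) rho h * w h * kap h / (2 + lam h) = A 0%N - A n.
  elim: n => [|n IH]; first by rewrite big_nil subrr.
  by rewrite big_nat_recr//= IH AS; ring.
under eq_fun do rewrite AE.
have -> : \sum_a p a * w [:: (a, 0%N)] = A 0%N - 0.
  by rewrite subr0 /A /= big_map enumT.
apply: cvgB; first exact: cvg_cst.
have [C C0 lamC] := lam_le.
apply: (@harmonic_decay R A (k0 / (2 + C))) => //; first by rewrite divr_gt0//; lra.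
move=> n; rewrite AS mulrBr mulr1 lerD2l lerN2 /A mulr_suml !big_seq.
apply: ler_sum => h /mem_hs[wh sh _]; rewrite -[leRHS]mulrA ler_wpM2l//; first by rewrite mulr_ge0 ?rho_ge0 ?w0.
rewrite -mulrA -invfM ler_pM ?invr_ge0 ?(ltW k00)//.
- by rewrite mulr_ge0//; lra.
- exact: kk.
rewrite lef_pV2 ?posrE// ?mulr_gt0//; last lra.
have n1 : 1 <= n.+1%:R :> R by rewrite ler1n.
by have := lamC _ wh; rewrite sh mulrDl; lra.
Qed.

Lemma vph_total : \sum_a p a = 1 ->
  (fun n => \sum_(0 <= m < n) \sum_(h <- hs m) vph h) @ \oo --> (1 : R).
Proof.
move=> p1; have := @sum_hs_cvg (fun=> 1) (fun=> 2) 2.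
under eq_fun do under eq_bigr do under eq_bigr do rewrite mulr1 [_ * 2]mulrC -/(vph _).
under eq_bigr do rewrite mulr1.
rewrite p1; apply => //.
by move=> h wh; rewrite mul1r addrK lamE; under eq_bigr do under eq_bigr do rewrite mulr1.
Qed.

Lemma vph_kids (eta : 'I_K -> R) : \sum_a p a = 1 -> (forall a, 0 < eta a) ->
  \sum_a eta a = 1 -> (forall a, \sum_b phi a b = 2 - p a / eta a) ->
  (fun n => \sum_(0 <= m < n) \sum_(h <- hs m) vph h * (nch h 0)%:R) @ \oo --> (1 : R).
Proof.
move=> p1 eta0 eta1 phiE.
pose w h := (nch h 0).+1%:R * (eta (ty h 0) / p (ty h 0)).
pose kap h := p (ty h 0) / eta (ty h 0).
pose k0 := \prod_a Num.min 1 (p a / eta a).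
have k0m a : 0 < Num.min 1 (p a / eta a) by rewrite lt_min ltr01 divr_gt0.
have k00 : 0 < k0 by exact: prodr_gt0.
have := @sum_hs_cvg w kap k0 k00.
have -> : \sum_a p a * w [:: (a, 0%N)] = 1.
  rewrite -eta1; apply: eq_bigr => a _; rewrite /w /= mul1r.
  by field; rewrite gt_eqF.
move=> H; have {H} : (fun n => \sum_(0 <= m < n) \sum_(h <- hs m) rho h * w h * kap h / (2 + lam h)) @ \oo --> (1 : R).
  apply: H => [h _|h _|h wh].
  - by rewrite mulr_ge0// divr_ge0// ltW.
  - rewrite /k0 (bigD1 (ty h 0))//= -[leRHS]mulr1 ler_pM ?(ltW (k0m _))//.
    + by apply: prodr_ge0 => a _; exact: ltW.
    + by rewrite ge_min lexx orbT.
    + by apply: prodr_ile1 => a _; rewrite ltW//= ge_min lexx.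
  - have /(wfP a0)[h0 _] := wh.
    transitivity (\sum_(0 <= j < size h) \sum_b (rt h j b * w h +
        (if j == 0%N then rt h j b * (eta (ty h 0) / p (ty h 0)) else 0))).
      apply: eq_big_nat => j /andP[_ jh]; apply: eq_bigr => b _.
      rewrite /w nch_rcons// ty_rcons h0 /=; case: eqP => _; last by rewrite addn0 addr0.
      by rewrite addn1 -[in LHS]natr1; ring.
    under eq_bigr do rewrite big_split/= -mulr_suml.
    rewrite big_split/= -mulr_suml -lamE; under [X in _ + X]eq_bigr => j _.
      rewrite (_ : \sum_b _ = if j == 0%N then \sum_b rt h j b * (eta (ty h 0) / p (ty h 0)) else 0); last first.
        by case: eqP => // _; rewrite big1.
      over.
    rewrite -big_mkcond/= big_nat1_eq h0 -mulr_suml -mulr_suml phiE /kap /w.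
    by rewrite /=; field; rewrite !gt_eqF.
pose S n := \sum_(0 <= m < n) \sum_(h <- hs m) vph h.
move=> H; have -> : (fun n => \sum_(0 <= m < n) \sum_(h <- hs m) vph h * (nch h 0)%:R) =
    (fun n => 2 * (\sum_(0 <= m < n) \sum_(h <- hs m) rho h * w h * kap h / (2 + lam h)) - S n).
  apply/funext => n; rewrite mulr_sumr -sumrB; apply: eq_bigr => m _.
  rewrite mulr_sumr -sumrB; apply: eq_bigr => h _; rewrite /vph /w /kap -natr1.
  by field; rewrite !gt_eqF//; have := lam_ge0 h; lra.
have e : 2 * 1 - 1 = 1 :> R by ring.
rewrite -[X in _ --> X]e.
apply: cvgB; last exact: vph_total.
exact: cvgMl_tmp.
Qed.

End HistoryWeights.

(** * Competing exponential clocks *)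

Section RealProbability.
Context d (T : measurableType d) (R : realType) (P : probability T R).
Implicit Types A B : set T.

Definition pr A : R := fine (P A).

Lemma prE A : measurable A -> P A = (pr A)%:E.
Proof. by move=> mA; rewrite /pr fineK// fin_num_measure. Qed.

Lemma pr_eq A r : P A = r%:E -> pr A = r.
Proof. by rewrite /pr => ->. Qed.

Lemma pr_ge0 A : 0 <= pr A.
Proof. by rewrite /pr fine_ge0. Qed.

Lemma pr_le A B : measurable A -> measurable B -> A `<=` B -> pr A <= pr B.
Proof.
move=> mA mB AB; rewrite -lee_fin -!prE//.
by apply: le_measure; rewrite ?inE.
Qed.

Lemma prT : pr setT = 1.
Proof. exact/pr_eq/probability_setT. Qed.

Lemma pr0 : pr set0 = 0.
Proof. exact/pr_eq/measure0. Qed.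

Lemma pr_le1 A : measurable A -> pr A <= 1.
Proof. by move=> mA; rewrite -prT; exact: pr_le. Qed.

Lemma pr_split A B : measurable A -> measurable B ->
  pr A = pr (A `\` B) + pr (A `&` B).
Proof.
move=> mA mB; have mD : measurable (A `\` B) by exact: measurableD.
have mI : measurable (A `&` B) by exact: measurableI.
by apply: EFin_inj; rewrite EFinD -!prE//; exact: measureDI.
Qed.

Lemma prU A B : measurable A -> measurable B -> A `&` B = set0 ->
  pr (A `|` B) = pr A + pr B.
Proof.
move=> mA mB AB.
by apply: EFin_inj; rewrite EFinD -!prE//; [exact: measureU|exact: measurableU].
Qed.

Lemma sum_pr_le (J : eqType) (s : seq J) (F : J -> set T) A : uniq s ->
  (forall i, i \in s -> measurable (F i)) -> measurable A ->
  (forall i, i \in s -> F i `<=` A) ->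
  (forall i j w, i \in s -> j \in s -> F i w -> F j w -> i = j) ->
  \sum_(i <- s) pr (F i) <= pr A.
Proof.
elim: s A => [|j s IH] A; first by rewrite big_nil pr_ge0.
move=> /= /andP[js us] mF mA FA dis; rewrite big_cons.
have mFj : measurable (F j) by apply: mF; rewrite mem_head.
rewrite (pr_split mA mFj) addrC; apply: lerD.
  apply: IH => //.
  - by move=> i si; apply: mF; rewrite inE si orbT.
  - exact: measurableD.
  - move=> i si w Fiw; split; first by apply: (FA i) => //; rewrite inE si orbT.
    move=> Fjw; have ij : i = j by apply: (dis _ _ w) => //; rewrite inE ?eqxx ?si ?orbT.
    by rewrite -ij si in js.
  - by move=> i k w si sk; apply: dis; rewrite inE ?si ?sk orbT.
apply: pr_le => //; first exact: measurableI.
by move=> w Fjw; split=> //; apply: (FA j) => //; rewrite mem_head.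
Qed.

Lemma measurable_forall_in (J : eqType) (s : seq J) (F : J -> set T) :
  (forall i, i \in s -> measurable (F i)) ->
  measurable [set w | forall i, i \in s -> F i w].
Proof.
elim: s => [|j s IH] mF.
  by rewrite (_ : mkset _ = setT)//; apply/seteqP; split=> // w _ i; rewrite in_nil.
rewrite (_ : mkset _ = F j `&` [set w | forall i, i \in s -> F i w]).
  apply: measurableI; first by apply: mF; rewrite mem_head.
  by apply: IH => i si; apply: mF; rewrite inE si orbT.
apply/seteqP; split=> w /=.
  move=> H; split; first by apply: H; rewrite mem_head.
  by move=> i si; apply: H; rewrite inE si orbT.
by move=> [Fj H] i; rewrite inE => /predU1P[->//|]; exact: H.
Qed.

Lemma measurable_forall_in2 (J : eqType) (s : seq J) (b : pred J) (F : J -> set T) :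
  (forall i, i \in s -> measurable (F i)) ->
  measurable [set w | forall i, i \in s -> b i -> F i w].
Proof.
move=> mF; have := @measurable_forall_in _ [seq i <- s | b i] F.
rewrite (_ : [set w | forall i, i \in [seq i <- s | b i] -> F i w] =
  [set w | forall i, i \in s -> b i -> F i w]).
  by apply => i; rewrite mem_filter => /andP[_]; exact: mF.
apply/seteqP; split=> w /= H i; first by move=> si bi; apply: H; rewrite mem_filter bi.
by rewrite mem_filter => /andP[bi si]; exact: H.
Qed.

Lemma measurable_lt (f g : T -> R) :
  measurable_fun setT f -> measurable_fun setT g -> measurable [set w | f w < g w].
Proof.
move=> mf mg; have m : measurable_fun setT (g \- f) by exact: measurable_realfun.measurable_funB.
have := m measurableT `]0, +oo[%classic (measurable_itv _); rewrite setTI.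
by congr measurable; apply/seteqP; split=> w /=; rewrite in_itv/= andbT subr_gt0.
Qed.

End RealProbability.

Section Race.
Context d (T : measurableType d) (R : realType) (P : probability T R).
Local Notation pr := (pr P).

Lemma eq0_small_increments (g : R -> R) D1 D2 :
  (forall u e, 0 <= u -> 0 < e -> `|g u - g (u + e)| <= D1 * e ^+ 2) ->
  (forall u, 0 < u -> `|g u| <= D2 / u) -> g 0 = 0.
Proof.
move=> g1 g2.
have H e n : 0 < e -> `|g 0| <= `|g (n%:R * e)| + n%:R * (D1 * e ^+ 2).
  move=> e0; elim: n => [|n IH]; first by rewrite !mul0r addr0.
  apply: le_trans IH _.
  have -> : n.+1%:R * e = n%:R * e + e by rewrite -natr1 mulrDl mul1r.
  rewrite -natr1 mulrDl mul1r.
  have := g1 (n%:R * e) e (mulr_ge0 (ler0n _ _) (ltW e0)) e0.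
  have := ler_normD (g (n%:R * e + e)) (g (n%:R * e) - g (n%:R * e + e)).
  rewrite [X in `|X| <= _]addrC subrK; lra.
have B m : (0 < m)%N -> `|g 0| <= (D1 + D2) / m%:R.
  move=> m0; have m0' : 0 < m%:R :> R by rewrite ltr0n.
  have := H (m%:R ^- 2) (m ^ 3)%N; rewrite invr_gt0 exprn_gt0// => /(_ isT).
  have -> : (m ^ 3)%:R * m%:R ^- 2 = m%:R :> R.
    by rewrite natrX; field; rewrite gt_eqF.
  have -> : (m ^ 3)%:R * (D1 * m%:R ^- 2 ^+ 2) = D1 / m%:R :> R.
    by rewrite natrX; field; rewrite gt_eqF.
  have := g2 _ m0'; lra.
apply/normr0_eq0/eqP; rewrite eq_le normr_ge0 andbT; apply/ler_addgt0Pl => e e0.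
rewrite addr0.
have [D0|D0] := leP (D1 + D2) 0.
  apply: le_trans (B 1%N isT) _; rewrite divr1; lra.
pose m := (Num.trunc ((D1 + D2) / e)).+1.
apply: le_trans (B m isT) _; rewrite ler_pdivrMr ?ltr0n// mulrC -ler_pdivrMr//.
exact/ltW/truncnS_gt.
Qed.

Variables (I : eqType) (X : I -> T -> R) (lam : I -> R) (E : set T) (c : R).
Variable alive : pred I.
Hypotheses (mX : forall i, measurable_fun setT (X i)) (mE : measurable E).
Hypothesis lam_gt0 : forall i, 0 < lam i.
Hypothesis surv : forall J, uniq J -> all alive J ->
  forall r : I -> R, (forall i, 0 <= r i) ->
  pr (E `&` [set w | forall i, i \in J -> r i < X i w]) =
  c * \prod_(i <- J) expR (- (lam i * r i)).

Lemma race i0 (L : seq I) (b : pred I) (r : I -> R) :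
  uniq (i0 :: L) -> all alive (i0 :: L) -> (forall i, 0 <= r i) ->
  pr (E `&` [set w | forall i, i \in L -> r i + (b i)%:R * X i0 w < X i w]) =
  c * (lam i0 / (lam i0 + \sum_(i <- L | b i) lam i)) *
  \prod_(i <- L) expR (- (lam i * r i)).
Proof.
move=> /= /andP[i0L uL] /andP[ai0 aL] r0.
set A := E `&` _.
have mA : measurable A.
  apply: measurableI => //; apply: measurable_forall_in => i _.
  apply: measurable_lt => //; apply: measurable_realfun.measurable_funD => //.
  exact: measurable_realfun.measurable_funM.
pose LB := \sum_(i <- L | b i) lam i.
have LB0 : 0 <= LB by rewrite sumr_ge0// => i _; exact: ltW.
pose C := c * \prod_(i <- L) expR (- (lam i * r i)).
have c0 : 0 <= c.
  have := @surv [::] isT isT (fun=> 0) (fun=> lexx _); rewrite big_nil mulr1 => <-.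
  exact: pr_ge0.
have C0 : 0 <= C by rewrite mulr_ge0// prodr_ge0// => i _; exact: expR_ge0.
pose S u := [set w | u < X i0 w].
have mS u : measurable (S u) by exact: measurable_lt.
pose M s := [set w | forall i, i \in L -> s i < X i w].
have mM s : measurable (M s).
  by apply: measurable_forall_in => i _; exact: measurable_lt.
have GE u s : 0 <= u -> (forall i, 0 <= s i) ->
    pr (E `&` (S u `&` M s)) =
    c * (expR (- (lam i0 * u)) * \prod_(i <- L) expR (- (lam i * s i))).
  move=> u0 s0; have s0' i : 0 <= if i == i0 then u else s i by case: ifP.
  have := @surv (i0 :: L) _ _ _ s0'; rewrite /= i0L uL ai0 aL => /(_ isT isT).
  have -> : \prod_(i <- i0 :: L) expR (- (lam i * (if i == i0 then u else s i))) =
      expR (- (lam i0 * u)) * \prod_(i <- L) expR (- (lam i * s i)).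
    rewrite big_cons eqxx; congr (_ * _).
    by apply: eq_big_seq => i iL; case: eqP => // ii; rewrite -ii iL in i0L.
  move=> <-.
  congr pr; congr setI; apply/seteqP; split=> w /=.
    by move=> [Su Mw] i; rewrite inE; case: eqP => [->//|_ /=]; exact: Mw.
  move=> H; split; first by have := H i0 (mem_head _ _); rewrite eqxx.
  move=> i iL; have := H i; rewrite inE iL orbT; case: eqP => [ii|_]; last exact.
  by rewrite -ii iL in i0L.
have mEG u s : measurable (E `&` (S u `&` M s)) by apply: measurableI => //; apply: measurableI.
have slab u e s : 0 <= u -> 0 < e -> (forall i, 0 <= s i) ->
    pr ((E `&` (S u `&` M s)) `\` S (u + e)) =
    c * ((expR (- (lam i0 * u)) - expR (- (lam i0 * (u + e)))) *
         \prod_(i <- L) expR (- (lam i * s i))).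
  move=> u0 e0 s0; have := pr_split P (mEG u s) (mS (u + e)).
  rewrite GE//; have -> : E `&` (S u `&` M s) `&` S (u + e) = E `&` (S (u + e) `&` M s).
    apply/seteqP; split=> w /= [].
      by move=> [Ew [_ Mw]] Sw.
    by move=> Ew [Sw Mw]; split=> //; split=> //; split=> //; apply: lt_trans Sw; rewrite /= ltrDl.
  rewrite (GE _ _ (addr_ge0 u0 (ltW e0)) s0) => /eqP; rewrite -subr_eq => /eqP <-.
  by ring.
have prodE v : \prod_(i <- L) expR (- (lam i * (r i + (b i)%:R * v))) =
    \prod_(i <- L) expR (- (lam i * r i)) * expR (- (LB * v)).
  rewrite /LB; elim: (L) => [|i L' IH]; first by rewrite !big_nil mul0r oppr0 expR0 mulr1.
  rewrite !big_cons {}IH; case: (b i) => /=.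
    have -> : expR (- (lam i * (r i + 1 * v))) = expR (- (lam i * r i)) * expR (- (lam i * v)).
      by rewrite -expRD; congr expR; ring.
    set S' := \sum_(_ <- _ | _) _.
    have -> : expR (- ((lam i + S') * v)) = expR (- (lam i * v)) * expR (- (S' * v)).
      by rewrite -expRD; congr expR; ring.
    by ring.
  by rewrite mul0r addr0 mulrA.
set l0 := lam i0; have l00 : 0 < l0 := lam_gt0 i0.
set L1 := l0 + LB; have L10 : 0 < L1 by rewrite /L1; lra.
pose a u := pr (A `&` S u).
pose f u := C * (l0 / L1) * expR (- (L1 * u)).
have expRN_le (t : R) : 0 <= t -> expR (- t) <= 1 - t + t ^+ 2.
  move=> t0; rewrite expRN; apply: (@le_trans _ _ (1 + t)^-1).
    by rewrite lef_pV2 ?posrE ?expR_gt0 ?expR_ge1Dx//; lra.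
  rewrite -[leLHS]mul1r ler_pdivrMr; last lra.
  by rewrite -subr_ge0 (_ : _ - 1 = t ^+ 3) ?exprn_ge0//; ring.
have expRN_ge (t : R) : 1 - t <= expR (- t) := expR_ge1Dx _.
have expRN_le1 (t : R) : 0 <= t -> expR (- t) <= 1 by move=> t0; rewrite expR_le1; lra.
have expRN_inv (t : R) : 0 < t -> expR (- t) <= t^-1.
  move=> t0; rewrite expRN lef_pV2 ?posrE ?expR_gt0//.
  by have := expR_ge1Dx t; lra.
have a0E : a 0 = f 0.
  apply/eqP; rewrite -subr_eq0; apply/eqP.
  apply: (@eq0_small_increments (fun u => a u - f u) (C * L1 ^+ 2) ((c + C) / l0)).
    move=> u e u0 e0.
    have aS : a u = pr ((A `&` S u) `\` S (u + e)) + a (u + e).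
      rewrite {1}/a (pr_split P _ (mS (u + e))); last exact: measurableI.
      congr (_ + pr _); apply/seteqP; split=> w; first by move=> [[Aw _] Sw'].
      by move=> [Aw Sw']; split=> //; split=> //; apply: lt_trans Sw'; rewrite ltrDl.
    set x := expR (- (L1 * u)); set q0 := expR (- (l0 * e)); set qB := expR (- (LB * e)).
    have x1 : x <= 1 by apply: expRN_le1; rewrite mulr_ge0// ltW.
    have x0 : 0 < x by exact: expR_gt0.
    have xE : expR (- (l0 * u)) * expR (- (LB * u)) = x.
      by rewrite -expRD; congr expR; rewrite /L1; ring.
    have qE : q0 * qB = expR (- (L1 * e)).
      by rewrite -expRD; congr expR; rewrite /L1; ring.
    have l0u : expR (- (l0 * (u + e))) = expR (- (l0 * u)) * q0.
      by rewrite -expRD; congr expR; ring.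
    have LBu : expR (- (LB * (u + e))) = expR (- (LB * u)) * qB.
      by rewrite -expRD; congr expR; ring.
    have up : a u - a (u + e) <= C * x * (1 - q0).
      have s0 i : 0 <= r i + (b i)%:R * u by rewrite addr_ge0// mulr_ge0.
      have -> : C * x * (1 - q0) = pr ((E `&` (S u `&` M (fun i => r i + (b i)%:R * u))) `\` S (u + e)).
        by rewrite slab// prodE l0u -xE /C; ring.
      rewrite aS addrK; apply: pr_le.
      - by apply: measurableD => //; exact: measurableI.
      - exact: measurableD.
      - move=> w /= [[[Ew Aw] Sw] nS]; split=> //; split=> //; split=> //.
        move=> i /Aw; apply: le_lt_trans; rewrite lerD2l ler_wpM2l// ?ltW//.
    have lo : C * x * (qB - q0 * qB) <= a u - a (u + e).
      have s0 i : 0 <= r i + (b i)%:R * (u + e) by rewrite addr_ge0// mulr_ge0// addr_ge0// ltW.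
      have -> : C * x * (qB - q0 * qB) = pr ((E `&` (S u `&` M (fun i => r i + (b i)%:R * (u + e)))) `\` S (u + e)).
        by rewrite slab// prodE l0u LBu -xE /C; ring.
      rewrite aS addrK; apply: pr_le.
      - exact: measurableD.
      - by apply: measurableD => //; exact: measurableI.
      - move=> w /= [[Ew [Sw Mw]] nS]; split=> //; split=> //; split=> //.
        move=> i /Mw; apply: le_lt_trans; rewrite lerD2l ler_wpM2l//.
        by rewrite leNgt; apply/negP.
    have fE : f u - f (u + e) = C * x * (l0 / L1 * (1 - q0 * qB)).
      rewrite /f -/x qE; set y := expR (- (L1 * (u + e))).
      have -> : y = x * expR (- (L1 * e)) by rewrite -expRD; congr expR; ring.
      by ring.
    have q0u : 1 - q0 <= l0 * e by have := expRN_ge (l0 * e); rewrite -/q0; lra.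
    have qBl : 1 - LB * e <= qB by exact: expRN_ge.
    have qu : q0 * qB <= 1 - L1 * e + (L1 * e) ^+ 2.
      by rewrite qE; apply: expRN_le; rewrite mulr_ge0// ltW.
    have ql : 1 - L1 * e <= q0 * qB by rewrite qE; exact: expRN_ge.
    have l0L : l0 / L1 <= 1 by rewrite ler_pdivrMr// mul1r /L1 lerDl.
    have l0L0 : 0 < l0 / L1 by rewrite divr_gt0.
    have fu : l0 / L1 * (1 - q0 * qB) <= l0 * e.
      rewrite -(@ler_pM2l _ L1)// (_ : L1 * _ = l0 * (1 - q0 * qB)); last by field; lra.
      rewrite (_ : L1 * _ = l0 * (L1 * e)); last by ring.
      by rewrite ler_pM2l//; lra.
    have fl : l0 * e - (L1 * e) ^+ 2 <= l0 / L1 * (1 - q0 * qB).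
      apply: (@le_trans _ _ (l0 / L1 * (L1 * e - (L1 * e) ^+ 2))); last by rewrite ler_pM2l//; lra.
      rewrite mulrBr (_ : l0 / L1 * (L1 * e) = l0 * e); last by field; lra.
      by rewrite lerD2l lerN2 ler_piMl// sqr_ge0.
    have al : l0 * e - (L1 * e) ^+ 2 <= qB - q0 * qB.
      by move: qBl qu; rewrite /L1 mulrDl; lra.
    rewrite (_ : _ - _ = (a u - a (u + e)) - (f u - f (u + e))); last by ring.
    rewrite fE.
    have Cx0 : 0 <= C * x by rewrite mulr_ge0// ltW.
    have CxC : C * x <= C by rewrite ler_piMr.
    have {up}up : a u - a (u + e) <= C * x * (l0 * e) by apply: le_trans up _; exact: ler_wpM2l.
    have {lo al}lo : C * x * (l0 * e - (L1 * e) ^+ 2) <= a u - a (u + e).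
      by apply: le_trans lo; exact: ler_wpM2l.
    have {}fu := ler_wpM2l Cx0 fu; have {}fl := ler_wpM2l Cx0 fl.
    apply: (@le_trans _ _ (C * x * (L1 * e) ^+ 2)); last first.
      by rewrite exprMn mulrA ler_wpM2r// ?sqr_ge0// ler_wpM2r// sqr_ge0.
    by rewrite ler_norml; apply/andP; split; lra.
  move=> u u0; have lu : 0 < l0 * u by rewrite mulr_gt0.
  have fu0 : 0 <= f u by rewrite /f mulr_ge0 ?expR_ge0// mulr_ge0// ltW// divr_gt0.
  have au0 : 0 <= a u := pr_ge0 _ _.
  have fu : f u <= C * (l0 * u)^-1.
    rewrite /f -mulrA ler_wpM2l//; apply: le_trans (_ : expR (- (L1 * u)) <= _).
      by rewrite ler_piMl ?expR_ge0// ler_pdivrMr// mul1r /L1 lerDl.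
    apply: le_trans (expRN_inv _ lu); rewrite ler_expR lerN2 ler_pM2r//.
    by rewrite /L1 lerDl.
  have au : a u <= c * (l0 * u)^-1.
    have := @surv [:: i0] isT _ (fun=> u) (fun=> ltW u0); rewrite /= ai0 => /(_ isT).
    rewrite big_seq1 => H; apply: (@le_trans _ _ (c * expR (- (l0 * u)))); last first.
      by rewrite ler_wpM2l//; exact: expRN_inv.
    rewrite -H; apply: pr_le.
    - exact: measurableI.
    - by apply: measurableI => //; apply: measurable_forall_in => i _; exact: measurable_lt.
    - by move=> w /= [[Ew _] Sw]; split=> // i; rewrite inE => /eqP ->.
  have -> : (c + C) / l0 / u = c * (l0 * u)^-1 + C * (l0 * u)^-1 by field; lra.
  by rewrite ler_norml; apply/andP; split; lra.
have -> : pr A = a 0.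
  have := pr_split P mA (mS 0); suff -> : pr (A `\` S 0) = 0 by rewrite add0r.
  apply/eqP; rewrite eq_le pr_ge0 andbT.
  apply: (@le_trans _ _ (pr (E `\` S 0))).
    apply: pr_le; try exact: measurableD.
    by move=> w /= [[Ew _] nS].
  have := pr_split P mE (mS 0).
  have := @surv [::] isT isT (fun=> 0) (fun=> lexx _); rewrite big_nil mulr1.
  rewrite (_ : mkset _ = setT) ?setIT; last by apply/seteqP; split=> // w _ i.
  move=> ->; have := @surv [:: i0] isT _ (fun=> 0) (fun=> lexx _); rewrite /= ai0 => /(_ isT).
  rewrite big_seq1 mulr0 oppr0 expR0 mulr1.
  rewrite (_ : mkset _ = S 0) => [-> |]; first lra.
  apply/seteqP; split=> w /=; first by apply; rewrite mem_head.
  by move=> Sw i; rewrite inE => /eqP ->.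
by rewrite a0E /f mulr0 oppr0 expR0 mulr1 /C /L1 /LB; ring.
Qed.

End Race.

(** * The branching process along a history *)

Section Clocks.
Variables (R : realType) (K : nat) (a0 : 'I_K).
Implicit Types (h : rtree K) (j y k : nat).
Local Notation ty := (ty a0).
Local Notation I := (option (clock_index K)).
Implicit Types (i : I) (X : I -> R).

Fixpoint ws_rev h : seq (seq nat) :=
  match h with
  | [::] => [::]
  | e :: h' => if h' is [::] then [:: [::]]
               else rcons (ws_rev h') (nch (rev h') e.2 :: nth [::] (ws_rev h') e.2)
  end.

(* The code in the branching process of the j-th vertex of a history. *)
Definition wd h j : seq nat := nth [::] (ws_rev (rev h)) j.

Lemma size_ws h : size (ws_rev (rev h)) = size h.
Proof.
rewrite -(size_rev h); elim: (rev h) => //= e [//|e' s] IH.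
by rewrite size_rcons IH.
Qed.

Lemma wd_rcons h e j : (0 < size h)%N -> wd (rcons h e) j =
  if (j < size h)%N then wd h j
  else if j == size h then nch h e.2 :: wd h e.2 else [::].
Proof.
move=> h0; rewrite -(size_ws h) /wd rev_rcons/=.
have : (0 < size (rev h))%N by rewrite size_rev.
by case E : (rev h) => [//|x s] _; rewrite -E revK nth_rcons.
Qed.

Lemma wd_root h : wf h -> wd h 0 = [::].
Proof. by elim/wf_ind => [//|{}h b j wh jh IH]; rewrite wd_rcons//; case: h jh IH wh. Qed.

Lemma wd_parent h : wf h -> forall y, (0 < y < size h)%N ->
  exists2 k, (k < nch h (par a0 h y))%N & wd h y = k :: wd h (par a0 h y).
Proof.
elim/wf_ind => [e [] //|{}h b j wh jh IH] y; rewrite size_rcons => /andP[y0 yh].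
have h0 : (0 < size h)%N by lia.
rewrite par_rcons wd_rcons//; have [ylt|yge] := ltnP y (size h).
  have yy : (0 < y < size h)%N by rewrite y0.
  have [k kn E] := IH y yy; have /(wfP a0)[_ H] := wh.
  exists k; first by rewrite nch_rcons// (leq_trans kn)// leq_addr.
  by rewrite E wd_rcons// (ltn_trans (H _ yy) ylt).
have -> : y = size h by lia.
rewrite eqxx /= wd_rcons// jh; exists (nch h j) => //.
by rewrite nch_rcons//= eqxx addn1.
Qed.

Lemma wd_child h : wf h -> forall j k, (j < size h)%N -> (k < nch h j)%N ->
  exists y, [/\ (0 < y < size h)%N, par a0 h y = j & wd h y = k :: wd h j].
Proof.
elim/wf_ind => [e [] //|{}h b j wh jh IH] j' k.
have h0 : (0 < size h)%N by lia.
rewrite size_rcons nch_rcons//= ltnS leq_eqVlt => /predU1P[->|jh'].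
  by rewrite (nch_size a0)// (ltn_eqF jh).
have [kn _|kn] := ltnP k (nch h j').
  have [y [yh py wy]] := IH _ _ jh' kn; exists y; move: (yh) => /andP[y0 ylt].
  by rewrite par_rcons !wd_rcons// ylt jh' y0 ltnW.
case: eqP => [->|_] kn'; last by lia.
have -> : k = nch h j' by lia.
exists (size h); rewrite par_rcons !wd_rcons// ltnn eqxx /= jh'.
by rewrite h0 ltnSn.
Qed.

Lemma wd_inj h : wf h -> forall j j', (j < size h)%N -> (j' < size h)%N ->
  wd h j = wd h j' -> j = j'.
Proof.
elim/wf_ind => [e [|//] [|//] //|{}h b j wh jh IH].
have h0 : (0 < size h)%N by lia.
have new y : (y < size h)%N -> nch h j :: wd h j <> wd h y.
  move=> yh; have [->|y0] := posnP y; first by rewrite wd_root.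
  have yy : (0 < y < size h)%N by rewrite y0.
  have /(wfP a0)[_ /(_ y yy) pl] := wh.
  have [k + ->] := wd_parent wh yy; move=> kn [ek /IH e].
  by move: kn; rewrite -ek -e ?ltnn//; exact: ltn_trans pl yh.
move=> j1 j2; rewrite size_rcons !wd_rcons//= !ltnS => l1 l2.
have [s1|s1] := ltnP j1 (size h); have [s2|s2] := ltnP j2 (size h).
- exact: IH.
- by (have -> : j2 == size h by lia); move=> e; case: (new j1 s1).
- by (have -> : j1 == size h by lia); move=> e; case: (new j2 s2).
- by lia.
Qed.

Definition ck h j b : I := Some (wd h j, ty h j, nch h j, b).

(* The clocks that run when the history is h, None standing for tau. *)
Definition act h : seq I :=
  None :: [seq ck h j b | j <- iota 0 (size h), b <- enum 'I_K].

Lemma mem_act h i :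
  i \in act h <-> i = None \/ exists j b, (j < size h)%N /\ i = ck h j b.
Proof.
rewrite /act in_cons; split=> [/predU1P[->|/allpairsP[[j b] [jh _ ->]]]|[->|[j [b [jh ->]]]]].
- by left.
- by right; exists j, b; rewrite mem_iota in jh.
- by [].
- by apply/orP; right; apply: allpairs_f; rewrite ?mem_enum// mem_iota.
Qed.

Lemma ck_act h j b : (j < size h)%N -> ck h j b \in act h.
Proof. by move=> jh; apply/mem_act; right; exists j, b. Qed.

Lemma None_act h : None \in act h. Proof. exact: mem_head. Qed.

Lemma uniq_act h : wf h -> uniq (act h).
Proof.
move=> wh; rewrite /act cons_uniq; apply/andP; split.
  by apply/negP => /allpairsP[[j b] []].
apply: allpairs_uniq; rewrite ?iota_uniq ?enum_uniq// => -[j b] [j' b'].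
move=> /allpairsP[[j1 b1] [+ _ [-> ->]]] /allpairsP[[j2 b2] [+ _ [-> ->]]] [/=].
by rewrite !mem_iota /= => l1 l2 /(wd_inj wh l1 l2) -> _ _ ->.
Qed.

Definition dead h i : bool :=
  if i is Some (u, _, N, _) then
    has (fun j => (wd h j == u) && (N < nch h j)%N) (iota 0 (size h))
  else false.

Lemma dead_rcons h b j i : wf h -> (j < size h)%N -> dead (rcons h (b, j)) i =
  dead h i || (if i is Some (u, _, N, _) then (u == wd h j) && (N == nch h j) else false).
Proof.
move=> wh jh; have h0 : (0 < size h)%N by lia.
case: i => [[[[u a] N] b']|//]; rewrite /dead; apply/hasP/orP.
  move=> [y]; rewrite mem_iota size_rcons /= => yh.
  rewrite wd_rcons// nch_rcons//=; have [<-|_] := eqVneq j y.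
    rewrite jh => /andP[/eqP <-]; rewrite addn1 ltnS leq_eqVlt => /predU1P[->|lt].
      by right; rewrite !eqxx.
    by left; apply/hasP; exists j; rewrite ?mem_iota// eqxx.
  rewrite addn0; have [yl|yg] := ltnP y (size h).
    by move=> H; left; apply/hasP; exists y; rewrite ?mem_iota.
  by (have -> : y = size h by lia); rewrite (nch_size a0 wh (leqnn _)) andbF.
case=> [/hasP[y]|/andP[/eqP -> /eqP ->]].
  rewrite mem_iota /= => yh /andP[/eqP <- lt]; exists y.
    by rewrite mem_iota size_rcons /= ltnW.
  by rewrite wd_rcons// yh eqxx nch_rcons//= (leq_trans lt)// leq_addr.
exists j; first by rewrite mem_iota size_rcons /= ltnW.
by rewrite wd_rcons// jh eqxx nch_rcons//= eqxx addn1 ltnSn.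
Qed.

Lemma act_dead h i : wf h -> i \in act h -> ~~ dead h i.
Proof.
move=> wh /mem_act[->//|[j [b [jh ->]]]]; apply/negP => /hasP[y]; rewrite mem_iota /= => yh.
by move=> /andP[/eqP /(wd_inj wh yh jh) ->]; rewrite ltnn.
Qed.

Lemma ck_rcons h b j j' b' : wf h -> (j < size h)%N -> (j' < size h)%N -> j' != j ->
  ck (rcons h (b, j)) j' b' = ck h j' b'.
Proof.
move=> wh jh jh' ne; have h0 : (0 < size h)%N by lia.
by rewrite /ck wd_rcons// ty_rcons jh' nch_rcons//= eq_sym (negbTE ne) addn0.
Qed.

Lemma act_rcons h b j i : wf h -> (j < size h)%N ->
  i \in act h -> i \in act (rcons h (b, j)) \/ dead (rcons h (b, j)) i.
Proof.
move=> wh jh /mem_act[->|[j' [b' [jh' ->]]]]; first by left.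
have [->|ne] := eqVneq j' j; first by right; rewrite dead_rcons//= !eqxx orbT.
left; apply/mem_act; right; exists j', b'; rewrite size_rcons ltnW//.
by rewrite ck_rcons.
Qed.

Lemma ck_fresh h b j b' : wf h -> (j < size h)%N ->
  ck (rcons h (b, j)) j b' \notin act h /\
  ck (rcons h (b, j)) (size h) b' \notin act h.
Proof.
move=> wh jh; have h0 : (0 < size h)%N by lia.
have wh' : wf (rcons h (b, j)) by rewrite wf_rcons// wh.
split; apply/negP => /mem_act[//|[y [b'' [yh]]]]; rewrite /ck wd_rcons//.
  by rewrite jh => -[/(wd_inj wh jh yh) -> _ ]; rewrite nch_rcons//= eqxx; lia.
rewrite ltnn eqxx => -[E _ _].
have := @wd_inj _ wh' y (size h); rewrite size_rcons !wd_rcons// yh ltnn eqxx E.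
by rewrite ltnW// ltnSn => /(_ isT isT erefl); lia.
Qed.

Fixpoint res_rev X h : I -> R :=
  match h with
  | [::] => X
  | e :: h' => if h' is [::] then X
               else fun i => if i \in act (rev h')
                             then res_rev X h' i - res_rev X h' (ck (rev h') e.2 e.1)
                             else res_rev X h' i
  end.

(* The remaining waiting times once the history h is complete; the clocks in act h
   are running, those which satisfy dead h have rung or were discarded. *)
Definition res X h : I -> R := res_rev X (rev h).

Lemma res_rcons X h e i : (0 < size h)%N -> res X (rcons h e) i =
  if i \in act h then res X h i - res X h (ck h e.2 e.1) else res X h i.
Proof.
move=> h0; rewrite /res rev_rcons/=; have : (0 < size (rev h))%N by rewrite size_rev.
by case E : (rev h) => [//|x s] _; rewrite -E revK.
Qed.

Lemma res_fresh X h i : wf h -> i \notin act h -> ~~ dead h i -> res X h i = X i.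
Proof.
elim/wf_ind => [e _ _//|{}h b j wh jh IH ia nd].
have h0 : (0 < size h)%N by lia.
rewrite res_rcons//; case: ifP => [iact|/negbT/IH]; last first.
  by apply; move: nd; rewrite dead_rcons// negb_or => /andP[].
by have [] := act_rcons b wh jh iact; rewrite ?(negbTE ia) ?(negbTE nd).
Qed.

Fixpoint ev_rev (A : 'I_K) X h : Prop :=
  match h with
  | [::] => False
  | e :: h' => if h' is [::] then A = e.1
               else ev_rev A X h' /\ forall i, i \in act (rev h') ->
                    i != ck (rev h') e.2 e.1 ->
                    res_rev X h' (ck (rev h') e.2 e.1) < res_rev X h' i
  end.

(* The population follows the history h before time tau. *)
Definition ev A X h : Prop := ev_rev A X (rev h).

Lemma ev_rcons A X h e : (0 < size h)%N -> ev A X (rcons h e) <->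
  ev A X h /\ forall i, i \in act h -> i != ck h e.2 e.1 ->
    res X h (ck h e.2 e.1) < res X h i.
Proof.
move=> h0; rewrite /ev /res rev_rcons/=; have : (0 < size (rev h))%N by rewrite size_rev.
by case E : (rev h) => [//|x s] _; rewrite -E revK.
Qed.

(* The history at time tau is h. *)
Definition fev A X h : Prop :=
  ev A X h /\ forall i, i \in act h -> i != None -> res X h None < res X h i.

Lemma ck_inj h j b j' b' : wf h -> (j < size h)%N -> (j' < size h)%N ->
  ck h j b = ck h j' b' -> (b, j) = (b', j').
Proof. by move=> wh l l' [/(wd_inj wh l l') -> _ _ ->]. Qed.

Lemma ev_take A X h n : ev A X h -> (0 < n <= size h)%N -> ev A X (take n h).
Proof.
elim/last_ind: h => // h e IH H /andP[n0]; rewrite size_rcons leq_eqVlt.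
move=> /predU1P[->|nh]; first by rewrite -(size_rcons h e) take_size.
have h0 : (0 < size h)%N by lia.
move/ev_rcons: H => /(_ h0)[evh _].
by rewrite -cats1 takel_cat//; apply: IH; rewrite // n0.
Qed.

Lemma ev_step A X h n : ev A X h -> (0 < n < size h)%N ->
  forall i, i \in act (take n h) ->
    i != ck (take n h) (par a0 h n) (ty h n) ->
    res X (take n h) (ck (take n h) (par a0 h n) (ty h n)) < res X (take n h) i.
Proof.
move=> H /andP[n0 nh]; have := @ev_take A X h n.+1 H.
rewrite /= nh (take_nth (a0, 0%N) nh) => /(_ isT) /ev_rcons.
by rewrite size_take nh => /(_ n0)[].
Qed.

Lemma wf_take h n : wf h -> (0 < n)%N -> wf (take n h).
Proof.
move=> /(wfP a0)[h0 H] n0; apply/(wfP a0); rewrite size_take_min; split; first by lia.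
move=> v vn; rewrite /par nth_take; last lia.
by apply: H; lia.
Qed.

Lemma fev_inj A X h h' : wf h -> wf h' -> par a0 h 0 = 0%N -> par a0 h' 0 = 0%N ->
  fev A X h -> fev A X h' -> h = h'.
Proof.
wlog le : h h' / (size h <= size h')%N.
  by move=> H wh wh' p p' f f'; case: (leqP (size h) (size h')) => l; [|symmetry]; apply: H => //; exact: ltnW.
move=> wh wh' p p' [evh fh] [evh' fh'].
have h0 : (0 < size h)%N by case: h wh {le p evh fh}.
have H n : (0 < n <= size h)%N -> take n h = take n h'.
  elim: n => // n IH /andP[_ nh]; have [n0|n0] := posnP n.
    have h0' : (0 < size h')%N by lia.
    rewrite n0; move: (@ev_take A X h 1 evh) (@ev_take A X h' 1 evh').
    move: p p' h0 h0'; case: (h) => // -[a k] s; case: (h') => // -[a' k'] s' /=.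
    rewrite /par /= !take0 => -> -> _ _ /(_ isT) + /(_ isT).
    by rewrite /ev /= => <- <-.
  have nh' : (n < size h')%N by lia.
  have E := IH; rewrite n0 (ltnW nh) in E; have {}E := E isT.
  rewrite (take_nth (a0, 0%N) nh) (take_nth (a0, 0%N) nh') -E; congr rcons.
  set g := take n h in E *; have wg : wf g by exact: wf_take.
  set e := nth _ h n; set e' := nth _ h' n.
  have sg : size g = n by rewrite size_take nh.
  have eg : (e.2 < size g)%N.
    by have /(wfP a0)[_ /(_ n)] := wh; rewrite n0 nh sg => /(_ isT).
  have eg' : (e'.2 < size g)%N.
    by have /(wfP a0)[_ /(_ n)] := wh'; rewrite n0 nh' sg => /(_ isT).
  have [ee|ne] := eqVneq (ck g e.2 e.1) (ck g e'.2 e'.1).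
    by have := ck_inj wg eg eg' ee; case: (e) (e') => [? ?] [? ?] [/= -> ->].
  have nn : (0 < n < size h)%N by rewrite n0.
  have nn' : (0 < n < size h')%N by rewrite n0.
  have := ev_step evh nn (ck_act e'.1 eg').
  rewrite -/g /par /(ty _ _) -/e eq_sym => /(_ ne) lt1.
  have := ev_step evh' nn'; rewrite -E -/g /par /(ty _ _) -/e'.
  move=> /(_ _ (ck_act e.1 eg) ne) lt2.
  by have := lt_trans lt1 lt2; rewrite ltxx.
have := H (size h); rewrite h0 leqnn take_size => /(_ isT) E.
move: le; rewrite leq_eqVlt => /predU1P[e|lt]; first by rewrite E e take_size.
have nn : (0 < size h < size h')%N by rewrite h0.
have pl : (par a0 h' (size h) < size h)%N by have /(wfP a0)[_ /(_ _ nn)] := wh'.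
have := ev_step evh' nn (None_act _); rewrite -E => /(_ isT) lt1.
have := fh _ (ck_act (ty h' (size h)) pl) isT.
by move=> lt2; have := lt_trans lt1 lt2; rewrite ltxx.
Qed.

End Clocks.

Section ClocksToTree.
Variables (R : realType) (K : nat) (a0 : 'I_K).
Implicit Types (h : rtree K) (j y k : nat).
Local Notation ty := (ty a0).
Local Notation ck := (ck a0).
Local Notation act := (act a0).
Local Notation I := (option (clock_index K)).
Variables (A : 'I_K) (X : I -> R).
Hypothesis X_gt0 : forall i, 0 < X i.

Let clk u a N b : R := X (Some (u, a, N, b)).
Local Notation bt := (bp_type clk A).
Local Notation bb := (bp_birth clk A).
Local Notation res := (res a0 X).
Local Notation ev := (ev a0 A X).
Local Notation fev := (fev a0 A X).

Lemma arg_min_strict (F : 'I_K -> R) (c b : 'I_K) :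
  (forall b', b' != b -> F b < F b') -> [arg min_(i < c) F i]%O = b.
Proof.
move=> H; case: arg_minP => //= i _ Hi; apply/eqP/negPn/negP => /H.
by rewrite ltNge Hi.
Qed.

Fixpoint tm_rev h : R :=
  match h with
  | [::] => 0
  | e :: h' => if h' is [::] then 0
               else tm_rev h' + res (rev h') (ck (rev h') e.2 e.1)
  end.

Definition tm h := tm_rev (rev h).

Lemma tm_rcons h e : (0 < size h)%N -> tm (rcons h e) = tm h + res h (ck h e.2 e.1).
Proof.
move=> h0; rewrite /tm rev_rcons/=; have : (0 < size (rev h))%N by rewrite size_rev.
by case E : (rev h) => [//|x s] _; rewrite -E revK.
Qed.

Lemma bp_birth_cons k u : bb (k :: u) =
  bb u + \sum_(l < k.+1) clk u (bt u) l (bt (nat_of_ord l :: u)).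
Proof. by []. Qed.

Lemma bp_birth_last k u : bb (k :: u) =
  bb u + \sum_(l < k) clk u (bt u) l (bt (nat_of_ord l :: u)) + clk u (bt u) k (bt (k :: u)).
Proof. by rewrite bp_birth_cons big_ord_recr/= addrA. Qed.

Definition kids_time h j : R :=
  \sum_(k < nch h j) clk (wd h j) (ty h j) k (bt (nat_of_ord k :: wd h j)).

Lemma ev_inv h : wf h -> ev h ->
  [/\ res h None = X None - tm h,
      forall i, i \in act h -> 0 < res h i,
      forall j, (j < size h)%N -> bt (wd h j) = ty h j,
      forall j, (j < size h)%N -> bb (wd h j) <= tm h
    & forall j b, (j < size h)%N -> res h (ck h j b) =
        bb (wd h j) + kids_time h j + clk (wd h j) (ty h j) (nch h j) b - tm h].
Proof.
elim/wf_ind => [e Ae|{}h b j wh jh IH].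
  have tm0 : tm [:: e] = 0 by [].
  split=> [|i _|[|//] _|[|//] _|[|//] b _]; rewrite ?tm0 ?subr0.
  - by [].
  - exact: X_gt0.
  - exact: Ae.
  - exact: lexx.
  - by rewrite /kids_time big_ord0 /= !add0r.
have h0 : (0 < size h)%N by lia.
have wh' : wf (rcons h (b, j)) by rewrite wf_rcons// wh.
move=> /(ev_rcons _ _ _ _ h0)[/IH[I1 I5 I2 I4 I3]] /= lt.
set h' := rcons h (b, j); set i0 := ck h j b.
have i0h : i0 \in act h by exact: ck_act.
have tmE : tm h' = tm h + res h i0 by rewrite tm_rcons.
have tmle : tm h <= tm h' by rewrite tmE lerDl ltW// I5.
have fresh i : i \in act h' -> i \notin act h -> res h' i = X i.
  move=> ia' ia; rewrite res_rcons// (negbTE ia) res_fresh//.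
  by have := act_dead wh' ia'; rewrite dead_rcons// negb_or => /andP[].
have ni0 i : i \in act h' -> i != i0.
  move=> ia'; apply/eqP => e; have := act_dead wh' ia'.
  by rewrite e dead_rcons//= !eqxx orbT.
have btb : bt (nch h j :: wd h j) = b.
  rewrite /= (I2 _ jh); apply: arg_min_strict => b' nb.
  have nck : ck h j b' != i0.
    by apply: contra nb => /eqP /(ck_inj wh jh jh)[->].
  by have := lt _ (ck_act a0 b' jh) nck; rewrite !I3// ltrD2r ltrD2l.
have bbn : bb (nch h j :: wd h j) = tm h'.
  rewrite tmE I3// bp_birth_last btb (I2 _ jh) /kids_time; ring.
have wdo y : (y < size h)%N -> wd h' y = wd h y by move=> yh; rewrite wd_rcons// yh.
have wdn : wd h' (size h) = nch h j :: wd h j by rewrite wd_rcons// ltnn eqxx.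
have tyo y : (y < size h)%N -> ty h' y = ty h y by move=> yh; rewrite ty_rcons yh.
have tyn : ty h' (size h) = b by rewrite ty_rcons ltnn eqxx.
have sumS y : (y < size h)%N -> kids_time h' y =
    kids_time h y + if y == j then clk (wd h j) (ty h j) (nch h j) b else 0.
  move=> yh; rewrite /kids_time wdo// tyo//; have [->|ne] := eqVneq y j.
    have -> : nch h' j = (nch h j).+1 by rewrite nch_rcons//= eqxx addn1.
    rewrite big_ord_recr [nat_of_ord ord_max]/= btb; congr (_ + _).
  have -> : nch h' y = nch h y by rewrite nch_rcons//= eq_sym (negbTE ne) addn0.
  by rewrite addr0.
split.
- by rewrite res_rcons// None_act I1 tmE; ring.
- move=> i ia'; have [ia|ia] := boolP (i \in act h); last by rewrite fresh.
  by rewrite res_rcons// ia subr_gt0 lt// ni0.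
- move=> y; rewrite size_rcons ltnS leq_eqVlt => /predU1P[->|yh].
    by rewrite wdn btb tyn.
  by rewrite wdo// tyo// I2.
- move=> y; rewrite size_rcons ltnS leq_eqVlt => /predU1P[->|yh].
    by rewrite wdn bbn.
  by rewrite wdo//; apply: le_trans tmle; exact: I4.
- move=> y b'; rewrite size_rcons ltnS leq_eqVlt => /predU1P[->|yh].
    rewrite fresh; [|by apply: ck_act; rewrite size_rcons|exact: (ck_fresh a0 b b' wh jh).2].
    have nch0 : nch h' (size h) = 0%N.
      by rewrite nch_rcons//= (nch_size a0 wh (leqnn _)) (ltn_eqF jh).
    rewrite wdn bbn /kids_time nch0 big_ord0 tyn addr0 addrAC subrr add0r.
    by rewrite /clk /(ck _ _ _) wdn tyn nch0.
  rewrite wdo// tyo// (sumS _ yh); have [->|ne] := eqVneq y j; last first.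
    rewrite /h' ck_rcons// res_rcons// ck_act// I3// addr0 tmE nch_rcons//= eq_sym (negbTE ne) addn0; ring.
  rewrite fresh; [|by apply: ck_act; rewrite size_rcons ltnW|exact: (ck_fresh a0 b b' wh jh).1].
  rewrite tmE I3// /clk /(ck _ _ _) wdo// tyo//; ring.
Qed.

Lemma fev_BP h : wf h -> fev h -> BP clk A (X None) = Some (cls a0 h).
Proof.
move=> wh [/(ev_inv wh)[I1 I5 I2 I4 I3] lt].
rewrite /BP -(wd_root wh).
apply: (@subtree_at_transfer K _ _ (ty h) (chl a0 h) bt (bp_children clk A (X None))
  [set j | (j < size h)%N] (wd h)); last exact: shape_cls.
- by move=> j _ y /= [/andP[]].
- by move=> j j' jh jh'; exact: wd_inj.
- by move=> j jh; exact: I2.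
- move=> j jh /=; have tau0 := I5 _ (None_act a0 h).
  apply/seteqP; split=> v /=; last first.
    move=> [y [/andP[y0 yh] py] <-].
    have yy : (0 < y < size h)%N by rewrite y0.
    have [k kn E] := wd_parent a0 wh yy; rewrite py in kn.
    exists k; first by rewrite E py.
    by apply: le_trans (I4 _ yh) _; move: tau0; rewrite I1; lra.
  move=> [k -> bk]; have [kn|kn] := ltnP k (nch h j).
    by have [y [yh py E]] := wd_child a0 wh jh kn; exists y.
  exfalso; move: bk; apply/negP; rewrite -ltNge.
  set b := bt (nch h j :: wd h j).
  have le : bb (nch h j :: wd h j) <= bb (k :: wd h j).
    rewrite !bp_birth_cons lerD2l -(subnKC (n := k.+1) (m := (nch h j).+1)) ?ltnS// big_split_ord/=.
    by rewrite lerDl; apply: sumr_ge0 => i _; exact/ltW/X_gt0.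
  apply: lt_le_trans le; rewrite bp_birth_last -/b I2//.
  have := lt _ (ck_act a0 b jh) isT; rewrite I1 I3// /kids_time; lra.
- by rewrite /=; have /(wfP a0)[] := wh.
Qed.

End ClocksToTree.

Section ExponentialTail.
Context d (T : measurableType d) (R : realType) (P : probability T R).
Local Notation pr := (pr P).

Lemma exponential_tail (X : T -> R) (l r : R) : measurable_fun setT X ->
  (forall B, measurable B -> P (X @^-1` B) = exponential_prob l B) ->
  0 < l -> 0 <= r -> pr [set w | r < X w] = expR (- (l * r)).
Proof.
move=> mX HX l0 r0.
have mXB B : measurable B -> measurable (X @^-1` B).
  by move=> mB; have := mX measurableT B mB; rewrite setTI.
have neg : pr (X @^-1` `]-oo, 0[) = 0.
  apply: pr_eq; rewrite HX// /exponential_prob integral0_eq// => x /=.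
  by rewrite in_itv/= => x0; rewrite lt0_exponential_pdf.
have pos x : 0 < x -> pr (X @^-1` `[0, x]) = 1 - expR (- (l * x)).
  by move=> x0; apply: pr_eq; rewrite HX// exponential_prob_itv0c// mulNr.
have pos' : pr (X @^-1` `[0, r]) = 1 - expR (- (l * r)).
  move: r0; rewrite le_eqVlt => /predU1P[<-|]; last exact: pos.
  rewrite mulr0 oppr0 expR0 subrr; apply/eqP; rewrite eq_le pr_ge0 andbT.
  apply/ler_addgt0Pl => e e0; rewrite addr0.
  have el : 0 < e / l by rewrite divr_gt0.
  apply: (@le_trans _ _ (pr (X @^-1` `[0, e / l]))).
    apply: pr_le; try exact: mXB.
    by move=> w /=; rewrite !in_itv/= => /andP[-> /le_trans]; apply; exact: ltW.
  rewrite pos//; have := expR_ge1Dx (- (l * (e / l))).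
  rewrite (_ : l * (e / l) = e); first lra.
  by field; rewrite gt_eqF.
have mneg : measurable (X @^-1` `]-oo, 0[) by exact: mXB.
have mpos : measurable (X @^-1` `[0, r]) by exact: mXB.
have mgt : measurable (X @^-1` `]r, +oo[) by exact: mXB.
have -> : [set w | r < X w] = X @^-1` `]r, +oo[.
  by apply/seteqP; split=> w /=; rewrite in_itv/= andbT.
have e1 : pr (X @^-1` `]-oo, 0[ `|` X @^-1` `[0, r]) = 1 - expR (- (l * r)).
  rewrite prU// ?neg ?pos' ?add0r//; apply/seteqP; split=> w //= [].
  by rewrite !in_itv/= => x0 /andP[/(lt_le_trans x0)]; rewrite ltxx.
have : pr ((X @^-1` `]-oo, 0[ `|` X @^-1` `[0, r]) `|` X @^-1` `]r, +oo[) = 1.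
  rewrite (_ : _ `|` _ = setT) ?prT//; apply/seteqP; split=> w //= _.
  rewrite !in_itv/= andbT; have [?|x0] := ltP (X w) 0; first by left; left.
  by have [?|?] := leP (X w) r; [left; right|right].
rewrite prU//; first by rewrite e1; lra.
  exact: measurableU.
apply/seteqP; split=> w //= [[|]]; rewrite !in_itv/= ?andbT.
  by move=> x0 /(le_lt_trans r0) /(lt_trans x0); rewrite ltxx.
by move=> /andP[_ xr] /(le_lt_trans xr); rewrite ltxx.
Qed.

End ExponentialTail.

Section BranchingHistories.
Variables (R : realType) (K : nat) (a0 : 'I_K).
Variables (p : 'I_K -> R) (ph : 'I_K -> 'I_K -> R).
Hypotheses (p_gt0 : forall a, 0 < p a) (ph_gt0 : forall a b, 0 < ph a b).
Context d (T : measurableType d) (P : probability T R).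
Variables (A : T -> 'I_K) (tau : {RV P >-> R}).
Variable xi : seq nat -> 'I_K -> nat -> 'I_K -> {RV P >-> R}.
Hypothesis HBP : branching_setup p ph A tau xi.
Local Notation I := (option (clock_index K)).
Local Notation pr := (pr P).
Local Notation ty := (ty a0).
Local Notation ck := (ck a0).
Local Notation act := (act a0).
Local Notation rho := (rho a0 p ph).
Local Notation lam := (lam a0 ph).
Implicit Types (h : rtree K) (i : I).

Definition clock i : T -> R :=
  if i is Some (u, a, N, b) then xi u a N b else tau.
Definition rate i : R :=
  if i is Some (_, a, N, b) then ph a b * N.+1%:R else 2.

Lemma measurable_clock i : measurable_fun setT (clock i).
Proof. by case: i => [[[[u a] N] b]|]. Qed.

Lemma rate_gt0 i : 0 < rate i.
Proof. by case: i => [[[[u a] N] b]|] //=; rewrite mulr_gt0. Qed.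

Lemma measurable_type a : measurable [set w | A w = a].
Proof. by case: HBP => /(_ a)[]. Qed.

Lemma clock_law i B : measurable B -> P (clock i @^-1` B) = exponential_prob (rate i) B.
Proof. by case: HBP => _ Ht Hx _; case: i => [[[[u a] N] b]|]; [exact: Hx|exact: Ht]. Qed.

Lemma type_clock_law a (J : seq I) (r : I -> R) : uniq J -> (forall i, 0 <= r i) ->
  pr ([set w | A w = a] `&` [set w | forall i, i \in J -> r i < clock i w]) =
  p a * \prod_(i <- J) expR (- (rate i * r i)).
Proof.
move=> uJ r0; case: HBP => HA _ _ indep.
pose E (i : option I) : set T :=
  if i is Some i' then [set w | r i' < clock i' w] else [set w | A w = a].
have EE i : [set w | r i < clock i w] = clock i @^-1` `]r i, +oo[.
  by apply/seteqP; split=> w /=; rewrite in_itv/= andbT.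
have := indep (None :: map Some J) E.
have -> : \bigcap_(i in [set` None :: map Some J]) E i =
    [set w | A w = a] `&` [set w | forall i, i \in J -> r i < clock i w].
  apply/seteqP; split=> w /=.
    move=> H; split; first exact: (H None (mem_head _ _)).
    by move=> i iJ; apply: (H (Some i)); rewrite /= inE map_f.
  move=> [Aa H] i /=; rewrite inE => /predU1P[->//|/mapP[i' iJ ->]]; exact: H.
move=> Hind; apply: pr_eq; rewrite Hind.
- rewrite big_cons big_map EFinM [P (E None)](HA a).2; congr (_ * _)%E.
  rewrite -prodEFin; apply: eq_bigr => i _; rewrite /E.
  rewrite -(exponential_tail (measurable_clock i) (clock_law i) (rate_gt0 i) (r0 i)) -prE//.
  by apply: measurable_lt; [exact: measurable_cst|exact: measurable_clock].
- have /map_inj_uniq uS : injective (@Some I) by move=> ? ? [].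
  by rewrite /= uS uJ andbT; apply/negP => /mapP[].
- move=> i _; case: i => [[[[[u a'] N] b]|]|] /=.
  + by exists `]r (Some (u, a', N, b)), +oo[%classic => //; rewrite -EE.
  + by exists `]r None, +oo[%classic => //; rewrite -EE.
  + by exists [set a].
Qed.

Lemma sum_rate_act h : \sum_(i <- act h) rate i = 2 + lam h.
Proof.
rewrite big_cons big_allpairs_dep lamE /index_iota subn0; congr (_ + _).
by apply: eq_bigr => j _; rewrite big_enum.
Qed.

Local Notation clk w := (clock^~ w).

Lemma measurable_res h i : measurable_fun setT (fun w => res a0 (clk w) h i).
Proof.
elim/last_ind: h i => [|h e IH] i; first exact: measurable_clock.
have [h0|h0] := posnP (size h).
  by case: h h0 {IH} => //= _; exact: measurable_clock.
have E w := res_rcons a0 (clk w) e i h0.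
move: E; case: (i \in act h) => /funext ->; last exact: IH.
by apply: measurable_realfun.measurable_funB; exact: IH.
Qed.

Lemma measurable_ev h : measurable [set w | ev a0 (A w) (clk w) h].
Proof.
elim/last_ind: h => [|h e IH]; first exact: measurable0.
have [h0|h0] := posnP (size h).
  by case: h h0 {IH} => //= _; exact: measurable_type.
rewrite (_ : mkset _ = [set w | ev a0 (A w) (clk w) h] `&`
  [set w | forall i, i \in act h -> i != ck h e.2 e.1 ->
    res a0 (clk w) h (ck h e.2 e.1) < res a0 (clk w) h i]).
  apply: measurableI => //.
  apply: (@measurable_forall_in2 _ _ _ _ (fun i => i != ck h e.2 e.1)
    (fun i => [set w | res a0 (clk w) h (ck h e.2 e.1) < res a0 (clk w) h i])) => i _.
  by apply: measurable_lt; exact: measurable_res.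
by apply/seteqP; split=> w; rewrite /mkset ev_rcons.
Qed.

Lemma ev_law h : wf h -> forall J, uniq J -> all (fun i => ~~ dead h i) J ->
  forall r : I -> R, (forall i, 0 <= r i) ->
  pr ([set w | ev a0 (A w) (clk w) h] `&`
      [set w | forall i, i \in J -> r i < res a0 (clk w) h i]) =
  rho h * \prod_(i <- J) expR (- (rate i * r i)).
Proof.
elim/wf_ind => [e J uJ _ r r0|{}h b j wh jh IH J uJ aJ r r0].
  exact: type_clock_law.
have h0 : (0 < size h)%N by lia.
set i0 := ck h j b.
have i0act : i0 \in act h by exact: ck_act.
have aliveJ i : i \in J -> ~~ dead h i /\ i != i0.
  move=> /(allP aJ); rewrite dead_rcons// negb_or => /andP[-> ni]; split=> //.
  by apply: contra ni => /eqP ->; rewrite /= !eqxx.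
pose L := rem i0 (undup (act h ++ J)).
have uL : uniq (i0 :: L).
  rewrite -(perm_uniq (perm_to_rem _)) ?undup_uniq//.
  by rewrite mem_undup mem_cat i0act.
have memL i : (i \in L) = (i != i0) && ((i \in act h) || (i \in J)).
  by rewrite mem_rem_uniq ?undup_uniq// inE mem_undup mem_cat.
pose r' i := if i \in J then r i else 0.
have r'0 i : 0 <= r' i by rewrite /r'; case: ifP.
have aL : all (fun i => ~~ dead h i) (i0 :: L).
  apply/allP => i; rewrite inE => /predU1P[->|]; first exact: (act_dead wh i0act).
  rewrite memL => /andP[_ /orP[]]; first exact: act_dead.
  by move=> /aliveJ[].
have := @race _ T R P _ (fun i w => res a0 (clk w) h i) rate _ (rho h)
  (fun i => ~~ dead h i) (measurable_res h) (measurable_ev h) rate_gt0 IH i0 L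
  (mem (act h)) r' uL aL r'0.
have -> : rate i0 + \sum_(i <- L | mem (act h) i) rate i = 2 + lam h.
  rewrite -sum_rate_act (perm_big _ (perm_to_rem i0act)) big_cons; congr (_ + _).
  rewrite -[LHS]big_filter; apply: perm_big; apply: uniq_perm.
  - by rewrite filter_uniq//; case/andP: uL.
  - by rewrite rem_uniq// uniq_act.
  - move=> i; rewrite mem_filter memL mem_rem_uniq ?uniq_act// !inE /=.
    by case: (i == None); case: (i != i0); case: (i \in [seq _ | _ <- _, _ <- _]).
have -> : \prod_(i <- L) expR (- (rate i * r' i)) = \prod_(i <- J) expR (- (rate i * r i)).
  rewrite (bigID (mem J)) /= [X in _ * X]big1 ?mulr1; last first.
    by move=> i /negbTE iJ; rewrite /r' iJ mulr0 oppr0 expR0.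
  rewrite -[LHS]big_filter (perm_big J) /=.
    by apply: eq_big_seq => i iJ; rewrite /r' iJ.
  apply: uniq_perm => //; first by rewrite filter_uniq//; case/andP: uL.
  move=> i; rewrite mem_filter memL; case iJ : (i \in J) => //=.
  by rewrite orbT andbT; have [_ ->] := aliveJ i iJ.
have -> : rate i0 = rt a0 ph h j b by [].
rewrite rho_rcons//= -[rho h * _ / _]mulrA => <-; congr pr.
apply/seteqP; split=> w.
  move=> [/(ev_rcons _ _ _ _ h0)[evw lt] H]; split=> // i.
  rewrite memL => /andP[ni0 iU]; rewrite /r'.
  have [iJ|iJ] := boolP (i \in J).
    have := H i iJ; rewrite res_rcons//=; case: ifP => iact.
      by rewrite /= mul1r ltrBrDr.
    by rewrite /= mul0r addr0.
  by move: iU; rewrite (negbTE iJ) orbF => iact; rewrite /= iact mul1r add0r; exact: lt.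
move=> [evw H]; split.
  apply/(ev_rcons _ _ _ _ h0); split=> // i iact ni.
  have := H i; rewrite memL ni iact => /(_ isT); rewrite /= ?iact mul1r.
  by apply: le_lt_trans; rewrite lerDr.
move=> i iJ; have [nd ni] := aliveJ i iJ.
have := H i; rewrite memL ni iJ orbT => /(_ isT); rewrite /r' iJ res_rcons//=.
by case: ifP => iact; rewrite /= ?mul1r ?ltrBrDr// mul0r addr0.
Qed.

Lemma measurable_fev h : measurable [set w | fev a0 (A w) (clk w) h].
Proof.
rewrite (_ : mkset _ = [set w | ev a0 (A w) (clk w) h] `&`
  [set w | forall i, i \in act h -> i != None ->
    res a0 (clk w) h None < res a0 (clk w) h i]) //.
apply: measurableI; first exact: measurable_ev.
apply: (@measurable_forall_in2 _ _ _ _ (fun i => i != None)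
  (fun i => [set w | res a0 (clk w) h None < res a0 (clk w) h i])) => i _.
by apply: measurable_lt; exact: measurable_res.
Qed.

Lemma fev_law h : wf h -> pr [set w | fev a0 (A w) (clk w) h] = vph a0 p ph h.
Proof.
move=> wh; pose L := behead (act h).
have uL : uniq (None :: L) by exact: uniq_act.
have aL : all (fun i => ~~ dead h i) (None :: L) by apply/allP => i; exact: act_dead.
have := @race _ T R P _ (fun i w => res a0 (clk w) h i) rate _ (rho h)
  (fun i => ~~ dead h i) (measurable_res h) (measurable_ev h) rate_gt0 (ev_law wh) None L
  xpredT (fun=> 0) uL aL (fun=> lexx _).
have E0 : rate None + \sum_(i <- L) rate i = 2 + lam h by rewrite -sum_rate_act big_cons.
rewrite E0.
rewrite [X in _ * _ * X]big1 ?mulr1 => [|i _]; last by rewrite mulr0 oppr0 expR0.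
move=> E; rewrite /vph [2 * _]mulrC -mulrA -E; congr pr.
apply/seteqP; split=> w [evw H]; split=> // i.
  move=> iL; rewrite add0r mul1r; apply: H; first by rewrite inE iL orbT.
  by apply: contraTneq iL => ->; case/andP: uL.
by rewrite inE => /predU1P[->//|iL] _; have := H i iL; rewrite add0r mul1r.
Qed.

End BranchingHistories.

(** * The law of the branching process at an exponential time *)

Section CountableMeasurability.
Context d (T : measurableType d).

Lemma measurable_prop (Q : Prop) : measurable [set _ : T | Q].
Proof.
have [H|H] := pselect Q.
  by rewrite (_ : mkset _ = setT)//; apply/seteqP; split.
by rewrite (_ : mkset _ = set0)//; apply/seteqP; split.
Qed.

Lemma measurable_exists (C : countType) (F : C -> set T) :
  (forall x, measurable (F x)) -> measurable [set w | exists x, F x w].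
Proof.
move=> mF; rewrite (_ : mkset _ = \bigcup_n (if unpickle n is Some x then F x else set0)).
  by apply: bigcupT_measurable => n; case: (unpickle n).
apply/seteqP; split=> w /=; first by move=> [x Fx]; exists (pickle x) => //; rewrite pickleK.
by move=> [n _]; case: (unpickle n) => // x Fx; exists x.
Qed.

Lemma measurable_forall (C : countType) (F : C -> set T) :
  (forall x, measurable (F x)) -> measurable [set w | forall x, F x w].
Proof.
move=> mF; rewrite -[X in measurable X]setCK; apply: measurableC.
rewrite (_ : ~` _ = [set w | exists x, (~` F x) w]).
  by apply: measurable_exists => x; exact: measurableC.
by apply/seteqP; split=> w /=; [move=> /existsNP|move=> [x nF] /(_ x)].
Qed.

Lemma measurable_discrete (C : countType) (f : T -> C) (S : C -> set T) :
  (forall c, measurable [set w | f w = c]) -> (forall c, measurable (S c)) ->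
  measurable [set w | S (f w) w].
Proof.
move=> mf mS; rewrite (_ : mkset _ = [set w | exists c, ([set w | f w = c] `&` S c) w]).
  by apply: measurable_exists => c; exact: measurableI.
apply/seteqP; split=> w /=; first by move=> Sw; exists (f w).
by move=> [c [<-]].
Qed.

Lemma measurable_discrete_pair (C D : countType) (f : T -> C) (g : T -> D) (S : C -> D -> set T) :
  (forall c, measurable [set w | f w = c]) -> (forall c, measurable [set w | g w = c]) ->
  (forall c e, measurable (S c e)) -> measurable [set w | S (f w) (g w) w].
Proof.
move=> mf mg mS; apply: (@measurable_discrete C f (fun c => [set w | S c (g w) w])) => // c.
exact: measurable_discrete.
Qed.

End CountableMeasurability.

Section BranchingMeasurability.
Context d (T : measurableType d) (R : realType) (P : probability T R) (K : nat).
Variables (A : T -> 'I_K) (tau : {RV P >-> R}).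
Variable xi : seq nat -> 'I_K -> nat -> 'I_K -> {RV P >-> R}.
Hypothesis mA : forall a, measurable [set w | A w = a].
Local Notation clk w := (fun u a N b => xi u a N b w).
Local Notation bt w := (bp_type (clk w) (A w)).
Local Notation bb w := (bp_birth (clk w) (A w)).

Lemma measurable_le_fun (f g : T -> R) : measurable_fun setT f -> measurable_fun setT g ->
  measurable [set w | f w <= g w].
Proof.
move=> mf mg; rewrite (_ : mkset _ = ~` [set w | g w < f w]).
  by apply: measurableC; exact: measurable_lt.
by apply/seteqP; split=> w /=; rewrite leNgt => /negP.
Qed.

Lemma measurable_argmin (F : 'I_K -> T -> R) (c c' : 'I_K) :
  (forall b, measurable_fun setT (F b)) ->
  measurable [set w | [arg min_(b < c) F b w]%O = c'].
Proof.
move=> mF.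
pose M w : {ffun 'I_K * 'I_K -> bool} := [ffun x => F x.1 w <= F x.2 w].
pose g (m : {ffun 'I_K * 'I_K -> bool}) := odflt c [pick i | [forall j, m (i, j)]].
rewrite (_ : mkset _ = [set w | g (M w) = c']).
  apply: (@measurable_discrete _ _ _ M (fun m => [set w : T | g m = c'])) => m; last first.
    exact: measurable_prop.
  rewrite (_ : mkset _ = [set w | forall x, x \in enum {: 'I_K * 'I_K} ->
      [set w | (F x.1 w <= F x.2 w) = m x] w]).
    apply: measurable_forall_in => x _; case: (m x).
      by apply: measurable_le_fun.
    rewrite (_ : mkset _ = ~` [set w | F x.1 w <= F x.2 w]).
      by apply: measurableC; exact: measurable_le_fun.
    by apply/seteqP; split=> w /=; [move=> -> //|move/negP/negbTE].
  apply/seteqP; split=> w /=; first by move=> <- x _; rewrite ffunE.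
  by move=> H; apply/ffunP => x; rewrite ffunE H// mem_enum.
apply/seteqP; split=> w /=; suff -> : [arg min_(b < c) F b w]%O = g (M w) by [].
  rewrite /g /Order.arg_min /extremum; congr odflt; apply: eq_pick => i /=.
  by apply: eq_forallb => j; rewrite ffunE.
rewrite /g /Order.arg_min /extremum; congr odflt; apply: eq_pick => i /=.
by apply: eq_forallb => j; rewrite ffunE.
Qed.

Lemma measurable_bt u c : measurable [set w | bt w u = c].
Proof.
elim: u c => [|k u IH] c /=; first exact: mA.
apply: (@measurable_discrete _ _ _ (fun w => bt w u)
  (fun c' => [set w | [arg min_(b < c') xi u c' k b w]%O = c])) => // c'.
exact: measurable_argmin.
Qed.

Lemma measurable_bb u : measurable_fun setT (fun w => bb w u).
Proof.
elim: u => [|k u IH]; first exact: measurable_cst.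
rewrite (_ : (fun w => _) = (fun w => bb w u +
  \sum_(j < k.+1) xi u (bt w u) j (bt w (nat_of_ord j :: u)) w)) //.
apply: measurable_realfun.measurable_funD => //.
apply: measurable_sum => j _ B mB; rewrite setTI.
apply: (@measurable_discrete_pair _ _ _ _ (fun w => bt w u)
  (fun w => bt w (nat_of_ord j :: u)) (fun c c' => xi u c j c' @^-1` B)).
- exact: measurable_bt.
- exact: measurable_bt.
- move=> c c'; have m : measurable_fun setT (xi u c j c') by [].
  by have := m measurableT B mB; rewrite setTI.
Qed.

Lemma measurable_is_shape t u :
  measurable [set w | is_shape (bt w) (bp_children (clk w) (A w) (tau w)) t u].
Proof.
elim/ptree_mem_ind: t u => a ts IH u.
rewrite (_ : mkset _ = [set w | bt w u = a] `&`
  [set w | exists xs : seq (seq nat), ([set w | uniq xs] `&`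
     ([set w | forall v : seq nat, bp_children (clk w) (A w) (tau w) u v <-> v \in xs] `&`
      [set w | all2P (is_shape (bt w) (bp_children (clk w) (A w) (tau w))) ts xs])) w]); last first.
  apply/seteqP; split=> w /= [-> [xs]].
    by move=> [uxs cE H]; split=> //; exists xs; split=> //; split=> // v; rewrite cE.
  by move=> [uxs [cE H]]; split=> //; exists xs; split=> //; apply/seteqP; split=> v /cE.
apply: measurableI; first exact: measurable_bt.
apply: measurable_exists => xs; apply: measurableI.
  exact: measurable_prop.
apply: measurableI.
  apply: (@measurable_forall _ _ _ (fun v => [set w | bp_children (clk w) (A w) (tau w) u v <-> v \in xs])) => v.
  have m : measurable [set w | bp_children (clk w) (A w) (tau w) u v].
    case: v => [|k v].
      rewrite (_ : mkset _ = set0)//; apply/seteqP; split=> w //= [k] //.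
    have [->|ne] := eqVneq v u; last first.
      rewrite (_ : mkset _ = set0)//; apply/seteqP; split=> w //= [k' [_ e]].
      by rewrite e eqxx in ne.
    rewrite (_ : mkset _ = [set w | bb w (k :: u) <= tau w]).
      by apply: measurable_le_fun => //; exact: measurable_bb.
    by apply/seteqP; split=> w /=; [case|exists k].
  case: (v \in xs).
    by rewrite (_ : mkset _ = [set w | bp_children (clk w) (A w) (tau w) u v])//; apply/seteqP; split=> w /=; [case=> _; apply|].
  rewrite (_ : mkset _ = ~` [set w | bp_children (clk w) (A w) (tau w) u v]).
    exact: measurableC.
  by apply/seteqP; split=> w /=; [case=> + _ => h /h|move=> h; split].
elim: ts IH xs => [|t ts IHts] IH [|x xs] /=.
- by rewrite (_ : mkset _ = setT)//; apply/seteqP.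
- by rewrite (_ : mkset _ = set0)//; apply/seteqP.
- by rewrite (_ : mkset _ = set0)//; apply/seteqP.
- apply: (@measurableI _ _ [set w | is_shape _ _ t x] [set w | all2P _ ts xs]).
    by apply: IH; rewrite mem_head.
  by apply: IHts => t' t'ts; apply: IH; rewrite inE t'ts orbT.
Qed.

Lemma measurable_BP t : measurable [set w | BP (clk w) (A w) (tau w) = Some t].
Proof.
rewrite (_ : mkset _ = [set w | exists t', ((fun t' => if tclass t' == t then
  [set w | is_shape (bt w) (bp_children (clk w) (A w) (tau w)) t' [::]] else set0) t') w]).
  by apply: measurable_exists => t'; case: ifP => // _; exact: measurable_is_shape.
apply/seteqP; split=> w /=.
  by move=> /subtree_at_Some[t' H <-]; exists t'; rewrite eqxx.
by move=> [t']; case: eqP => // <- /subtree_at_shape.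
Qed.

End BranchingMeasurability.

Section HistoryLists.
Variables (K : nat) (a0 : 'I_K).

Fixpoint hsl n : seq (rtree K) := if n is n'.+1 then hsl n' ++ hs K n' else [::].

Lemma mem_hsl n h : h \in hsl n -> [/\ wf h, (size h <= n)%N & par a0 h 0 = 0%N].
Proof.
elim: n => [//|n IH]; rewrite /= mem_cat => /orP[/IH[-> s ->]|/(mem_hs a0)[-> -> ->]] //.
by split=> //; exact: leqW.
Qed.

Lemma uniq_hsl n : uniq (hsl n).
Proof.
elim: n => [//|n IH]; rewrite /= cat_uniq IH uniq_hs// andbT /=.
apply/hasPn => h /(mem_hs a0)[_ sh _]; apply/negP => /mem_hsl[_ + _].
by rewrite sh ltnn.
Qed.

Lemma sum_hsl (R : nmodType) n (F : rtree K -> R) :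
  \sum_(h <- hsl n) F h = \sum_(0 <= m < n) \sum_(h <- hs K m) F h.
Proof.
elim: n => [|n IH]; first by rewrite big_nil big_geq.
by rewrite /= big_cat IH big_nat_recr.
Qed.

Lemma sum_by_class (R : realDomainType) (C : eqType) (c : rtree K -> C) (s : seq (rtree K)) (F : rtree K -> R) :
  \sum_(t <- undup (map c s)) \sum_(h <- s | c h == t) F h = \sum_(h <- s) F h.
Proof.
rewrite (exchange_big_dep xpredT)//= big_seq [RHS]big_seq; apply: eq_bigr => h hs.
rewrite big_mkcond (bigD1_seq (c h)) ?undup_uniq ?mem_undup ?map_f//= eqxx.
by rewrite big1 ?addr0// => t; rewrite eq_sym => /negbTE ->.
Qed.

End HistoryLists.

Section LawOfBP.
Variables (R : realType) (K : nat) (a0 : 'I_K).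
Variables (p : 'I_K -> R) (ph : 'I_K -> 'I_K -> R).
Hypotheses (p_gt0 : forall a, 0 < p a) (p1 : \sum_a p a = 1).
Hypothesis ph_gt0 : forall a b, 0 < ph a b.
Context d (T : measurableType d) (P : probability T R).
Variables (A : T -> 'I_K) (tau : {RV P >-> R}).
Variable xi : seq nat -> 'I_K -> nat -> 'I_K -> {RV P >-> R}.
Hypothesis HBP : branching_setup p ph A tau xi.
Local Notation pr := (pr P).
Local Notation cls := (cls a0).
Local Notation vph := (vph a0 p ph).
Local Notation clk w := ((clock tau xi)^~ w).
Local Notation varpi := (varpi_infty A tau xi).

Definition vr t : R := fine (varpi t).

Definition BPset t := [set w | BP (fun u a N b => xi u a N b w) (A w) (tau w) = Some t].

Lemma measurable_BPset t : measurable (BPset t).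
Proof. by apply: measurable_BP; exact: (measurable_type HBP). Qed.

Lemma varpiE t : varpi t = (vr t)%:E.
Proof. by rewrite /vr /varpi_infty fineK// fin_num_measure//; exact: measurable_BPset. Qed.

Lemma vr_ge0 t : 0 <= vr t.
Proof. exact: pr_ge0. Qed.

Definition positive_clocks := [set w | forall i, 0 < clock tau xi i w].

Lemma measurable_positive_clocks : measurable positive_clocks.
Proof.
apply: (@measurable_forall _ _ _ (fun i => [set w | 0 < clock tau xi i w])) => i.
by apply: measurable_lt; [exact: measurable_cst|exact: measurable_clock].
Qed.

Lemma pr_positive_clocks : pr (~` positive_clocks) = 0.
Proof.
apply: pr_eq; apply: measure_negligible; first exact/measurableC/measurable_positive_clocks.
pose N n := if unpickle n is Some i then ~` [set w | 0 < clock tau xi i w] else set0.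
have mi i : measurable [set w | 0 < clock tau xi i w].
  by apply: measurable_lt; [exact: measurable_cst|exact: measurable_clock].
apply: (@negligibleS _ _ _ _ (\bigcup_n N n)).
  move=> w /= /existsNP[i ni]; exists (pickle i) => //.
  by rewrite /N pickleK.
apply: negligible_bigcup => n; rewrite /N; case: (unpickle n) => [i|]; last exact: negligible_set0.
apply/negligibleP; first exact: measurableC.
apply: (etrans (prE P (measurableC (mi i)))); congr (_%:E).
have := prU P (mi i) (measurableC (mi i)) (setICr _); rewrite setUv prT.
rewrite (exponential_tail (measurable_clock tau xi i) (clock_law HBP i) (rate_gt0 ph_gt0 i) (lexx 0)).
by rewrite mulr0 oppr0 expR0; lra.
Qed.

Definition Hset h := [set w | fev a0 (A w) (clk w) h] `&` positive_clocks.

Lemma measurable_Hset h : measurable (Hset h).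
Proof.
by apply: measurableI; [exact: (measurable_fev _ HBP)|exact: measurable_positive_clocks].
Qed.

Lemma pr_Hset h : wf h -> pr (Hset h) = vph h.
Proof.
move=> wh; have mf := measurable_fev a0 HBP h.
have := pr_split P mf measurable_positive_clocks.
rewrite (fev_law a0 ph_gt0 HBP wh) => ->; rewrite /Hset.
suff -> : pr ([set w | fev a0 (A w) (clk w) h] `\` positive_clocks) = 0 by rewrite add0r.
apply/eqP; rewrite eq_le pr_ge0 andbT -pr_positive_clocks; apply: pr_le.
- exact/measurableD/measurable_positive_clocks.
- exact/measurableC/measurable_positive_clocks.
- by move=> w [].
Qed.

Lemma Hset_sub h : wf h -> Hset h `<=` BPset (cls h).
Proof. by move=> wh w [fh pos]; exact: (fev_BP pos wh fh). Qed.

Lemma Hset_inj n h h' w : h \in hsl K n -> h' \in hsl K n -> Hset h w -> Hset h' w -> h = h'.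
Proof.
by move=> /(mem_hsl a0)[wh _ ph0] /(mem_hsl a0)[wh' _ ph0'] [f _] [f' _]; exact: (fev_inj wh wh' ph0 ph0' f f').
Qed.

Lemma sum_vph_le n (b : pred (rtree K)) B : measurable B ->
  (forall h, h \in hsl K n -> b h -> Hset h `<=` B) ->
  \sum_(h <- hsl K n | b h) vph h <= pr B.
Proof.
move=> mB HB; rewrite -big_filter.
rewrite (eq_big_seq (fun h => pr (Hset h))); last first.
  by move=> h; rewrite mem_filter => /andP[_ /(mem_hsl a0)[wh _ _]]; rewrite pr_Hset.
apply: sum_pr_le => //.
- by rewrite filter_uniq// (uniq_hsl a0).
- by move=> h _; exact: measurable_Hset.
- by move=> h; rewrite mem_filter => /andP[bh hh]; exact: HB.
- move=> h h' w; rewrite !mem_filter => /andP[_ hh] /andP[_ hh'].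
  exact: Hset_inj hh hh'.
Qed.

Lemma vr_sum_ge n t : \sum_(h <- hsl K n | cls h == t) vph h <= vr t.
Proof.
apply: sum_vph_le; first exact: measurable_BPset.
by move=> h /(mem_hsl a0)[wh _ _] /eqP <-; exact: Hset_sub.
Qed.

Lemma hsl_total e : 0 < e -> exists n, 1 - e <= \sum_(h <- hsl K n) vph h.
Proof.
move=> e0; have := vph_total a0 p_gt0 ph_gt0 p1.
move=> /cvgrPdist_le/(_ e e0)[n _ /(_ n (leqnn n))] H; exists n; rewrite sum_hsl.
by move: H; rewrite ler_norml => /andP[_]; lra.
Qed.

Lemma vr_sum_le t e : 0 < e ->
  exists n, vr t - e <= \sum_(h <- hsl K n | cls h == t) vph h.
Proof.
move=> e0; have [n Hn] := hsl_total e0; exists n.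
rewrite (bigID (fun h => cls h == t)) /= in Hn.
have mt := measurable_BPset t.
have : \sum_(h <- hsl K n | cls h != t) vph h <= pr (~` BPset t).
  apply: sum_vph_le; first exact: measurableC.
  move=> h /(mem_hsl a0)[wh _ _] /eqP nt w /(Hset_sub wh) wB /=.
  by move=> wt; apply: nt; have := etrans (esym wB) wt; case.
have := prU P mt (measurableC mt) (setICr _); rewrite setUv prT -/(vr t).
rewrite -[pr (BPset t)]/(vr t); lra.
Qed.

Lemma vr_sum_le1 (s : seq (utree K)) : uniq s -> \sum_(t <- s) vr t <= 1.
Proof.
move=> us; rewrite -(prT P); apply: sum_pr_le => //.
- by move=> t _; exact: measurable_BPset.
- by move=> t t' w _ _ H H'; have := etrans (esym H) H'; case.
Qed.

Lemma vr_total e : 0 < e -> exists2 s, uniq s & 1 - e <= \sum_(t <- s) vr t.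
Proof.
move=> e0; have [n Hn] := hsl_total e0.
exists (undup (map cls (hsl K n))); first exact: undup_uniq.
apply: le_trans Hn _; rewrite -(sum_by_class cls); apply: ler_sum => t _.
exact: vr_sum_ge.
Qed.

Lemma vr_kids (eta : 'I_K -> R) e : (forall a, 0 < eta a) -> \sum_a eta a = 1 ->
  (forall a, \sum_b ph a b = 2 - p a / eta a) -> 0 < e ->
  exists2 s, uniq s & 1 - e <= \sum_(t <- s) vr t * (size (kids t))%:R.
Proof.
move=> eta0 eta1 phE e0.
have := vph_kids a0 p_gt0 ph_gt0 p1 eta0 eta1 phE.
move=> /cvgrPdist_le/(_ e e0)[n _ /(_ n (leqnn n))]; rewrite -sum_hsl => H.
exists (undup (map cls (hsl K n))); first exact: undup_uniq.
apply: (@le_trans _ _ (\sum_(h <- hsl K n) vph h * (nch h 0)%:R)).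
  by move: H; rewrite ler_norml => /andP[_]; lra.
rewrite -(sum_by_class cls); apply: ler_sum => t _.
apply: le_trans (_ : (\sum_(h <- hsl K n | cls h == t) vph h) * (size (kids t))%:R <= _); last first.
  by rewrite ler_wpM2r// vr_sum_ge.
rewrite mulr_suml big_seq_cond [leRHS]big_seq_cond; apply: ler_sum => h.
by move=> /andP[/(mem_hsl a0)[wh _ _] /eqP <-]; rewrite size_kids_cls.
Qed.

End LawOfBP.

(** * Degrees and attachment probabilities *)

Section Degrees.
Variables (K : nat) (a0 : 'I_K).
Implicit Types (g : rtree K) (v : nat).
Local Notation ty := (ty a0).

Definition dg (s : bool) g v : nat := (nch g v + ((v != 0%N) || s))%N.

Lemma degE s g (v : 'I_(size g)) : wf g -> deg s v = dg s g v.
Proof.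
move=> wg; rewrite /deg /dg.
have -> : [set w | Defs.adjacent v w]%SET = ([set w | parent v == Some w] :|: [set w | parent w == Some v])%SET.
  by apply/setP => w; rewrite !inE.
rewrite cardsU (_ : _ :&: _ = finset.set0) ?cards0 ?subn0; last first.
  apply/setP => w; rewrite !inE; apply/negbTE/negP => /andP[/eqP pv /eqP pw].
  have := children_lt a0 wg pv; have := children_lt a0 wg pw; lia.
have -> : #|[set w | parent w == Some v]%SET| = nch g v.
  rewrite (nchE a0) big_mkord -sum1_card big_mkcond/=; apply: eq_bigr => w _.
  by rewrite inE (parent_eq a0 wg); case: ifP.
have -> : #|[set w | parent v == Some w]%SET| = (v != 0%N :> nat).
  have [v0|v0] := eqVneq (nat_of_ord v) 0%N.
    apply/eqP; rewrite cards_eq0; apply/eqP/setP => w.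
    by rewrite !inE (parent_eq a0 wg) v0.
  have /(wfP a0)[_ H] := wg; have pl : (par a0 g v < size g)%N.
    by apply: ltn_trans (ltn_ord v); apply: H; rewrite lt0n v0 ltn_ord.
  have -> : [set w | parent v == Some w]%SET = [set Ordinal pl]%SET.
    apply/setP => w; rewrite !inE (parent_eq a0 wg) lt0n v0 /=.
    by rewrite eq_sym -val_eqE.
  by rewrite cards1.
by case: eqP => _; rewrite /= ?andbF ?andbT ?add0n ?addn0// addnC.
Qed.

Variable R : realType.

(* Total degree of the vertices of type a. *)
Definition Xmass s g a : R :=
  dsum a0 (fun c => (c == a)%:R) g - (~~ s && (ty g 0 == a))%:R.

Lemma Xm_rcons s g b j a : wf g -> (j < size g)%N ->
  Xmass s (rcons g (b, j)) a = Xmass s g a + (ty g j == a)%:R + (b == a)%:R.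
Proof.
move=> wg jg; have g0 : (0 < size g)%N by lia.
by rewrite /Xmass dsum_rcons// ty_rcons g0; ring.
Qed.

Lemma sum_dg s g (F : 'I_K -> R) : wf g ->
  \sum_(0 <= v < size g) F (ty g v) * (dg s g v)%:R = \sum_a F a * Xmass s g a.
Proof.
move=> wg; have /(wfP a0)[g0 _] := wg.
have dE (F' : 'I_K -> R) : \sum_(0 <= v < size g) F' (ty g v) * (dg s g v)%:R =
    dsum a0 F' g - (~~ s)%:R * F' (ty g 0).
  rewrite /dsum big_ltn// [in RHS]big_ltn// addrAC; congr (_ + _).
    rewrite /dg /=; case: s => /=; first by rewrite addn1 mul0r subr0.
    by rewrite addn0 -natr1; ring.
  by apply: eq_big_nat => v /andP[v0 _]; rewrite /dg -lt0n v0 addn1.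
rewrite dE /Xmass; under [RHS]eq_bigr do rewrite mulrBr.
rewrite sumrB; congr (_ - _).
  rewrite /dsum; under [RHS]eq_bigr do rewrite mulr_sumr.
  rewrite exchange_big; apply: eq_bigr => v _.
  rewrite (bigD1 (ty g v))//= eqxx mul1r big1 ?addr0// => c nc.
  by rewrite eq_sym (negbTE nc) mul0r mulr0.
rewrite (bigD1 (ty g 0))//= eqxx andbT big1 ?addr0; first by rewrite mulrC.
by move=> c nc; rewrite eq_sym (negbTE nc) andbF mulr0.
Qed.

Lemma Xm_sum s g a : wf g ->
  Xmass s g a = \sum_(0 <= v < size g) (ty g v == a)%:R * (dg s g v)%:R.
Proof.
move=> wg; rewrite (sum_dg s (fun c => (c == a)%:R))// (bigD1 a)//= eqxx mul1r.
by rewrite big1 ?addr0// => c nc; rewrite (negbTE nc) mul0r.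
Qed.

Lemma Xm_ge0 s g a : wf g -> 0 <= Xmass s g a.
Proof. by move=> wg; rewrite Xm_sum//; apply: sumr_ge0 => v _; rewrite mulr_ge0. Qed.

Lemma Xm_total_gt0 s g : wf g -> (size g == 1%N) ==> s -> 0 < \sum_a Xmass s g a.
Proof.
move=> wg sg; under eq_bigr do rewrite -[Xmass _ _ _]mul1r.
rewrite -(sum_dg s (fun=> 1))//; under eq_bigr do rewrite mul1r.
rewrite -natr_sum ltr0n; have /(wfP a0)[g0 _] := wg.
case: (size g) g0 sg => // -[|n] _ sg.
  by rewrite big_nat1 /dg; move: sg; rewrite implyTb => ->; rewrite orbT; lia.
by rewrite big_nat_recr//= /dg /=; lia.
Qed.

Variables (p : 'I_K -> R) (kappa : 'I_K -> 'I_K -> R).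
Hypothesis kappa_gt0 : forall a b, 0 < kappa a b.

Definition Zmass s g b : R := \sum_a kappa a b * Xmass s g a.
Definition attach_q s g b v : R := kappa (ty g v) b * (dg s g v)%:R / Zmass s g b.

Lemma attach_probE s g b (v : 'I_(size g)) : wf g -> attach_prob kappa s b v = attach_q s g b v.
Proof.
move=> wg; rewrite /attach_prob /attach_q (vtypeE a0) degE//; congr (_ / _).
rewrite /Zmass -(sum_dg s (fun a => kappa a b))// big_mkord.
by apply: eq_bigr => w _; rewrite (vtypeE a0) degE.
Qed.

Lemma Zm_gt0 s g b : wf g -> (size g == 1%N) ==> s -> 0 < Zmass s g b.
Proof.
move=> wg sg; have X0 := Xm_total_gt0 wg sg.
have Z0 : 0 <= Zmass s g b by apply: sumr_ge0 => a _; rewrite mulr_ge0 ?Xm_ge0// ltW.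
rewrite lt_neqAle Z0 andbT eq_sym; apply/negP => /eqP Z.
suff : \sum_a Xmass s g a = 0 by move=> E; rewrite E ltxx in X0.
apply: big1 => a _; apply/eqP; have := psumr_eq0P _ Z (i := a) => /(_ _ isT)/eqP.
rewrite mulf_eq0 (gt_eqF (kappa_gt0 _ _))/=; apply => c _.
by rewrite mulr_ge0 ?Xm_ge0// ltW.
Qed.

Lemma q_ge0 s g b v : wf g -> (size g == 1%N) ==> s -> 0 <= attach_q s g b v.
Proof. by move=> wg sg; rewrite divr_ge0 ?mulr_ge0 ?(ltW (kappa_gt0 _ _))// ltW// Zm_gt0. Qed.

Lemma sum_q s g b : wf g -> (size g == 1%N) ==> s -> \sum_(0 <= v < size g) attach_q s g b v = 1.
Proof.
move=> wg sg; rewrite -mulr_suml (sum_dg s (fun a => kappa a b))//.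
by rewrite divff// gt_eqF// Zm_gt0.
Qed.

Lemma sum_q_type s g b a : wf g ->
  \sum_(0 <= v < size g) (ty g v == a)%:R * attach_q s g b v = kappa a b * Xmass s g a / Zmass s g b.
Proof.
move=> wg; rewrite Xm_sum// mulr_sumr mulr_suml; apply: eq_bigr => v _.
by rewrite /attach_q; case: eqP => [->|_]; rewrite ?mul1r// !mul0r mulr0 mul0r.
Qed.

(* The conditional expectation of psi at the next step. *)
Definition mean_incr (psi : rtree K -> 'I_K -> nat -> R) s g : R :=
  \sum_b \sum_(0 <= v < size g) p b * attach_q s g b v * psi g b v.

End Degrees.

(** * Martingale deviations *)

Section Noise.
Context d (T : measurableType d) (R : realType) (P : probability T R).
Variables (K : nat) (a0 : 'I_K) (p : 'I_K -> R) (kappa : 'I_K -> 'I_K -> R).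
Hypotheses (p_gt0 : forall a, 0 < p a) (p1 : \sum_a p a = 1).
Hypothesis kappa_gt0 : forall a b, 0 < kappa a b.
Variable G : nat -> T -> rtree K.
Hypothesis HG : network_process p kappa P G.
Local Notation pr := (pr P).
Local Notation q := (attach_q a0 kappa).
Local Notation drift := (mean_incr a0 p kappa).
Implicit Types g : rtree K.

Lemma measurable_G n g : measurable [set w | G n w = g].
Proof. by case: HG. Qed.

Section FixedStart.
Variable g0 : rtree K.
Hypothesis wg0 : wf g0.
Let m := size g0.
Let s := m == 1%N.

Fixpoint gs n : seq (rtree K) :=
  if n is n'.+1 then
    [seq rcons g e | g <- gs n', e <- [seq (b, j) | b <- enum 'I_K, j <- iota 0 (size g)]]
  else [:: g0].

Lemma gsS n : gs n.+1 =
  [seq rcons g e | g <- gs n, e <- [seq (b, j) | b <- enum 'I_K, j <- iota 0 (size g)]].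
Proof. by []. Qed.

Lemma m_gt0 : (0 < m)%N.
Proof. by have /(wfP a0)[] := wg0. Qed.

Lemma mem_gs n g : g \in gs n -> [/\ wf g, size g = (m + n)%N & take m g = g0].
Proof.
have := m_gt0; elim: n g => [|n IH] g m0.
  by rewrite inE => /eqP ->; rewrite addn0 take_size.
rewrite gsS => /allpairsPdep[g' [e [g's ep ->]]].
have [wg sg tg] := IH g' m0 g's; have /allpairsPdep[b [j [_ jn ->]]] := ep.
rewrite mem_iota in jn; split.
- by rewrite wf_rcons ?wg//=; lia.
- by rewrite size_rcons sg addnS.
- by rewrite -cats1 takel_cat// sg leq_addr.
Qed.

Lemma uniq_gs n : uniq (gs n).
Proof.
elim: n => // n IH; rewrite gsS; apply: allpairs_uniq_dep => //.
  by move=> g _; apply: allpairs_uniq; rewrite ?enum_uniq ?iota_uniq// => -[b j] [b' j'] _ _ [-> ->].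
by move=> [g e] [g' e'] _ _ /= /rcons_inj[-> ->].
Qed.

Lemma sum_gsS n (F : rtree K -> R) : \sum_(g <- gs n.+1) F g =
  \sum_(g <- gs n) \sum_b \sum_(0 <= v < size g) F (rcons g (b, v)).
Proof.
rewrite gsS big_allpairs_dep; apply: eq_bigr => g _.
rewrite big_allpairs_dep /index_iota subn0; by rewrite big_enum.
Qed.

Definition atom n g := [set w | forall i, (i <= n)%N -> G i w = take (m + i) g].

Lemma measurable_atom n g : measurable (atom n g).
Proof.
have := @measurable_forall_in _ T _ (iota 0 n.+1) (fun i => [set w | G i w = take (m + i) g]).
move=> /(_ (fun i _ => measurable_G _ _)); congr measurable; apply/seteqP; split=> w; rewrite /mkset => H i.
  by move=> lin; apply: H; rewrite mem_iota.
by rewrite mem_iota => /H.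
Qed.

Lemma atom0 g : take m g = g0 -> atom 0 g = [set w | G 0%N w = g0].
Proof.
move=> tg; apply/seteqP; split=> w /=; first by move=> /(_ 0%N isT); rewrite addn0 tg.
by move=> E i; rewrite leqn0 => /eqP ->; rewrite addn0 tg.
Qed.

Lemma atom_step n g b v : g \in gs n -> (v < size g)%N ->
  pr (atom n.+1 (rcons g (b, v))) = pr (atom n g) * (p b * q s g b v).
Proof.
move=> /mem_gs[wg sg tg] vg.
have HG' (h : nat -> rtree K) g' (v' : 'I_(size g')) : h n = g' ->
    P [set w | (forall i, (i <= n)%N -> G i w = h i) /\ G n.+1 w = attach v' b] =
    (P [set w | forall i, (i <= n)%N -> G i w = h i] *
     (p b * attach_prob kappa (size (h 0%N) == 1%N) b v')%:E)%E.
  by move=> E; move: v'; rewrite -E => v'; case: HG => _ _; apply.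
have := HG' (fun i => take (m + i) g) g (Ordinal vg).
rewrite -sg take_size => /(_ erefl); rewrite addn0 tg (attach_probE a0)// -/m -/s.
rewrite (_ : [set w | _ /\ _] = atom n.+1 (rcons g (b, v))).
  rewrite -/(atom n g) (prE P (measurable_atom n g)) -EFinM => E.
  by rewrite (pr_eq E).
apply/seteqP; split=> w /=.
  move=> [H E] i; rewrite leq_eqVlt => /predU1P[->|].
    by rewrite E addnS -sg -(size_rcons g (b, v)) take_size.
  by rewrite ltnS => lin; rewrite H// -cats1 takel_cat// sg leq_add2l.
move=> H; split.
  by move=> i lin; rewrite H ?leqW// -cats1 takel_cat// sg leq_add2l.
by rewrite H// addnS -sg -(size_rcons g (b, v)) take_size.
Qed.

(* The expectation of F (G n) on the event G 0 = g0. *)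
Definition W n (F : rtree K -> R) := \sum_(g <- gs n) pr (atom n g) * F g.

Lemma size_ok n g : g \in gs n -> (size g == 1%N) ==> s.
Proof.
move=> /mem_gs[_ -> _]; apply/implyP => /eqP e; rewrite /s; apply/eqP.
by have := m_gt0; lia.
Qed.

Lemma sum_pq n g : g \in gs n -> \sum_b \sum_(0 <= v < size g) p b * q s g b v = 1.
Proof.
move=> gg; have [wg _ _] := mem_gs gg; rewrite -p1; apply: eq_bigr => b _.
by rewrite -mulr_sumr sum_q ?mulr1//; exact: size_ok gg.
Qed.

Lemma avg_const n g c : g \in gs n ->
  \sum_b \sum_(0 <= v < size g) p b * q s g b v * c = c.
Proof.
move=> gg; under eq_bigr do rewrite -mulr_suml.
by rewrite -mulr_suml (sum_pq gg) mul1r.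
Qed.

Lemma pq_ge0 n g b v : g \in gs n -> 0 <= p b * q s g b v.
Proof.
move=> gg; have [wg _ _] := mem_gs gg; rewrite mulr_ge0 ?(ltW (p_gt0 _))//.
by apply: q_ge0 => //; exact: size_ok gg.
Qed.

Lemma W_S n F : W n.+1 F =
  W n (fun g => \sum_b \sum_(0 <= v < size g) p b * q s g b v * F (rcons g (b, v))).
Proof.
rewrite /W sum_gsS; apply: eq_big_seq => g gg; rewrite mulr_sumr; apply: eq_bigr => b _.
rewrite mulr_sumr; apply: eq_big_nat => v /andP[_ vg].
by rewrite atom_step// !mulrA.
Qed.

Lemma eq_W n F F' : (forall g, g \in gs n -> F g = F' g) -> W n F = W n F'.
Proof. by move=> E; apply: eq_big_seq => g gg; rewrite E. Qed.

Lemma le_W n F F' : (forall g, g \in gs n -> F g <= F' g) -> W n F <= W n F'.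
Proof.
move=> E; rewrite /W big_seq [leRHS]big_seq; apply: ler_sum => g gg.
by rewrite ler_wpM2l ?pr_ge0// E.
Qed.

Lemma W_D n F F' : W n (fun g => F g + F' g) = W n F + W n F'.
Proof. by rewrite -big_split/=; apply: eq_bigr => g _; rewrite mulrDr. Qed.

Lemma W_Z n c F : W n (fun g => c * F g) = c * W n F.
Proof. by rewrite mulr_sumr; apply: eq_bigr => g _; rewrite mulrCA. Qed.

Lemma W_sum n (N : nat) (F : nat -> rtree K -> R) :
  W n (fun g => \sum_(0 <= k < N) F k g) = \sum_(0 <= k < N) W n (F k).
Proof. by rewrite exchange_big; apply: eq_bigr => g _; rewrite mulr_sumr. Qed.

Lemma W_const n c : W n (fun=> c) = c * pr [set w | G 0%N w = g0].
Proof.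
elim: n => [|n IH].
  by rewrite /W big_seq1 atom0 ?take_size// mulrC.
rewrite W_S -IH; apply: eq_W => g gg.
exact: avg_const gg.
Qed.

Lemma W_take n k F : (k <= n)%N -> W n (fun g => F (take (m + k) g)) = W k F.
Proof.
elim: n => [|n IH].
  rewrite leqn0 => /eqP ->; apply: eq_W => g /mem_gs[_ <- _]; by rewrite take_size.
rewrite leq_eqVlt => /predU1P[->|].
  by apply: eq_W => g /mem_gs[_ <- _]; rewrite take_size.
rewrite ltnS => kn; rewrite -IH// W_S; apply: eq_W => g gg.
have [_ sg _] := mem_gs gg.
rewrite -[RHS](avg_const _ gg); apply: eq_bigr => b _.
apply: eq_bigr => v _; congr (_ * F _).
by rewrite -cats1 takel_cat// sg leq_add2l.
Qed.

Lemma W_event n (b : pred (rtree K)) B : measurable B ->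
  (forall g, g \in gs n -> b g -> atom n g `<=` B) ->
  W n (fun g => (b g)%:R) <= pr ([set w | G 0%N w = g0] `&` B).
Proof.
move=> mB HB.
have -> : W n (fun g => (b g)%:R) = \sum_(g <- [seq g <- gs n | b g]) pr (atom n g).
  by rewrite big_filter big_mkcond; apply: eq_bigr => g _; case: ifP => _; rewrite ?mulr1 ?mulr0.
apply: sum_pr_le.
- by rewrite filter_uniq// uniq_gs.
- by move=> g _; exact: measurable_atom.
- by apply: measurableI => //; exact: measurable_G.
- move=> g; rewrite mem_filter => /andP[bg gg] w gw; split; last exact: HB gg bg w gw.
  have [_ _ tg] := mem_gs gg; by rewrite /= (gw 0%N isT) addn0.
- move=> g g' w; rewrite !mem_filter => /andP[_ /mem_gs[_ sg _]] /andP[_ /mem_gs[_ sg' _]].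
  by move=> /(_ n (leqnn n)) + /(_ n (leqnn n)); rewrite -{1}sg -sg' !take_size => -> ->.
Qed.

Section Psi.
Variables (psi : rtree K -> 'I_K -> nat -> R) (C : R).
Hypothesis psiC : forall g b v, wf g -> (v < size g)%N -> `|psi g b v| <= C.

Fixpoint noise_rev (r : rtree K) : R :=
  if r is e :: r' then
    if (size r <= m)%N then 0
    else noise_rev r' + (psi (rev r') e.1 e.2 - drift psi s (rev r'))
  else 0.

Definition noise g := noise_rev (rev g).

Lemma noise_rcons g e : (m <= size g)%N ->
  noise (rcons g e) = noise g + (psi g e.1 e.2 - drift psi s g).
Proof. by move=> mg; rewrite /noise rev_rcons/= size_rev ltnNge mg/= revK. Qed.

Lemma noise0 g : size g = m -> noise g = 0.
Proof. by rewrite -(size_rev g) /noise; case: (rev g) => //= e r ->; rewrite leqnn. Qed.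

Lemma drift_le n g : g \in gs n -> `|drift psi s g| <= C.
Proof.
move=> gg; have [wg _ _] := mem_gs gg; rewrite -[leRHS](avg_const _ gg).
apply: le_trans (ler_norm_sum _ _ _) _; apply: ler_sum => b _.
apply: le_trans (ler_norm_sum _ _ _) _; apply: ler_sum_nat => v /andP[_ vg].
rewrite normrM (ger0_norm (pq_ge0 _ _ gg)); apply: ler_wpM2l; first exact: (pq_ge0 _ _ gg).
exact: psiC.
Qed.

Lemma W_noise2 n : W n (fun g => noise g ^+ 2) <= 4 * C ^+ 2 * n%:R.
Proof.
elim: n => [|n IH].
  rewrite mulr0 (@eq_W _ _ (fun=> 0)) ?W_const ?mul0r//.
  by move=> g /mem_gs[_ sg _]; rewrite noise0 ?expr0n// sg addn0.
rewrite W_S -[n.+1%:R]natr1 mulrDr mulr1.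
have H : W n (fun=> 4 * C ^+ 2) <= 4 * C ^+ 2.
  rewrite W_const ler_piMr ?pr_le1//; last exact: measurable_G.
  by rewrite mulr_ge0 ?sqr_ge0.
apply: (@le_trans _ _ (W n (fun g => noise g ^+ 2 + 4 * C ^+ 2))); last first.
  by rewrite W_D lerD.
apply: le_W => g gg; have [wg sg _] := mem_gs gg.
set D := drift psi s g; set S := noise g.
have DC : `|D| <= C := drift_le gg.
apply: (@le_trans _ _ (\sum_b \sum_(0 <= v < size g) (p b * q s g b v * (S ^+ 2 - 2 * S * D) +
   2 * S * (p b * q s g b v * psi g b v) + p b * q s g b v * (psi g b v - D) ^+ 2))).
  apply: ler_sum => b _; apply: ler_sum => v _; rewrite noise_rcons ?sg ?leq_addr//=.
  by rewrite -/S -/D le_eqVlt; apply/orP; left; apply/eqP; ring.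
have -> : \sum_b \sum_(0 <= v < size g) (p b * q s g b v * (S ^+ 2 - 2 * S * D) +
   2 * S * (p b * q s g b v * psi g b v) + p b * q s g b v * (psi g b v - D) ^+ 2) =
   (S ^+ 2 - 2 * S * D) + 2 * S * D +
   \sum_b \sum_(0 <= v < size g) p b * q s g b v * (psi g b v - D) ^+ 2.
  under eq_bigr do rewrite !big_split/=; rewrite !big_split/=; congr (_ + _ + _).
    exact: avg_const gg.
  rewrite /D /mean_incr mulr_sumr; apply: eq_bigr => b _; by rewrite mulr_sumr.
rewrite -addrA; apply: (@le_trans _ _ (S ^+ 2 - 2 * S * D + (2 * S * D + 4 * C ^+ 2))); last by lra.
rewrite !lerD2l -[leRHS](avg_const _ gg).
apply: ler_sum => b _; apply: ler_sum_nat => v /andP[_ vg].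
apply: ler_wpM2l; first exact: (pq_ge0 _ _ gg).
have h : `|psi g b v - D| <= 2 * C.
  by apply: le_trans (ler_normB _ _) _; have := psiC b wg vg; lra.
rewrite -(real_normK (num_real (psi g b v - D))) (_ : 4 * C ^+ 2 = (2 * C) ^+ 2); last by ring.
by rewrite lerXn2r ?nnegrE//; apply: le_trans h.
Qed.

Definition vnoise n g : R := \sum_(0 <= k < n) `|noise (take (m + k) g)| / k.+1%:R ^+ 2.

Lemma sum_sqrt n : \sum_(0 <= k < n) (Num.sqrt k.+1%:R * k.+1%:R)^-1 <= 3 :> R.
Proof.
suff : \sum_(0 <= k < n.+1) (Num.sqrt k.+1%:R * k.+1%:R)^-1 <= 3 - 2 / Num.sqrt n.+1%:R :> R.
  rewrite big_nat_recr//= => H; apply: le_trans (le_trans _ H) _.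
    by rewrite lerDl invr_ge0 mulr_ge0 ?sqrtr_ge0.
  by rewrite lerBlDr lerDl divr_ge0// sqrtr_ge0.
elim: n => [|n IH]; first by rewrite big_nat1 sqrtr1 mul1r invr1; lra.
rewrite big_nat_recr//=; apply: le_trans (lerD IH (lexx _)) _.
set x := Num.sqrt n.+1%:R; set y := Num.sqrt n.+2%:R.
have x0 : 0 < x by rewrite sqrtr_gt0 ltr0n.
have y0 : 0 < y by rewrite sqrtr_gt0 ltr0n.
have x2 : x ^+ 2 = n.+1%:R by rewrite sqr_sqrtr.
have y2 : y ^+ 2 = n.+2%:R by rewrite sqr_sqrtr.
have xy : y ^+ 2 = x ^+ 2 + 1 by rewrite x2 y2 natr1.
have lxy : x <= y by rewrite ler_sqrt ?ler_nat// ltr0n.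
rewrite -y2 -lerBrDl (_ : 3 - 2 / y - (3 - 2 / x) = 2 * (y - x) / (x * y)); last first.
  by field; rewrite !gt_eqF.
rewrite -(ler_pM2r (_ : 0 < x * y ^+ 3)) ?mulr_gt0 ?exprn_gt0//.
rewrite (_ : (y * y ^+ 2)^-1 * (x * y ^+ 3) = x); last by field; rewrite gt_eqF.
rewrite (_ : _ / _ * _ = 2 * (y - x) * y ^+ 2); last by field; rewrite !gt_eqF.
have : (y - x) * (y + x) = 1 by rewrite -subr_sqr xy; ring.
have : 0 <= y - x by rewrite subr_ge0.
nra.
Qed.

Lemma W_vnoise n : W n (vnoise n) <= 2 * (4 * C ^+ 2 + 1).
Proof.
rewrite W_sum.
apply: (@le_trans _ _ (\sum_(0 <= k < n) (4 * C ^+ 2 + 1) / 2 * (Num.sqrt k.+1%:R * k.+1%:R)^-1)); last first.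
  rewrite -mulr_sumr; have := sum_sqrt n; have : 0 <= C ^+ 2 by exact: sqr_ge0.
  nra.
apply: ler_sum_nat => k /andP[_ kn].
rewrite (@W_take n k (fun g => `|noise g| / k.+1%:R ^+ 2)); last exact: ltnW.
set x := Num.sqrt k.+1%:R; have x0 : 0 < x by rewrite sqrtr_gt0 ltr0n.
have x2 : x ^+ 2 = k.+1%:R by rewrite sqr_sqrtr.
rewrite -x2.
apply: (@le_trans _ _ (W k (fun g => (2 * x ^+ 5)^-1 * noise g ^+ 2 + (2 * x ^+ 3)^-1))).
  apply: le_W => g _; rewrite -(real_normK (num_real (noise g))).
  set y := `|noise g|.
  rewrite (_ : _ + _ = (y ^+ 2 + x ^+ 2) / (2 * x ^+ 5)); last by field; rewrite gt_eqF.
  rewrite (_ : y / _ = (2 * x * y) / (2 * x ^+ 5)); last by field; rewrite gt_eqF.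
  rewrite ler_pM2r ?invr_gt0 ?mulr_gt0 ?exprn_gt0//.
  by have := sqr_ge0 (y - x); nra.
rewrite W_D W_Z W_const.
have g1 : pr [set w | G 0%N w = g0] <= 1 by apply: pr_le1; exact: measurable_G.
apply: (@le_trans _ _ ((2 * x ^+ 5)^-1 * (4 * C ^+ 2 * x ^+ 2) + (2 * x ^+ 3)^-1)).
  apply: lerD; last by rewrite ler_piMr// invr_ge0 mulr_ge0// exprn_ge0// ltW.
  rewrite ler_wpM2l ?invr_ge0 ?mulr_ge0 ?exprn_ge0 ?(ltW x0)//.
  apply: le_trans (W_noise2 k) _; rewrite x2; apply: ler_wpM2l; last by rewrite ler_nat.
  by rewrite mulr_ge0 ?sqr_ge0.
by rewrite le_eqVlt; apply/orP; left; apply/eqP; field; rewrite gt_eqF.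
Qed.

Lemma vnoise_le n B : 0 < B ->
  pr [set w | G 0%N w = g0] - 2 * (4 * C ^+ 2 + 1) / B <=
  W n (fun g => (vnoise n g <= B)%R%:R).
Proof.
move=> B0; rewrite -[X in X - _]mul1r -(W_const n 1) lerBlDr.
apply: (@le_trans _ _ (W n (fun g => (vnoise n g <= B)%R%:R + B^-1 * vnoise n g))).
  apply: le_W => g _; have v0 : 0 <= vnoise n g.
    by apply: sumr_ge0 => k _; rewrite divr_ge0// sqr_ge0.
  case: (leP (vnoise n g) B) => vB /=; first by rewrite lerDl mulr_ge0// invr_ge0 ltW.
  by rewrite add0r mulrC ler_pdivlMr// mul1r ltW.
by rewrite W_D W_Z lerD2l mulrC ler_wpM2r ?invr_ge0 ?(ltW B0)// W_vnoise.
Qed.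

End Psi.
End FixedStart.
End Noise.

Section AlmostSure.
Context d (T : measurableType d) (R : realType) (P : probability T R).
Variables (K : nat) (a0 : 'I_K) (p : 'I_K -> R) (kappa : 'I_K -> 'I_K -> R).
Hypotheses (p_gt0 : forall a, 0 < p a) (p1 : \sum_a p a = 1).
Hypothesis kappa_gt0 : forall a b, 0 < kappa a b.
Variable G : nat -> T -> rtree K.
Hypothesis HG : network_process p kappa P G.
Local Notation pr := (pr P).
Local Notation drift := (mean_incr a0 p kappa).

Definition step (g g' : rtree K) : Prop :=
  exists b v, (v < size g)%N /\ g' = rcons g (b, v).

Lemma null_of_starts (B : set T) : measurable B ->
  (forall g0, wf g0 -> pr ([set w | G 0%N w = g0] `\` B) = 0) ->
  \forall w \ae P, B w.
Proof.
move=> mB H; rewrite /almost_everywhere /=.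
pose N n := if unpickle n is Some g0 then
  (if wf g0 then [set w | G 0%N w = g0] `\` B else set0) else set0.
apply: (@negligibleS _ _ _ _ (\bigcup_n N n)).
  move=> w /= nB; exists (pickle (G 0%N w)) => //; rewrite /N pickleK.
  by have -> : wf (G 0%N w) by case: HG.
apply: negligible_bigcup => n; rewrite /N.
case: (unpickle n) => [g0|]; last exact: negligible_set0.
case: ifP => [wg0|_]; last exact: negligible_set0.
have m : measurable ([set w | G 0%N w = g0] `\` B).
  by apply: measurableD => //; exact: (measurable_G HG).
by apply/negligibleP => //; apply: (etrans (prE P m)); rewrite H.
Qed.

Lemma ae_and (A B : T -> Prop) : (\forall w \ae P, A w) -> (\forall w \ae P, B w) ->
  \forall w \ae P, A w /\ B w.
Proof. by move=> HA HB; apply: filterS2 HA HB => w; split. Qed.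

Lemma ae_countable (C : countType) (A : C -> T -> Prop) :
  (forall c, \forall w \ae P, A c w) -> \forall w \ae P, forall c, A c w.
Proof.
move=> H; rewrite /almost_everywhere /=.
apply: (@negligibleS _ _ _ _ (\bigcup_n (if unpickle n is Some c then ~` [set w | A c w] else set0))).
  by move=> w /= /existsNP[c nA]; exists (pickle c) => //; rewrite pickleK.
by apply: negligible_bigcup => n; case: (unpickle n) => [c|]; [exact: H|exact: negligible_set0].
Qed.

Lemma measurable_step n : measurable [set w | step (G n w) (G n.+1 w)].
Proof.
apply: (@measurable_discrete_pair _ _ _ _ (G n) (G n.+1) (fun g g' => [set w : T | step g g'])).
- exact: (measurable_G HG).
- exact: (measurable_G HG).
- by move=> g g'; exact: measurable_prop.
Qed.

Lemma steps_ae : \forall w \ae P, forall n, step (G n w) (G n.+1 w).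
Proof.
apply: ae_countable => n; apply: null_of_starts => [|g0 wg0]; first exact: measurable_step.
have mg : measurable [set w | G 0%N w = g0] by exact: (measurable_G HG).
have := pr_split P mg (measurable_step n).
suff : pr [set w | G 0%N w = g0] <= pr ([set w | G 0%N w = g0] `&` [set w | step (G n w) (G n.+1 w)]).
  have := pr_ge0 P ([set w | G 0%N w = g0] `\` [set w | step (G n w) (G n.+1 w)]).
  by move=> ? ?; lra.
rewrite -[leLHS]mul1r -(W_const a0 p1 kappa_gt0 HG wg0 n.+1 1).
apply: le_trans (W_event a0 HG wg0 (n := n.+1) (b := xpredT) (measurable_step n) _) => //.
move=> g gg _ w aw; have [wg sg _] := mem_gs a0 wg0 gg; rewrite /=.
have g0g : (0 < size g0)%N by have /(wfP a0)[] := wg0.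
rewrite (aw n (leqnSn n)) (aw n.+1 (leqnn _)).
have ng : (size g0 + n < size g)%N by rewrite sg addnS.
exists (ty a0 g (size g0 + n)), (par a0 g (size g0 + n)).
rewrite size_take ng; split.
  by have /(wfP a0)[_] := wg; apply; rewrite ng; lia.
by rewrite addnS (take_nth (a0, 0%N))// /ty /par; case: (nth _ _ _).
Qed.

Section Psi.
Variables (psi : rtree K -> 'I_K -> nat -> R) (C : R).
Hypothesis psiC : forall g b v, wf g -> (v < size g)%N -> `|psi g b v| <= C.

(* The accumulated deviation of psi from its conditional expectation along the
   path g. *)
Definition dev (g : nat -> rtree K) n : R :=
  \sum_(0 <= k < n) (psi (g k) (last (a0, 0%N) (g k.+1)).1 (last (a0, 0%N) (g k.+1)).2
                     - drift psi (size (g 0%N) == 1%N) (g k)).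

Definition vdev (g : nat -> rtree K) n : R := \sum_(0 <= k < n) `|dev g k| / k.+1%:R ^+ 2.

Lemma dev_atom g0 n g w : wf g0 -> g \in gs g0 n -> atom G g0 n g w ->
  forall k, (k <= n)%N -> dev (G^~ w) k = noise a0 p kappa g0 psi (take (size g0 + k) g).
Proof.
move=> wg0 gg aw; have [wg sg tg] := mem_gs a0 wg0 gg.
elim=> [|k IH] kn.
  by rewrite /dev big_geq// addn0 tg noise0.
rewrite /dev big_nat_recr//= -/(dev (G^~ w) k) IH 1?ltnW//.
rewrite (aw k.+1 kn) (aw k (ltnW kn)) (aw 0%N (leq0n _)) addn0 tg addnS.
have ng : (size g0 + k < size g)%N by rewrite sg ltn_add2l.
rewrite (take_nth (a0, 0%N) ng) last_rcons noise_rcons//.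
by rewrite size_take ng leq_addr.
Qed.

Lemma measurable_vdev n B : measurable [set w | vdev (G^~ w) n <= B].
Proof.
pose H w := [seq G i w | i <- iota 0 n.+1].
have HE w : vdev (G^~ w) n = vdev (nth [::] (H w)) n.
  have nE k : (k <= n)%N -> nth [::] (H w) k = G k w.
    by move=> kn; rewrite (nth_map 0%N) ?size_iota// nth_iota.
  apply: eq_big_nat => k /andP[_ kn]; congr (`|_| / _); apply: eq_big_nat => l /andP[_ lk].
  have lk' : (l <= n)%N by apply: ltnW; exact: ltn_trans kn.
  by rewrite !nE// (leq_trans lk (ltnW kn)).
under eq_set do rewrite HE.
apply: (@measurable_discrete _ _ _ H (fun z => [set w : T | vdev (nth [::] z) n <= B])) => z.
  have [sz|sz] := eqVneq (size z) n.+1; last first.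
    rewrite (_ : mkset _ = set0)//; apply/seteqP; split=> w //= Hz.
    by rewrite -Hz size_map size_iota eqxx in sz.
  rewrite (_ : mkset _ = [set w | forall i, i \in iota 0 n.+1 -> G i w = nth [::] z i]).
    by apply: (@measurable_forall_in _ _ _ _ (fun i => [set w | G i w = nth [::] z i])) => i _; exact: (measurable_G HG).
  apply/seteqP; split=> w; rewrite /mkset.
    by move=> <- i; rewrite mem_iota => /andP[_ lin]; rewrite (nth_map 0%N) ?size_iota// nth_iota.
  move=> E; apply: (@eq_from_nth _ [::]); rewrite size_map size_iota ?sz// => i lin.
  by rewrite (nth_map 0%N) ?size_iota// nth_iota// E// mem_iota.
exact: measurable_prop.
Qed.

Lemma vdev_mono g n n' : (n <= n')%N -> vdev g n <= vdev g n'.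
Proof.
move=> nn; rewrite /vdev (big_cat_nat (leq0n n) nn)/= lerDl.
by apply: sumr_ge0 => k _; rewrite divr_ge0// sqr_ge0.
Qed.

Definition vdev_bounded := [set w | exists B : nat, forall n, vdev (G^~ w) n <= B%:R].

Lemma measurable_vdev_bounded : measurable vdev_bounded.
Proof.
apply: measurable_exists => B.
by apply: (@measurable_forall _ _ _ (fun n => [set w | vdev (G^~ w) n <= B%:R])) => n; exact: measurable_vdev.
Qed.

Lemma vdev_ae : \forall w \ae P, exists B, forall n, vdev (G^~ w) n <= B.
Proof.
apply: (@filterS _ _ _ vdev_bounded) => [w [B HB]|]; first by exists B%:R.
apply: null_of_starts => [|g0 wg0]; first exact: measurable_vdev_bounded.
have mg : measurable [set w | G 0%N w = g0] by exact: (measurable_G HG).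
set c := 2 * (4 * C ^+ 2 + 1).
have c0 : 0 < c by rewrite /c; have := sqr_ge0 C; lra.
pose D (B : nat) n := [set w | G 0%N w = g0] `\` [set w | vdev (G^~ w) n <= B.+1%:R].
have mD B n : measurable (D B n) by apply: measurableD => //; exact: measurable_vdev.
have prD B n : pr (D B n) <= c / B.+1%:R.
  have B0 : 0 < B.+1%:R :> R by [].
  have H3 := vnoise_le a0 p_gt0 p1 kappa_gt0 HG wg0 psiC n B0.
  have H2 := pr_split P mg (measurable_vdev n B.+1%:R).
  rewrite -[_ `\` _]/(D B n) in H2; rewrite -/c in H3.
  suff H : pr [set w | G 0%N w = g0] - c / B.+1%:R <=
      pr ([set w | G 0%N w = g0] `&` [set w | vdev (G^~ w) n <= B.+1%:R]).
    by move: H; rewrite H2 lerBlDr [X in X <= _]addrC lerD2l.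
  apply: le_trans H3 _; apply: (W_event a0 HG wg0 (n := n)
    (b := fun g => vnoise a0 p kappa g0 psi n g <= B.+1%:R) (measurable_vdev n B.+1%:R)).
  move=> g gg gB w aw; rewrite /mkset.
  rewrite (_ : vdev _ n = vnoise a0 p kappa g0 psi n g)//.
  by apply: eq_big_nat => k /andP[_ kn]; rewrite (dev_atom wg0 gg aw (ltnW kn)).
have prU B : pr (\bigcup_n D B n) <= c / B.+1%:R.
  have mU : measurable (\bigcup_n D B n) by exact: bigcupT_measurable.
  have /= H := @nondecreasing_cvg_mu _ _ _ P (D B) (mD B) mU.
  have nd : nondecreasing_seq (D B).
    move=> n n' nn; apply/subsetPset => w [Gw nv]; split=> //= v; apply: nv.
    by apply: le_trans v; exact: vdev_mono.
  have cv := H nd.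
  rewrite -lee_fin -prE// -(cvg_lim _ cv)//; apply: lime_le; first exact: cvgP cv.
  by apply: nearW => n /=; rewrite prE// lee_fin.
have mN : measurable ([set w | G 0%N w = g0] `\` vdev_bounded).
  by apply: measurableD => //; exact: measurable_vdev_bounded.
apply/eqP; rewrite eq_le pr_ge0 andbT; apply/ler_addgt0Pl => e e0; rewrite addr0.
pose B := Num.trunc (c / e).
apply: (@le_trans _ _ (pr (\bigcup_n D B n))).
  apply: pr_le => //; first exact: bigcupT_measurable.
  move=> w [Gw nb]; have /existsNP[n nv] : ~ forall n, vdev (G^~ w) n <= B.+1%:R.
    by move=> H; apply: nb; exists B.+1.
  by exists n.
apply: le_trans (prU B) _; rewrite ler_pdivrMr ?ltr0n// mulrC -ler_pdivrMr//.
exact/ltW/truncnS_gt.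
Qed.

End Psi.
End AlmostSure.

(** * Stochastic approximation *)

Section LinearRecursions.
Variable R : realType.
Implicit Types (a r x c bt S : nat -> R).

Lemma arch_div (A e : R) : 0 < e -> exists N, forall n, (N <= n)%N -> A / n.+1%:R <= e.
Proof.
move=> e0; have [A0|A0] := leP A 0.
  exists 0%N => n _; apply: (@le_trans _ _ 0); last exact: ltW.
  by rewrite mulr_le0_ge0// invr_ge0.
exists (Num.trunc (A / e)).+1 => n nN; rewrite ler_pdivrMr// mulrC -ler_pdivrMr//.
apply: le_trans (ltW (truncnS_gt _)) _.
by rewrite ler_nat; exact: leqW.
Qed.

Lemma slow_growth a r N : (forall n, 0 <= a n) ->
  (forall n, (N <= n)%N -> a n.+1 <= a n + r n) -> r @ \oo --> (0 : R) ->
  (fun n => a n / n.+1%:R) @ \oo --> (0 : R).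
Proof.
move=> a0 ar r0; apply/cvgrPdist_le => e e0.
have e2 : 0 < e / 2 by rewrite divr_gt0.
move/cvgrPdist_le: r0 => /(_ _ e2)[N1 _ HN1].
pose M := maxn N N1.
have aM n : (M <= n)%N -> a n <= a M + n%:R * (e / 2).
  elim: n => [|n IH]; first by rewrite leqn0 => /eqP ->; rewrite mul0r addr0.
  rewrite leq_eqVlt => /predU1P[<-|].
    by rewrite lerDl mulr_ge0// ltW.
  rewrite ltnS => Mn; apply: le_trans (ar n _) _; first by rewrite (leq_trans _ Mn)// leq_maxl.
  have := HN1 n; rewrite /= (leq_trans _ Mn) ?leq_maxr// => /(_ isT).
  rewrite sub0r normrN => rn; have := ler_norm (r n); have := IH Mn.
  rewrite -[n.+1%:R]natr1 mulrDl mul1r; lra.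
have [N2 HN2] := arch_div (a M) e2.
exists (maxn M N2) => // n /=; rewrite geq_max => /andP[Mn N2n].
rewrite sub0r normrN ger0_norm ?divr_ge0//.
apply: (@le_trans _ _ ((a M + n%:R * (e / 2)) / n.+1%:R)).
  by rewrite ler_pM2r ?invr_gt0// aM.
rewrite mulrDl [leRHS]splitr; apply: lerD; first exact: HN2.
rewrite ler_pdivrMr// mulrC ler_wpM2l ?ltW//.
by rewrite ltr_nat.
Qed.

Lemma dev_small S L B : (forall n, `|S n.+1 - S n| <= L) ->
  (forall n, \sum_(0 <= k < n) `|S k| / k.+1%:R ^+ 2 <= B) ->
  (fun n => S n / n.+1%:R) @ \oo --> (0 : R).
Proof.
move=> SL SB; pose L1 := Num.max L 1.
have L10 : 1 <= L1 by rewrite le_max lexx orbT.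
have {}SL n : `|S n.+1 - S n| <= L1 by apply: le_trans (SL n) _; rewrite le_max lexx.
have SLj n j : `|S n| - j%:R * L1 <= `|S (n + j)%N|.
  elim: j => [|j IH]; first by rewrite mul0r subr0 addn0.
  rewrite addnS -[j.+1%:R]natr1 mulrDl mul1r.
  have := SL (n + j)%N; have := lerB_dist (S (n + j)%N) (S (n + j).+1).
  rewrite distrC; move: IH; lra.
pose V n := \sum_(0 <= k < n) `|S k| / k.+1%:R ^+ 2.
have V0 k : 0 <= `|S k| / k.+1%:R ^+ 2 by rewrite divr_ge0// sqr_ge0.
have Vc : cvgn V.
  apply: nondecreasing_is_cvgn.
    by apply: nondecreasing_series => n _ _; exact: V0.
  by exists B => _ [n _ <-]; exact: SB.
apply/cvgrPdist_le => e0 e00.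
pose e := Num.min e0 1.
have e_gt0 : 0 < e by rewrite lt_min e00 ltr01.
have e1 : e <= 1 by rewrite ge_min lexx orbT.
pose d := e ^+ 2 / (32 * L1) / 4.
have d0 : 0 < d by rewrite !divr_gt0 ?exprn_gt0// mulr_gt0//; lra.
have [N1 _ HN1] := (cvgrPdist_le _ _).1 Vc d d0.
have [N2 HN2] := @arch_div (4 * L1 / e) 1 ltr01.
exists (maxn N1 N2) => // n /=; rewrite geq_max => /andP[nN1 nN2].
rewrite sub0r normrN normrM [`|_^-1|]ger0_norm ?invr_ge0//.
apply: (@le_trans _ _ e); last by rewrite ge_min lexx.
rewrite leNgt; apply/negP; rewrite ltr_pdivlMr// => big.
have nn : 4 * L1 / e <= n.+1%:R by have := HN2 n nN2; rewrite ler_pdivrMr// mul1r.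
pose j := Num.trunc (e * n.+1%:R / (2 * L1)).
have x0 : 0 <= e * n.+1%:R / (2 * L1) by rewrite divr_ge0 ?mulr_ge0//; lra.
have jle : j%:R <= e * n.+1%:R / (2 * L1) by have /andP[] := truncn_itv x0.
have jge : e * n.+1%:R / (2 * L1) < j.+1%:R by exact: truncnS_gt.
have jn : (j <= n.+1)%N.
  rewrite -(ler_nat R); apply: le_trans jle _.
  rewrite ler_pdivrMr; last lra.
  have : e * n.+1%:R <= n.+1%:R by rewrite ler_piMl.
  have : n.+1%:R <= n.+1%:R * (2 * L1) by rewrite ler_peMr//; lra.
  lra.
have j4 : e * n.+1%:R / (4 * L1) <= j%:R.
  have h : 1 <= e * n.+1%:R / (4 * L1).
    rewrite ler_pdivlMr; last lra.
    by move: nn; rewrite ler_pdivrMr//; lra.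
  have : e * n.+1%:R / (2 * L1) = 2 * (e * n.+1%:R / (4 * L1)) by field; lra.
  by move: jge; rewrite -natr1; lra.
have Vd : V (n + j)%N - V n <= 2 * d.
  have h1 := HN1 n nN1; have h2 := HN1 (n + j)%N (leq_trans nN1 (leq_addr _ _)).
  have := ler_normD (V (n + j)%N - limn V) (limn V - V n).
  rewrite addrA subrK => h3; have := ler_norm (V (n + j)%N - V n).
  by move: h1 h2 => /= h1; rewrite distrC => h2; lra.
have : j%:R * (e / (8 * n.+1%:R)) <= V (n + j)%N - V n.
  rewrite /V (big_cat_nat (leq0n n) (leq_addr j n))/= addrAC subrr add0r.
  have -> (F : nat -> R) : \sum_(n <= k < n + j) F k = \sum_(0 <= k < j) F (k + n)%N.
    by rewrite -{1}[n]add0n big_addn addKn.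
  have -> : j%:R * (e / (8 * n.+1%:R)) = \sum_(0 <= k < j) e / (8 * n.+1%:R).
    by rewrite sumr_const_nat subn0 mulr_natl.
  apply: ler_sum_nat => k /andP[_ kj].
  have Sk : e * n.+1%:R / 2 <= `|S (k + n)%N|.
    have := SLj n k; rewrite addnC.
    have : k%:R * L1 <= e * n.+1%:R / 2.
      have kj' : k%:R <= j%:R :> R by rewrite ler_nat ltnW.
      apply: (@le_trans _ _ (e * n.+1%:R / (2 * L1) * L1)).
        by rewrite ler_wpM2r//; lra.
      by rewrite le_eqVlt; apply/orP; left; apply/eqP; field; lra.
    lra.
  have kn : (k + n).+1%:R <= 2 * n.+1%:R :> R.
    have : (k + n.+1 <= n.+1 + n.+1)%N by rewrite leq_add2r (leq_trans (ltnW kj) jn).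
    by rewrite addnS addnn -mul2n -(ler_nat R) natrM.
  apply: (@le_trans _ _ (e * n.+1%:R / 2 / (2 * n.+1%:R) ^+ 2)).
    by rewrite le_eqVlt; apply/orP; left; apply/eqP; field; rewrite gt_eqF.
  apply: ler_pM; last 1 first.
  - by rewrite lef_pV2 ?posrE ?exprn_gt0 ?mulr_gt0// lerXn2r ?nnegrE ?mulr_ge0.
  - by rewrite !mulr_ge0// ltW.
  - by rewrite invr_ge0 sqr_ge0.
  - exact: Sk.
have : e * n.+1%:R / (4 * L1) * (e / (8 * n.+1%:R)) <= j%:R * (e / (8 * n.+1%:R)).
  by rewrite ler_wpM2r// divr_ge0// ?ltW// mulr_ge0.
have -> : e * n.+1%:R / (4 * L1) * (e / (8 * n.+1%:R)) = 4 * d.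
  by rewrite /d; field; rewrite gt_eqF//=; lra.
move=> h1 h2; have := le_trans h1 (le_trans h2 Vd); lra.
Qed.

Lemma linear_recursion x c bt S (c0 b0 : R) N : 0 <= c0 -> (forall n, 0 <= c n) ->
  (forall n, (N <= n)%N -> x n.+1 = x n - c n * x n / n.+1%:R + bt n + (S n.+1 - S n)) ->
  (fun n => S n / n.+1%:R) @ \oo --> (0 : R) ->
  c @ \oo --> c0 -> bt @ \oo --> b0 ->
  (fun n => x n / n.+1%:R) @ \oo --> b0 / (1 + c0).
Proof.
move=> c00 cn0 xS S0 cc bb; set l := b0 / (1 + c0).
pose e n := x n - S n - l * n.+1%:R.
pose r n := bt n - l - c n * (S n / n.+1%:R + l).
have r0 : r @ \oo --> (0 : R).
  have -> : 0 = b0 - l - c0 * (0 + l) by rewrite /l; field; lra.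
  apply: cvgB; first by apply: cvgB => //; exact: cvg_cst.
  by apply: cvgM => //; apply: cvgD => //; exact: cvg_cst.
have [N1 _ HN1] := (cvgrPdist_le _ _).1 cc 1 ltr01.
have [N2 HN2] := arch_div (c0 + 1) (@ltr01 R).
have e_small : (fun n => `|e n| / n.+1%:R) @ \oo --> (0 : R).
  apply: (@slow_growth _ (fun n => `|r n|) (maxn N (maxn N1 N2))) => //; last first.
    by rewrite -[X in _ --> X](@normr0 _ R); exact: cvg_norm.
  move=> n; rewrite !geq_max => /andP[nN /andP[nN1 nN2]].
  have eS : e n.+1 = e n * (1 - c n / n.+1%:R) + r n.
    rewrite /e /r xS// -[n.+2%:R]natr1; field; rewrite gt_eqF//.
  have cn1 : c n / n.+1%:R <= 1.
    apply: le_trans (HN2 n nN2); rewrite ler_pM2r ?invr_gt0//.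
    have := HN1 n nN1; rewrite ler_norml => /andP[]; lra.
  have c0' : 0 <= c n / n.+1%:R by rewrite divr_ge0.
  rewrite eS; apply: le_trans (ler_normD _ _) _; rewrite lerD2r normrM.
  by rewrite ler_piMr// ger0_norm ?subr_ge0// lerBlDr lerDl.
have -> : (fun n => x n / n.+1%:R) = (fun n => e n / n.+1%:R + S n / n.+1%:R + l).
  by apply/funext => n; rewrite /e; field; rewrite gt_eqF.
have e_small' : (fun n => e n / n.+1%:R) @ \oo --> (0 : R).
  apply/cvgrPdist_le => z z0; have [M _ HM] := (cvgrPdist_le _ _).1 e_small z z0.
  by exists M => // n /HM; rewrite /= !sub0r !normrN !normrM normr_id.
rewrite -[X in _ --> X]add0r; apply: cvgD; last exact: cvg_cst.
by rewrite -[X in _ --> X]add0r; apply: cvgD.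
Qed.

End LinearRecursions.

(** * Convergence of the degrees *)

Section Potential.
Variables (R : realType) (K : nat) (p : 'I_K -> R) (kappa : 'I_K -> 'I_K -> R).
Hypotheses (p_gt0 : forall a, 0 < p a) (p1 : \sum_a p a = 1).
Hypothesis kappa_gt0 : forall a b, 0 < kappa a b.
Variable eta : 'I_K -> R.
Hypothesis eta_min : Vpi_minimizer p kappa eta.
Implicit Type y : 'I_K -> R.

Let eta_gt0 a : 0 < eta a. Proof. by case: eta_min => -[]. Qed.
Let eta1 : \sum_a eta a = 1. Proof. by case: eta_min => -[]. Qed.

Lemma ln_le_sub1 (x : R) : 0 < x -> ln x <= x - 1.
Proof.
by move=> x0; have := expR_ge1Dx (ln x); rewrite lnK ?posrE//; lra.
Qed.

Lemma sqrt_le_sub_ln (x : R) : 0 < x -> (Num.sqrt x - 1) ^+ 2 <= x - 1 - ln x.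
Proof.
move=> x0; have s0 : 0 < Num.sqrt x by rewrite sqrtr_gt0.
have s2 : Num.sqrt x ^+ 2 = x by rewrite sqr_sqrtr// ltW.
have -> : ln x = 2 * ln (Num.sqrt x) by rewrite -{1}s2 lnXn// mulr_natl.
have := ln_le_sub1 s0; rewrite (_ : (_ - 1) ^+ 2 = Num.sqrt x ^+ 2 - 2 * Num.sqrt x + 1); last by ring.
by rewrite s2; lra.
Qed.

Lemma ln_le_sqrt (x : R) : 0 < x -> ln x <= 2 * (Num.sqrt x - 1).
Proof.
move=> x0; have s0 : 0 < Num.sqrt x by rewrite sqrtr_gt0.
have s2 : Num.sqrt x ^+ 2 = x by rewrite sqr_sqrtr// ltW.
have -> : ln x = 2 * ln (Num.sqrt x) by rewrite -{1}s2 lnXn// mulr_natl.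
by rewrite ler_pM2l// ln_le_sub1.
Qed.

Definition kdot y b := \sum_k y k * kappa k b.

(* The drift of the relative entropy of y with respect to eta, up to sign. *)
Definition gain y : R :=
  \sum_a p a * (eta a / y a) + \sum_b p b * (kdot eta b / kdot y b) - 2.

Definition entropy y : R := \sum_a eta a * ln (eta a / y a).

Lemma kdot_gt0 y b : (forall a, 0 < y a) -> 0 < kdot y b.
Proof.
move=> y0; rewrite /kdot (bigD1 b)//= ltr_wpDr ?mulr_gt0//.
by apply: sumr_ge0 => k _; rewrite mulr_ge0// ltW.
Qed.

Lemma gain_ge y : (forall a, 0 < y a) -> \sum_a y a = 1 ->
  \sum_a p a * (Num.sqrt (eta a / y a) - 1) ^+ 2 <= gain y.
Proof.
move=> y0 y1; have [_ /(_ y (conj y0 y1))] := eta_min.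
rewrite /Vpi lerD2l lerN2 ler_pM2l ?invr_gt0// => V.
have h1 : \sum_a p a * (Num.sqrt (eta a / y a) - 1) ^+ 2 <=
    \sum_a p a * (eta a / y a - 1 - ln (eta a / y a)).
  by apply: ler_sum => a _; rewrite ler_pM2l// sqrt_le_sub_ln// divr_gt0.
have h2 : 0 <= \sum_b p b * (kdot eta b / kdot y b - 1 - ln (kdot eta b / kdot y b)).
  apply: sumr_ge0 => b _; rewrite mulr_ge0 ?(ltW (p_gt0 b))//.
  by have := @ln_le_sub1 (kdot eta b / kdot y b); rewrite divr_gt0 ?kdot_gt0// => /(_ isT); lra.
have h3 : gain y = \sum_a p a * (eta a / y a - 1 - ln (eta a / y a)) +
    \sum_b p b * (kdot eta b / kdot y b - 1 - ln (kdot eta b / kdot y b)) +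
    (\sum_j p j * (ln (eta j) + ln (kdot eta j)) - \sum_j p j * (ln (y j) + ln (kdot y j))).
  rewrite /gain -[X in _ - X = _](_ : \sum_a p a + \sum_a p a = 2); last by rewrite p1.
  rewrite -!sumrB -!big_split/= -sumrB; apply: eq_bigr => a _.
  by rewrite !ln_div ?posrE ?kdot_gt0//; ring.
have : 0 <= \sum_j p j * (ln (eta j) + ln (kdot eta j)) - \sum_j p j * (ln (y j) + ln (kdot y j)).
  by rewrite subr_ge0.
by rewrite h3; lra.
Qed.

Let pm := \prod_a p a.

Lemma p_le1 a : p a <= 1.
Proof.
rewrite -p1 (bigD1 a)//= lerDl; apply: sumr_ge0 => b _; exact: ltW.
Qed.

Lemma pm_gt0 : 0 < pm. Proof. exact: prodr_gt0. Qed.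

Lemma pm_le a : pm <= p a.
Proof.
rewrite /pm (bigD1 a)//= ler_piMr ?(ltW (p_gt0 a))//.
by apply: prodr_ile1 => b _; rewrite ltW//= p_le1.
Qed.

Lemma gain_ge_entropy y e : (forall a, 0 < y a) -> \sum_a y a = 1 -> 0 < e ->
  e <= entropy y -> pm * (e ^+ 2 / 4) <= gain y.
Proof.
move=> y0 y1 e0 De; apply: le_trans (gain_ge y0 y1).
pose z a := Num.sqrt (eta a / y a) - 1.
have h1 : e <= 2 / e * \sum_a eta a * z a ^+ 2 + e / 2.
  have E : \sum_a eta a * (e / 2) = e / 2 by rewrite -mulr_suml eta1 mul1r.
  apply: le_trans De _; rewrite -[X in _ <= _ + X]E mulr_sumr -big_split/=.
  apply: ler_sum => a _.
  rewrite (_ : 2 / e * _ + _ = eta a * (2 / e * z a ^+ 2 + e / 2)); last by ring.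
  rewrite ler_pM2l//; apply: le_trans (ln_le_sqrt _) _; first by rewrite divr_gt0.
  rewrite -/(z a) -subr_ge0 (_ : _ - _ = (2 * z a - e) ^+ 2 / (2 * e)); last first.
    by field; rewrite gt_eqF.
  by rewrite divr_ge0 ?sqr_ge0// mulr_ge0// ltW.
have h2 : e ^+ 2 / 4 <= \sum_a eta a * z a ^+ 2.
  have h : e / 2 <= 2 / e * \sum_a eta a * z a ^+ 2 by lra.
  have := ler_wpM2l (ltW (divr_gt0 e0 (@ltr0n R 2))) h.
  rewrite (_ : e / 2 * (2 / e * _) = \sum_a eta a * z a ^+ 2); last by field; rewrite gt_eqF.
  by rewrite (_ : e / 2 * (e / 2) = e ^+ 2 / 4)//; field.
apply: (@le_trans _ _ (pm * \sum_a eta a * z a ^+ 2)); first by rewrite ler_pM2l// pm_gt0.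
rewrite mulr_sumr; apply: ler_sum => a _; rewrite mulrA ler_wpM2r ?sqr_ge0//.
apply: le_trans (pm_le a); rewrite ler_piMr ?(ltW pm_gt0)//.
by rewrite -eta1 (bigD1 a)//= lerDl; apply: sumr_ge0 => b _; exact: ltW.
Qed.

Lemma entropy_ge y : (forall a, 0 < y a) -> \sum_a y a = 1 ->
  \sum_a eta a * (Num.sqrt (y a / eta a) - 1) ^+ 2 <= entropy y.
Proof.
move=> y0 y1; have -> : entropy y = \sum_a eta a * (y a / eta a - 1 - ln (y a / eta a)).
  have -> : \sum_a eta a * (y a / eta a - 1 - ln (y a / eta a)) =
      (\sum_a y a - \sum_a eta a) - \sum_a eta a * ln (y a / eta a).
    rewrite -!sumrB; apply: eq_bigr => a _; field; exact: lt0r_neq0.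
  rewrite y1 eta1 subrr sub0r -sumrN; apply: eq_bigr => a _.
  by rewrite !ln_div ?posrE//; ring.
by apply: ler_sum => a _; rewrite ler_pM2l// sqrt_le_sub_ln// divr_gt0.
Qed.

Lemma entropy_close a e : 0 < e -> exists2 f, 0 < f &
  forall y, (forall a, 0 < y a) -> \sum_a y a = 1 -> entropy y <= f -> `|eta a - y a| <= e.
Proof.
move=> e0; pose dd := Num.min 1 (e / (3 * eta a)).
have ea := eta_gt0 a.
have dd0 : 0 < dd by rewrite lt_min ltr01 divr_gt0// mulr_gt0.
exists (eta a * dd ^+ 2) => [|y y0 y1 D]; first by rewrite mulr_gt0// exprn_gt0.
set z := Num.sqrt (y a / eta a).
have z0 : 0 <= z by exact: sqrtr_ge0.
have z2 : y a = eta a * z ^+ 2.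
  rewrite /z sqr_sqrtr ?divr_ge0 ?(ltW (y0 a)) ?(ltW ea)//; field; exact: lt0r_neq0.
have : (z - 1) ^+ 2 <= dd ^+ 2.
  rewrite -(ler_pM2l ea); apply: le_trans D; apply: le_trans (entropy_ge y0 y1).
  rewrite [leRHS](bigD1 a)//= lerDl; apply: sumr_ge0 => b _.
  by rewrite mulr_ge0 ?sqr_ge0// ltW.
have d1 : dd <= 1 by rewrite ge_min lexx.
have d2 : 3 * eta a * dd <= e.
  by rewrite -ler_pdivlMl ?mulr_gt0// mulrC ge_min lexx orbT.
rewrite -[leLHS](real_normK (num_real _)) => h.
have {}h : `|z - 1| <= dd.
  by rewrite -(@ler_pXn2r _ 2)// nnegrE ?normr_ge0// ltW.
rewrite z2 (_ : _ - _ = - (eta a * ((z - 1) * (z - 1 + 2)))); last by ring.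
rewrite normrN normrM (gtr0_norm ea); apply: le_trans d2.
rewrite -mulrA mulrCA ler_pM2l// normrM mulrC.
apply: ler_pM => //; apply: le_trans (ler_normD _ _) _.
by rewrite (ger0_norm (ler0n _ 2)); lra.
Qed.

End Potential.

Lemma eventually_ord (K : nat) (Q : nat -> 'I_K -> Prop) :
  (forall a, exists N, forall n, (N <= n)%N -> Q n a) ->
  exists N, forall n, (N <= n)%N -> forall a, Q n a.
Proof.
move=> /choice[N HN]; exists (\max_a N a)%N => n Nn a; apply: HN.
by apply: leq_trans Nn; exact: leq_bigmax.
Qed.

Lemma cvg_sum_seq (R : realType) (I : Type) (r : seq I) (f : I -> nat -> R) (l : I -> R) :
  (forall i, f i @ \oo --> l i) ->
  (fun n => \sum_(i <- r) f i n) @ \oo --> \sum_(i <- r) l i.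
Proof.
move=> fl; elim: r => [|i r IH].
  by rewrite big_nil; under eq_fun do rewrite big_nil; exact: cvg_cst.
by rewrite big_cons; under eq_fun do rewrite big_cons; apply: cvgD.
Qed.

Section DegreeConvergence.
Variables (R : realType) (K : nat) (p : 'I_K -> R) (kappa : 'I_K -> 'I_K -> R).
Hypotheses (p_gt0 : forall a, 0 < p a) (p1 : \sum_a p a = 1).
Hypothesis kappa_gt0 : forall a b, 0 < kappa a b.
Variable eta : 'I_K -> R.
Hypothesis eta_min : Vpi_minimizer p kappa eta.
Variables (X S : nat -> 'I_K -> R) (T0 : R).

Let Z n b := \sum_a kappa a b * X n a.
Let dr n a := p a + \sum_b p b * (kappa a b * X n a / Z n b).
Let T n : R := T0 + 2 * n%:R.

Hypothesis T0_gt0 : 0 < T0.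
Hypothesis X_ge0 : forall n a, 0 <= X n a.
Hypothesis X_total : forall n, \sum_a X n a = T n.
Hypothesis XS : forall n a, X n.+1 a = X n a + dr n a + (S n.+1 a - S n a).
Hypothesis X_mono : forall n a, X n a <= X n.+1 a.
Hypothesis X_incr : forall n a, X n.+1 a <= X n a + 2.
Hypothesis S_bound : forall a, exists B, forall n,
  \sum_(0 <= k < n) `|S k a| / k.+1%:R ^+ 2 <= B.

Let eta_gt0 a : 0 < eta a. Proof. by case: eta_min => -[]. Qed.
Let eta1 : \sum_a eta a = 1. Proof. by case: eta_min => -[]. Qed.

Lemma T_gt0 n : 0 < T n. Proof. by rewrite ltr_pwDl// mulr_ge0. Qed.

Lemma Z_ge0 n b : 0 <= Z n b.
Proof. by apply: sumr_ge0 => a _; rewrite mulr_ge0// ltW. Qed.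

Lemma dr_ge n a : p a <= dr n a.
Proof.
rewrite lerDl; apply: sumr_ge0 => b _; rewrite mulr_ge0 ?(ltW (p_gt0 b))//.
by rewrite divr_ge0 ?Z_ge0// mulr_ge0// ltW.
Qed.

Lemma dr_le n a : dr n a <= 2.
Proof.
apply: (@le_trans _ _ (1 + \sum_b p b)); last by rewrite p1; lra.
rewrite lerD//; first exact: p_le1.
apply: ler_sum => b _; rewrite ler_piMr ?(ltW (p_gt0 b))//.
have [Z0|Z0] := eqVneq (Z n b) 0; first by rewrite Z0 invr0 mulr0.
rewrite ler_pdivrMr ?lt0r ?Z0 ?Z_ge0// mul1r /Z (bigD1 a)//= lerDl.
by apply: sumr_ge0 => c _; rewrite mulr_ge0// ltW.
Qed.

Lemma S_incr n a : `|S n.+1 a - S n a| <= 4.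
Proof.
have := XS n a; have := X_mono n a; have := X_incr n a; have := dr_le n a.
have := le_trans (ltW (p_gt0 a)) (dr_ge n a).
by move=> *; rewrite ler_norml; apply/andP; split; lra.
Qed.

Lemma S_small a : (fun n => S n a / n.+1%:R) @ \oo --> (0 : R).
Proof. by have [B HB] := S_bound a; apply: dev_small HB => n; exact: S_incr. Qed.

Lemma S_small_abs a e : 0 < e -> exists N, forall n, (N <= n)%N -> `|S n a| <= e * n.+1%:R.
Proof.
move=> e0; have [N _ HN] := (cvgrPdist_le _ _).1 (S_small a) e e0.
exists N => n /HN; rewrite /= sub0r normrN normrM [`|_^-1|]ger0_norm ?invr_ge0//.
by rewrite ler_pdivrMr.
Qed.

Let pm := \prod_a p a.
Let pm0 : 0 < pm. Proof. exact: pm_gt0. Qed.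
Let c := pm / 2.
Let c0 : 0 < c. Proof. exact: divr_gt0. Qed.

Lemma X_lower : exists N, forall n, (N <= n)%N -> forall a,
  c * n.+1%:R <= X n a /\ `|S n a| <= c * n.+1%:R.
Proof.
apply: eventually_ord => a.
have XL n : X 0%N a - S 0%N a + p a * n%:R <= X n a - S n a.
  elim: n => [|n IH]; first by rewrite mulr0 addr0.
  rewrite -natr1 mulrDr mulr1; have := XS n a; have := dr_ge n a; lra.
have pa : pm <= p a := pm_le p_gt0 p1 a.
have pa4 : 0 < pm / 4 by rewrite divr_gt0.
have [N1 H1] := S_small_abs a pa4.
have [N2 H2] := arch_div (p a + `|S 0%N a|) pa4.
exists (maxn N1 N2) => n; rewrite geq_max => /andP[/H1 s1 /H2].
rewrite ler_pdivrMr// => s2; split.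
  have := XL n; have := X_ge0 0 a; have := ler_norm (S 0%N a).
  move: s1; rewrite ler_norml => /andP[s1 _]; rewrite /c.
  have : p a * n.+1%:R = p a * n%:R + p a by rewrite -natr1 mulrDr mulr1.
  have : pm * n.+1%:R <= p a * n.+1%:R by rewrite ler_wpM2r.
  move: s1 s2; move: (n.+1%:R) => y; move: (n%:R) => x; lra.
apply: le_trans s1 _; rewrite ler_wpM2r// /c; lra.
Qed.

Lemma ln_increment (x dx : R) : 0 < x -> 0 <= dx -> dx / x - (dx / x) ^+ 2 <= ln (x + dx) - ln x.
Proof.
move=> x0 dx0; set t := dx / x.
have t0 : 0 <= t by rewrite divr_ge0// ltW.
have -> : x + dx = x * (1 + t) by rewrite /t; field; rewrite gt_eqF.
have t1 : 0 < 1 + t by lra.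
rewrite lnM ?posrE// addrAC subrr add0r.
have := @ln_le_sub1 R (1 + t)^-1; rewrite invr_gt0 t1 => /(_ isT).
rewrite lnV ?posrE// => h.
suff : t - t ^+ 2 <= 1 - (1 + t)^-1 by lra.
rewrite -subr_ge0 (_ : _ - _ = t ^+ 3 / (1 + t)); last by field; lra.
by rewrite divr_ge0 ?exprn_ge0//; lra.
Qed.

Let y n a := X n a / T n.
Let c1 := 8 / c ^+ 2.
Let c10 : 0 <= c1. Proof. by rewrite divr_ge0// sqr_ge0. Qed.
Let del n := \sum_a eta a * (c1 * (`|S n.+1 a| / n.+2%:R ^+ 2 + 1 / n.+1%:R ^+ 2)).
Let U n := \sum_a eta a * ln (X n a) - ln (T n).
Let V n := \sum_a eta a * (S n a / X n a).

Lemma del_ge0 n : 0 <= del n.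
Proof.
apply: sumr_ge0 => a _; rewrite mulr_ge0 ?(ltW (eta_gt0 a))// mulr_ge0//.
Qed.

Lemma sum_inv_sq n : \sum_(0 <= k < n) 1 / k.+1%:R ^+ 2 <= 2 :> R.
Proof.
suff : \sum_(0 <= k < n.+1) 1 / k.+1%:R ^+ 2 <= 2 - n.+1%:R^-1 :> R.
  rewrite big_nat_recr//= => H; apply: (@le_trans _ _ (2 - n.+1%:R^-1)).
    by apply: le_trans H; rewrite lerDl divr_ge0// sqr_ge0.
  by rewrite lerBlDr lerDl invr_ge0.
elim: n => [|n IH]; first by rewrite big_nat1 expr1n divr1 invr1; lra.
rewrite big_nat_recr//=; apply: le_trans (lerD IH (lexx _)) _.
rewrite -addrA lerD2l -(natr1 n.+1); set z : R := n.+1%:R.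
have z0 : 0 < z by rewrite ltr0n.
rewrite -subr_ge0 (_ : _ - _ = (z * (z + 1) ^+ 2)^-1); last first.
  by field; rewrite !gt_eqF//; lra.
by rewrite invr_ge0 mulr_ge0 ?sqr_ge0// ltW.
Qed.

Lemma del_bound : exists B, forall n, \sum_(0 <= k < n) del k <= B.
Proof.
have [B HB] := choice S_bound.
exists (\sum_a eta a * (c1 * (B a + 2))) => n.
rewrite exchange_big; apply: ler_sum => a _; rewrite -mulr_sumr ler_pM2l//.
rewrite -mulr_sumr ler_wpM2l// big_split/=; apply: lerD; last exact: sum_inv_sq.
apply: le_trans (HB a n.+1); rewrite big_nat_recl//= lerDr.
by rewrite divr_ge0// sqr_ge0.
Qed.

Lemma lyapunov_step n : (forall a, c * n.+1%:R <= X n a) ->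
  gain p kappa eta (y n) / T n <= (U n.+1 - V n.+1 + del n) - (U n - V n).
Proof.
move=> XL; have x0 : 0 < n.+1%:R :> R by [].
have X0 a : 0 < X n a by apply: lt_le_trans (XL a); rewrite mulr_gt0.
have X0' a : 0 < X n.+1 a by apply: lt_le_trans (X_mono n a).
have Z0 b : 0 < Z n b.
  rewrite /Z (bigD1 b)//= ltr_wpDr ?mulr_gt0//.
  by apply: sumr_ge0 => k _; rewrite mulr_ge0// ltW.
have Tn := T_gt0 n; have Tn' := T_gt0 n.+1.
have kE b : kdot kappa (y n) b = Z n b / T n.
  rewrite /kdot /Z mulr_suml; apply: eq_bigr => a _; rewrite /y; field; exact: lt0r_neq0.
have lnT : ln (T n.+1) - ln (T n) <= 2 / T n.
  have -> : T n.+1 = T n * (1 + 2 / T n).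
    by rewrite /T -natr1; field; apply/lt0r_neq0/T_gt0.
  have h : 0 < 1 + 2 / T n by rewrite ltr_wpDr// divr_ge0// ltW.
  rewrite lnM ?posrE// addrAC subrr add0r; have := ln_le_sub1 h; lra.
have gE : gain p kappa eta (y n) / T n = \sum_a eta a * (dr n a / X n a) - 2 / T n.
  rewrite /gain mulrBl; congr (_ - _).
  have -> : \sum_a eta a * (dr n a / X n a) =
      \sum_a p a * (eta a / X n a) + \sum_a \sum_b p b * (eta a * kappa a b / Z n b).
    rewrite -big_split/=; apply: eq_bigr => a _; rewrite /dr mulrDl mulrDr; congr (_ + _).
      by field; exact: lt0r_neq0.
    rewrite mulr_suml mulr_sumr; apply: eq_bigr => b _; field.
    by rewrite !lt0r_neq0.
  rewrite mulrDl; congr (_ + _).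
    rewrite mulr_suml; apply: eq_bigr => a _; rewrite /y; field.
    by rewrite !lt0r_neq0.
  rewrite exchange_big mulr_suml; apply: eq_bigr => b _; rewrite kE -mulr_sumr -mulr_suml -/(kdot kappa eta b).
  by field; rewrite !lt0r_neq0.
have step a : eta a * (dr n a / X n a) + eta a * (S n.+1 a / X n.+1 a) - eta a * (S n a / X n a)
    - eta a * (c1 * (`|S n.+1 a| / n.+2%:R ^+ 2 + 1 / n.+1%:R ^+ 2)) <=
    eta a * ln (X n.+1 a) - eta a * ln (X n a).
  rewrite -!mulrBr -mulrDr -!mulrBr ler_pM2l//.
  pose dx := X n.+1 a - X n a.
  have dx0 : 0 <= dx by rewrite subr_ge0.
  have dx2 : dx <= 2 by rewrite lerBlDr addrC.
  have := ln_increment (X0 a) dx0.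
  have -> : X n a + dx = X n.+1 a by rewrite /dx addrC subrK.
  apply: le_trans.
  have e1 : dx / X n a = dr n a / X n a + (S n.+1 a / X n.+1 a - S n a / X n a) +
      S n.+1 a * (dx / (X n a * X n.+1 a)).
    rewrite /dx; have -> : S n a = X n a + dr n a + S n.+1 a - X n.+1 a by rewrite XS; ring.
    by field; rewrite !lt0r_neq0.
  have cx : 0 < c * n.+1%:R by rewrite mulr_gt0.
  have e2 : (dx / X n a) ^+ 2 <= c1 * (1 / n.+1%:R ^+ 2).
    apply: (@le_trans _ _ ((2 / (c * n.+1%:R)) ^+ 2)); last first.
      rewrite (_ : c1 * _ = (2 / (c * n.+1%:R)) ^+ 2 * 2); last first.
        by rewrite /c1; field; rewrite !lt0r_neq0.
      by rewrite ler_peMr ?sqr_ge0// ler1n.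
    rewrite lerXn2r ?nnegrE ?divr_ge0//; [|exact: ltW..|].
      exact: ltW.
    by rewrite ler_pM ?invr_ge0 ?(ltW (X0 a))// lef_pV2 ?posrE.
  have e3 : - (c1 * (`|S n.+1 a| / n.+2%:R ^+ 2)) <= S n.+1 a * (dx / (X n a * X n.+1 a)).
    have h : dx / (X n a * X n.+1 a) <= c1 / n.+2%:R ^+ 2.
      apply: (@le_trans _ _ (2 / (c * n.+1%:R) ^+ 2)).
        rewrite ler_pM ?invr_ge0 ?mulr_ge0// lef_pV2 ?posrE ?mulr_gt0 ?exprn_gt0//.
        rewrite expr2 ler_pM ?(ltW cx)//; exact: le_trans (XL a) (X_mono n a).
      rewrite (_ : 2 / (c * n.+1%:R) ^+ 2 = c1 * (2 * n.+1%:R) ^- 2); last first.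
        by rewrite /c1; field; rewrite !lt0r_neq0.
      rewrite ler_wpM2l// lef_pV2 ?posrE ?exprn_gt0 ?mulr_gt0//.
      rewrite lerXn2r ?nnegrE ?mulr_ge0// -(natr1 n.+1).
      have : 1 <= n.+1%:R :> R by rewrite ler1n.
      by move: (n.+1%:R : R) => x; lra.
    have h0 : 0 <= dx / (X n a * X n.+1 a) by rewrite divr_ge0 ?mulr_ge0.
    rewrite lerNl -mulNr; apply: (@le_trans _ _ (`|S n.+1 a| * (dx / (X n a * X n.+1 a)))).
      by rewrite ler_wpM2r// -normrN ler_norm.
    by rewrite [leRHS]mulrCA ler_wpM2l.
  rewrite e1 mulrDr; move: e2 e3; rewrite e1; move: (c1 * _) (c1 * _) => u v; lra.
rewrite gE /U /V /del.
have := ler_sum (index_enum 'I_K) (P := xpredT) (fun a _ => step a).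
rewrite !sumrB big_split/=; lra.
Qed.

Let Phi n := U n - V n + \sum_(0 <= k < n) del k.

Lemma y_pos n : (forall a, c * n.+1%:R <= X n a) ->
  (forall a, 0 < y n a) /\ \sum_a y n a = 1.
Proof.
move=> XL; split=> [a|].
  by rewrite divr_gt0 ?T_gt0//; apply: lt_le_trans (XL a); rewrite mulr_gt0.
by rewrite -mulr_suml X_total divff// gt_eqF// T_gt0.
Qed.

Lemma entropyE n : (forall a, c * n.+1%:R <= X n a) ->
  entropy eta (y n) = \sum_a eta a * ln (eta a) - U n.
Proof.
move=> XL; rewrite /U opprB addrCA -sumrB.
have -> : ln (T n) = \sum_a eta a * ln (T n) by rewrite -mulr_suml eta1 mul1r.
rewrite -big_split/=; apply: eq_bigr => a _.
have X0 : 0 < X n a by apply: lt_le_trans (XL a); rewrite mulr_gt0.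
have Tn := T_gt0 n.
by rewrite /y !ln_div ?posrE ?divr_gt0//; ring.
Qed.

Lemma Phi_step n : (forall a, c * n.+1%:R <= X n a) ->
  Phi n + gain p kappa eta (y n) / T n <= Phi n.+1.
Proof.
move=> XL; have := lyapunov_step XL; rewrite /Phi big_nat_recr//=.
by move: (gain _ _ _ _ / _) => w; lra.
Qed.

Lemma entropy_small f : 0 < f -> exists N, forall n, (N <= n)%N -> entropy eta (y n) <= f.
Proof.
move=> f0; have [N0 H0] := X_lower.
have f8 : 0 < c * (f / 8) by rewrite mulr_gt0// divr_gt0.
have [N1 H1] := eventually_ord (fun a => S_small_abs a f8).
have [B HB] := del_bound.
have dc : cvgn (series del).
  apply: nondecreasing_is_cvgn.
    by apply: nondecreasing_series => n _ _; exact: del_ge0.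
  by exists B => _ [n _ <-]; exact: HB.
have f8' : 0 < f / 8 by rewrite divr_gt0.
have [N2 _ H2] := (cvgrPdist_le _ _).1 dc (f / 8) f8'.
pose M := maxn N0 (maxn N1 N2).
have MN0 n : (M <= n)%N -> forall a, c * n.+1%:R <= X n a.
  by rewrite !geq_max => /andP[/H0 h _] a; have [] := h a.
have VM n : (M <= n)%N -> `|V n| <= f / 8.
  rewrite !geq_max => /and3P[n0 n1 _].
  apply: le_trans (ler_norm_sum _ _ _) _.
  have -> : f / 8 = \sum_a eta a * (f / 8) by rewrite -mulr_suml eta1 mul1r.
  apply: ler_sum => a _; rewrite normrM (gtr0_norm (eta_gt0 a)) ler_pM2l//.
  have Xa := (H0 n n0 a).1; have X0 : 0 < X n a by apply: lt_le_trans Xa; rewrite mulr_gt0.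
  rewrite normrM normfV (gtr0_norm X0) ler_pdivrMr//; apply: le_trans (H1 n n1 a) _.
  by rewrite [c * _]mulrC -mulrA ler_pM2l.
have delM m n : (M <= m)%N -> (m <= n)%N -> \sum_(m <= k < n) del k <= f / 4.
  rewrite !geq_max => /and3P[_ _ m2] mn.
  have h1 := H2 m m2; have h2 := H2 n (leq_trans m2 mn).
  have : series del n - series del m = \sum_(m <= k < n) del k.
    by rewrite /series/= (big_cat_nat (leq0n m) mn)/= addrAC subrr add0r.
  move: h1 h2; rewrite /= !ler_norml; move: (limn _) (series del n) (series del m) => L x z.
  by move=> /andP[? ?] /andP[? ?]; lra.
have gain0 n : (M <= n)%N -> 0 <= gain p kappa eta (y n).
  move=> Mn; have [y0 y1] := y_pos (MN0 n Mn).
  apply: le_trans (gain_ge p_gt0 p1 kappa_gt0 eta_min y0 y1).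
  by apply: sumr_ge0 => a _; rewrite mulr_ge0 ?sqr_ge0// ltW.
have U0 n : (M <= n)%N -> U n <= 0.
  move=> Mn; rewrite subr_le0.
  have -> : ln (T n) = \sum_a eta a * ln (T n) by rewrite -mulr_suml eta1 mul1r.
  apply: ler_sum => a _; rewrite ler_pM2l// ler_ln ?posrE ?T_gt0//.
    by rewrite -X_total (bigD1 a)//= lerDl; apply: sumr_ge0 => b _.
  by apply: lt_le_trans (MN0 n Mn a); rewrite mulr_gt0.
have [m Mm Dm] : exists2 m, (M <= m)%N & entropy eta (y m) <= f / 2.
  apply: contrapT => no.
  have f2 : 0 < f / 2 by rewrite divr_gt0.
  pose gam := pm * ((f / 2) ^+ 2 / 4).
  have gam0 : 0 < gam by rewrite mulr_gt0 ?divr_gt0 ?exprn_gt0.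
  have gg n : (M <= n)%N -> gam <= gain p kappa eta (y n).
    move=> Mn; have [y0 y1] := y_pos (MN0 n Mn).
    apply: (gain_ge_entropy p_gt0 p1 kappa_gt0 eta_min y0 y1 f2).
    by rewrite leNgt; apply/negP => lt; apply: no; exists n => //; exact: ltW.
  pose AA := T0 + 2 * M%:R + 2.
  have AA0 : 0 < AA by have := T_gt0 M; rewrite /AA -/(T M); lra.
  have PhiM j : Phi M + gam / AA * \sum_(0 <= i < j) i.+1%:R^-1 <= Phi (M + j)%N.
    elim: j => [|j IH]; first by rewrite big_nil mulr0 addr0 addn0.
    rewrite big_nat_recr//= mulrDr addrA addnS.
    have Mj : (M <= M + j)%N by rewrite leq_addr.
    apply: le_trans (Phi_step (MN0 _ Mj)); apply: lerD => //.
    have TA : T (M + j)%N <= AA * j.+1%:R.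
      rewrite /T /AA natrD -[j.+1%:R]natr1; have : 0 <= j%:R :> R by [].
      have : 0 <= T0 * j%:R by rewrite mulr_ge0// ltW.
      have : 0 <= M%:R * j%:R :> R by rewrite mulr_ge0.
      by move: (j%:R : R) (M%:R : R) => w z; nra.
    rewrite -mulrA -invfM; apply: ler_pM (gg _ Mj) _ => //.
    - exact: ltW.
    - by rewrite invr_ge0 mulr_ge0// ltW.
    - by rewrite lef_pV2 ?posrE ?mulr_gt0// T_gt0.
  have gA : 0 < gam / AA by rewrite divr_gt0.
  have [j Hj] := harmonic_unbounded ((f / 8 + B - Phi M + 1) / (gam / AA)).
  have := PhiM j; apply/negP; rewrite -ltNge.
  have Mj : (M <= M + j)%N by rewrite leq_addr.
  have up : Phi (M + j)%N <= f / 8 + B.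
    have := U0 _ Mj; have := HB (M + j)%N; have := VM _ Mj; rewrite ler_norml => /andP[] v _.
    by rewrite /Phi; lra.
  apply: le_lt_trans up _; move: Hj; rewrite ler_pdivrMr//.
  rewrite [X in _ <= X]mulrC; move: (gam / AA * _) => w; lra.
exists m => n mn.
have Mn := leq_trans Mm mn.
have PhiN : Phi m <= Phi n.
  elim: n mn {Mn} => [|n IH]; first by rewrite leqn0 => /eqP ->.
  rewrite leq_eqVlt => /predU1P[->//|]; rewrite ltnS => mn.
  apply: le_trans (IH mn) _; apply: le_trans (Phi_step (MN0 n (leq_trans Mm mn))).
  by rewrite lerDl divr_ge0 ?gain0 ?(ltW (T_gt0 _))// (leq_trans Mm mn).
rewrite (entropyE (MN0 n Mn)); move: Dm; rewrite (entropyE (MN0 m Mm)).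
have := VM n Mn; have := VM m Mm; rewrite !ler_norml => /andP[v1 v2] /andP[v3 v4].
have := delM m n Mm mn; move: PhiN; rewrite /Phi (big_cat_nat (leq0n m) mn)/=.
by move: (\sum_a _) (\sum_(0 <= k < m) _) (\sum_(m <= k < n) _) => w1 w2 w3; lra.
Qed.

Lemma y_cvg a : y^~ a @ \oo --> eta a.
Proof.
apply/cvgrPdist_le => e e0; have [f f0 Hf] := entropy_close eta_min a e0.
have [N0 H0] := X_lower; have [N1 H1] := entropy_small f0.
exists (maxn N0 N1) => // n /=; rewrite geq_max => /andP[n0 n1].
have [y0 y1] := y_pos (fun a => (H0 n n0 a).1).
by apply: Hf => //; exact: H1.
Qed.

Lemma T_cvg : (fun n => T n / n.+1%:R) @ \oo --> (2 : R).
Proof.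
have -> : (fun n => T n / n.+1%:R) = (fun n => 2 + (T0 - 2) * harmonic n).
  apply/funext => n; rewrite /T /harmonic/= -[n.+1%:R]natr1; field.
  by rewrite natr1 gt_eqF.
rewrite -[X in _ --> X]addr0; apply: cvgD; first exact: cvg_cst.
by rewrite -(mulr0 (T0 - 2)); apply: cvgMl_tmp; exact: cvg_harmonic.
Qed.

Lemma degree_cvg a : (fun n => X n a / n.+1%:R) @ \oo --> 2 * eta a.
Proof.
have -> : (fun n => X n a / n.+1%:R) = (fun n => T n / n.+1%:R * y n a).
  by apply/funext => n; rewrite /y; field; rewrite ?lt0r_neq0 ?T_gt0.
by apply: cvgM; [exact: T_cvg|exact: y_cvg].
Qed.

Lemma Z_cvg b : (fun n => Z n b / n.+1%:R) @ \oo --> 2 * kdot kappa eta b.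
Proof.
have -> : (fun n => Z n b / n.+1%:R) = (fun n => \sum_a kappa a b * (X n a / n.+1%:R)).
  by apply/funext => n; rewrite mulr_suml; apply: eq_bigr => a _; rewrite mulrA.
have -> : 2 * kdot kappa eta b = \sum_a kappa a b * (2 * eta a).
  by rewrite mulr_sumr; apply: eq_bigr => a _; ring.
apply: cvg_sum_seq => a; by apply: cvgMl_tmp; exact: degree_cvg.
Qed.

Lemma rate_cvg a b :
  (fun n => p b * kappa a b / (Z n b / n.+1%:R)) @ \oo --> phi p kappa eta a b / 2.
Proof.
have k0 : 0 < kdot kappa eta b by exact: kdot_gt0.
have -> : phi p kappa eta a b / 2 = p b * kappa a b / (2 * kdot kappa eta b).
  rewrite /phi /nu; have -> : \sum_l kappa l b * eta l = kdot kappa eta b.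
    by apply: eq_bigr => l _; rewrite mulrC.
  by field; exact: lt0r_neq0.
apply: cvgMl_tmp; apply: cvgV; last exact: Z_cvg.
by rewrite gt_eqF// mulr_gt0.
Qed.

Lemma first_order a : \sum_b phi p kappa eta a b = 2 - p a / eta a.
Proof.
have drc : dr^~ a @ \oo --> p a + \sum_b phi p kappa eta a b / 2 * (2 * eta a).
  apply: cvgD; first exact: cvg_cst.
  have -> : (fun n => \sum_b p b * (kappa a b * X n a / Z n b)) =
      (fun n => \sum_b p b * kappa a b / (Z n b / n.+1%:R) * (X n a / n.+1%:R)).
    apply/funext => n; apply: eq_bigr => b _.
    have [Z0|Z0] := eqVneq (Z n b) 0; first by rewrite Z0 mul0r !invr0 !mulr0 mul0r.
    by field; rewrite Z0 gt_eqF.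
  apply: cvg_sum_seq => b; by apply: cvgM; [exact: rate_cvg|exact: degree_cvg].
have rec n : (0 <= n)%N -> X n.+1 a = X n a - 0 * X n a / n.+1%:R + dr n a + (S n.+1 a - S n a).
  by rewrite !mul0r subr0 XS.
have H := linear_recursion (c := fun=> 0) (x := X^~ a) (lexx 0) (fun=> lexx _) rec (S_small a) (cvg_cst _) drc.
have E := cvg_lim (@norm_hausdorff _ _) (@degree_cvg a).
rewrite (cvg_lim (@norm_hausdorff _ _) (H _)) addr0 divr1 in E.
rewrite -mulr_suml -mulr_suml in E.
have ea := eta_gt0 a; apply: (mulfI (lt0r_neq0 ea)).
rewrite mulrBr [eta a * (_ / _)]mulrCA divff ?lt0r_neq0// mulr1.
have {}E := E _; move: E; move: (\sum_b phi p kappa eta a b) => w E.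
have E2 : p a + eta a * w = 2 * eta a by rewrite -E; field.
by rewrite [eta a * 2]mulrC -E2 addrAC subrr add0r.
Qed.

End DegreeConvergence.

(** * Convergence of the frequencies of histories *)

Section Path.
Variables (R : realType) (K : nat) (a0 : 'I_K).
Variables (p : 'I_K -> R) (kappa : 'I_K -> 'I_K -> R).
Hypotheses (p_gt0 : forall a, 0 < p a) (p1 : \sum_a p a = 1).
Hypothesis kappa_gt0 : forall a b, 0 < kappa a b.
Implicit Types (g h : rtree K).
Local Notation ty := (ty a0).
Local Notation par := (par a0).
Local Notation drift := (mean_incr a0 p kappa).
Local Notation Zm := (Zmass a0 kappa).
Local Notation Xm := (@Xmass K a0 R).
Local Notation q := (attach_q a0 kappa).

Definition psi_deg a g b v : R := (ty g v == a)%:R + (b == a)%:R.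
Definition psi_cnt h g b v : R := (cnt h (rcons g (b, v)))%:R - (cnt h g)%:R.

Lemma psi_deg_le a g b v : `|psi_deg a g b v| <= 2.
Proof.
rewrite /psi_deg ger0_norm ?addr_ge0//.
by case: (_ == a); case: (_ == a); rewrite /=; lra.
Qed.

Lemma cnt_rconsE h g b v : psi_cnt h g b v =
  ([:: (b, 0%N)] == h)%:R +
  (\sum_(0 <= u < size g)
    ((rcons (hist u g) (b, index v (dsc u g)) == h) && (v \in dsc u g)))%:R -
  (\sum_(0 <= u < size g) ((hist u g == h) && (v \in dsc u g)))%:R.
Proof.
have /(congr1 (fun n => n%:R : R)) := cnt_rcons h g (b, v).
rewrite /psi_cnt !natrD /= => E; lra.
Qed.

Lemma psi_cnt_le h g b v : `|psi_cnt h g b v| <= 2.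
Proof.
rewrite cnt_rconsE.
have H1 : (\sum_(0 <= u < size g) ((hist u g == h) && (v \in dsc u g)) <= 1)%N.
  by apply: (@sum_dsc_le1 _ (size h)) => u /eqP <-; rewrite size_hist.
have H2 : (\sum_(0 <= u < size g)
    ((rcons (hist u g) (b, index v (dsc u g)) == h) && (v \in dsc u g)) <= 1)%N.
  apply: leq_trans (@sum_dsc_le1 _ (size h).-1 v g (fun u => size (dsc u g) == (size h).-1) _).
    apply: leq_sum => u _; case: eqP => [<-|//]; by rewrite size_rcons size_hist eqxx.
  by move=> u /eqP.
move: H1 H2; case: (\sum_(_ <= _ < _) _)%N => [|[|//]] _; case: (\sum_(_ <= _ < _) _)%N => [|[|//]] _;
  by case: eqP => _ /=; rewrite ler_norml; apply/andP; split; lra.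
Qed.

Section Drift.
Variables (s : bool) (g : rtree K).
Hypotheses (wg : wf g) (sg : (size g == 1%N) ==> s).

Lemma drift_deg a : drift (psi_deg a) s g =
  p a + \sum_b p b * (kappa a b * Xm s g a / Zm s g b).
Proof.
have E b : \sum_(0 <= v < size g) p b * q s g b v * psi_deg a g b v =
    p b * (kappa a b * Xm s g a / Zm s g b) + p b * (b == a)%:R.
  rewrite -(sum_q_type a0 kappa s b a wg) -[p b * (b == a)%:R]mulr1.
  rewrite -[X in _ + _ * X](sum_q a0 kappa_gt0 b wg sg) !mulr_sumr -big_split; apply: eq_bigr => v _.
  by rewrite /psi_deg /=; ring.
rewrite /mean_incr (eq_bigr _ (fun b _ => E b)) big_split/= addrC; congr (_ + _).
rewrite (bigD1 a)//= eqxx mulr1 big1 ?addr0// => b nb.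
by rewrite (negbTE nb) mulr0.
Qed.

Definition outq h b : R := \sum_(0 <= i < size h) kappa (ty h i) b * (nch h i).+1%:R / Zm s g b.

Lemma sum_dsc u (F : nat -> R) : \sum_(0 <= v < size g) (v \in dsc u g)%:R * F v =
  \sum_(0 <= i < size (dsc u g)) F (nth 0%N (dsc u g) i).
Proof.
rewrite -(big_nth 0%N xpredT F).
under [LHS]eq_bigr do rewrite mulr_natl mulrb.
rewrite -big_mkcond -big_filter; apply: perm_big; apply: uniq_perm.
- by rewrite filter_uniq// iota_uniq.
- exact: dsc_uniq.
move=> v; rewrite mem_filter mem_index_iota; case E : (v \in dsc u g) => //=.
by have /andP[] := dsc_bound E.
Qed.

Lemma q_dsc h u i b : (size h < size g)%N -> hist u g = h -> (i < size h)%N ->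
  q s g b (nth 0%N (dsc u g) i) = kappa (ty h i) b * (nch h i).+1%:R / Zm s g b.
Proof.
move=> hg uh ih; have su : size (dsc u g) = size h by rewrite -uh size_hist.
have iu : (i < size (dsc u g))%N by rewrite su.
have ty_i := hist_ty a0 wg iu; have nch_i := hist_nch a0 wg iu.
rewrite uh in ty_i nch_i.
rewrite /attach_q -ty_i /dg -nch_i.
have -> : nth 0%N (dsc u g) i != 0%N.
  apply/eqP => n0; have := mem_nth 0%N iu; rewrite n0 => /dsc_bound/andP[].
  rewrite leqn0 => /eqP u0 _; move: su; rewrite u0 (size_dsc0 a0 wg); lia.
by rewrite addn1.
Qed.

Lemma sum_cnt h (F : nat -> R) c : (forall u, hist u g = h -> F u = c) ->
  \sum_(0 <= u < size g) (hist u g == h)%:R * F u = (cnt h g)%:R * c.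
Proof.
move=> H; rewrite /cnt natr_sum mulr_suml; apply: eq_bigr => u _.
by case: eqP => [/H ->//|_]; rewrite !mul0r.
Qed.

Lemma drift_loss h : (size h < size g)%N ->
  \sum_b \sum_(0 <= v < size g) p b * q s g b v *
     (\sum_(0 <= u < size g) ((hist u g == h) && (v \in dsc u g)))%:R =
  (cnt h g)%:R * \sum_b p b * outq h b.
Proof.
move=> hg; rewrite mulr_sumr; apply: eq_bigr => b _.
transitivity (\sum_(0 <= u < size g) (hist u g == h)%:R *
    \sum_(0 <= v < size g) (v \in dsc u g)%:R * (p b * q s g b v)).
  under [RHS]eq_bigr do rewrite mulr_sumr.
  rewrite exchange_big; apply: eq_bigr => v _; rewrite natr_sum mulr_sumr.
  by apply: eq_bigr => u _; rewrite -mulnb natrM; ring.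
apply: sum_cnt => u uh; rewrite sum_dsc -mulr_sumr -size_hist uh; congr (_ * _).
by apply: eq_big_nat => i /andP[_ ih]; exact: q_dsc.
Qed.

Lemma drift_gain h0 c j : (size h0 < size g)%N -> (j < size h0)%N ->
  \sum_b \sum_(0 <= v < size g) p b * q s g b v *
     (\sum_(0 <= u < size g)
       ((rcons (hist u g) (b, index v (dsc u g)) == rcons h0 (c, j)) && (v \in dsc u g)))%:R =
  (cnt h0 g)%:R * (p c * (kappa (ty h0 j) c * (nch h0 j).+1%:R / Zm s g c)).
Proof.
move=> hg jh.
transitivity (\sum_(0 <= u < size g) (hist u g == h0)%:R *
    \sum_(0 <= v < size g) (v \in dsc u g)%:R * ((index v (dsc u g) == j)%:R * (p c * q s g c v))).
  under [RHS]eq_bigr do rewrite mulr_sumr.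
  rewrite (bigD1 c)//= [X in _ + X]big1 ?addr0; last first.
    move=> b nb; apply: big1 => v _; rewrite big1 ?mulr0// => u _.
    by rewrite eqseq_rcons xpair_eqE (negbTE nb) andbF.
  rewrite [in RHS]exchange_big; apply: eq_bigr => v _; rewrite natr_sum mulr_sumr.
  by apply: eq_bigr => u _; rewrite eqseq_rcons xpair_eqE eqxx/= -!mulnb !natrM; ring.
apply: sum_cnt => u uh; have su : size (dsc u g) = size h0 by rewrite -uh size_hist.
rewrite sum_dsc su (bigD1_seq j) ?iota_uniq ?mem_index_iota//=.
rewrite index_uniq ?su ?dsc_uniq// eqxx mul1r big1_seq ?addr0.
  by congr (_ * _); exact: q_dsc.
move=> i /andP[ij]; rewrite mem_index_iota => /andP[_ ih].
by rewrite index_uniq ?su ?dsc_uniq// (negbTE ij) mul0r.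
Qed.

Lemma drift_gain0 e :
  \sum_b \sum_(0 <= v < size g) p b * q s g b v *
     (\sum_(0 <= u < size g)
       ((rcons (hist u g) (b, index v (dsc u g)) == [:: e]) && (v \in dsc u g)))%:R = 0.
Proof.
apply: big1 => b _; apply: big1 => v _; rewrite big_nat big1 ?mulr0// => u /andP[_ ug].
rewrite -[[:: e]]/(rcons [::] e) eqseq_rcons.
have /(wfP a0)[] := hist_wf a0 wg ug.
by case: (hist u g).
Qed.

Lemma drift_cntE h : drift (psi_cnt h) s g =
  \sum_b \sum_(0 <= v < size g) p b * q s g b v * ([:: (b, 0%N)] == h)%:R +
  \sum_b \sum_(0 <= v < size g) p b * q s g b v *
     (\sum_(0 <= u < size g)
       ((rcons (hist u g) (b, index v (dsc u g)) == h) && (v \in dsc u g)))%:R -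
  \sum_b \sum_(0 <= v < size g) p b * q s g b v *
     (\sum_(0 <= u < size g) ((hist u g == h) && (v \in dsc u g)))%:R.
Proof.
rewrite -big_split -sumrB; apply: eq_bigr => b _; rewrite -big_split -sumrB.
by apply: eq_bigr => v _; rewrite cnt_rconsE /=; ring.
Qed.

Lemma drift_cnt1 a : (1 < size g)%N ->
  drift (psi_cnt [:: (a, 0%N)]) s g =
  p a - (cnt [:: (a, 0%N)] g)%:R * \sum_b p b * outq [:: (a, 0%N)] b.
Proof.
move=> g1; rewrite drift_cntE drift_gain0 drift_loss// addr0; congr (_ - _).
have E b : \sum_(0 <= v < size g) p b * q s g b v * ([:: (b, 0%N)] == [:: (a, 0%N)])%:R = p b * (b == a)%:R.
  rewrite -mulr_suml -mulr_sumr sum_q// mulr1.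
  by rewrite (inj_eq (f := fun b => [:: (b, 0%N)]))// => x y [].
rewrite (eq_bigr _ (fun b _ => E b)) (bigD1 a)//= eqxx mulr1 big1 ?addr0// => b nb.
by rewrite (negbTE nb) mulr0.
Qed.

Lemma drift_cnt_rcons h0 c j : (size h0 < (size g).-1)%N -> (j < size h0)%N ->
  drift (psi_cnt (rcons h0 (c, j))) s g =
  (cnt h0 g)%:R * (p c * (kappa (ty h0 j) c * (nch h0 j).+1%:R / Zm s g c)) -
  (cnt (rcons h0 (c, j)) g)%:R * \sum_b p b * outq (rcons h0 (c, j)) b.
Proof.
move=> hg jh; rewrite drift_cntE drift_loss; last by rewrite size_rcons; lia.
rewrite drift_gain//; last lia.
rewrite big1 ?add0r// => b _; rewrite big1// => v _.
by case: h0 jh {hg} => // e h0' _; rewrite /= [_ == _]andbC; case: h0' => [|? ?]; rewrite ?mulr0.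
Qed.

End Drift.

Section AlongPath.
Variable eta : 'I_K -> R.
Hypothesis eta_min : Vpi_minimizer p kappa eta.
Variable g : nat -> rtree K.
Hypotheses (wg0 : wf (g 0%N)) (steps : forall n, step (g n) (g n.+1)).
Let s := size (g 0%N) == 1%N.
Local Notation dev psi := (dev a0 p kappa psi g).
Local Notation vdev psi := (vdev a0 p kappa psi g).
Local Notation ph := (phi p kappa eta).

Lemma wf_path n : wf (g n).
Proof.
elim: n => // n IH; have [b [v [vg ->]]] := steps n.
by rewrite wf_rcons ?IH//; lia.
Qed.

Lemma size_path n : size (g n) = (size (g 0%N) + n)%N.
Proof.
elim: n => [|n IH]; first by rewrite addn0.
by have [b [v [vg ->]]] := steps n; rewrite size_rcons IH addnS.
Qed.

Lemma single_path n : (size (g n) == 1%N) ==> s.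
Proof.
rewrite /s size_path; have /(wfP a0)[g0 _] := wg0.
by apply/implyP => /eqP ?; apply/eqP; lia.
Qed.

Lemma dev_rcons psi n b v : g n.+1 = rcons (g n) (b, v) ->
  dev psi n.+1 - dev psi n = psi (g n) b v - drift psi s (g n).
Proof. by move=> E; rewrite [X in X - _]big_nat_recr//= addrAC subrr add0r E last_rcons. Qed.

Lemma path_drift_le psi C n : (forall g b v, `|psi g b v| <= C) ->
  `|drift psi s (g n)| <= C.
Proof.
move=> psiC; have wn := wf_path n; have sn := single_path n.
have q0 b v : 0 <= p b * q s (g n) b v by rewrite mulr_ge0 ?(ltW (p_gt0 _)) ?q_ge0.
apply: (le_trans (ler_norm_sum _ _ _)).
have -> : C = \sum_b \sum_(0 <= v < size (g n)) p b * q s (g n) b v * C.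
  under eq_bigr do rewrite -mulr_suml -mulr_sumr sum_q// mulr1.
  by rewrite -mulr_suml p1 mul1r.
apply: ler_sum => b _; apply: (le_trans (ler_norm_sum _ _ _)).
by apply: ler_sum => v _; rewrite normrM (ger0_norm (q0 b v)) ler_wpM2l.
Qed.

Lemma dev_incr psi C n : (forall g b v, `|psi g b v| <= C) ->
  `|dev psi n.+1 - dev psi n| <= 2 * C.
Proof.
move=> psiC; have [b [v [_ E]]] := steps n; rewrite (dev_rcons _ E).
rewrite mulrDl !mul1r; apply: (le_trans (ler_normB _ _)).
by apply: lerD; [exact: psiC|exact: path_drift_le].
Qed.

Hypothesis deg_noise : forall a, exists B, forall n, vdev (psi_deg a) n <= B.
Hypothesis cnt_noise : forall h, exists B, forall n, vdev (psi_cnt h) n <= B.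

Let X n a : R := Xm s (g n) a.
Let S n a : R := dev (psi_deg a) n.
Let T0 : R := \sum_a X 0 a.

Lemma X_rcons n b v a : g n.+1 = rcons (g n) (b, v) -> (v < size (g n))%N ->
  X n.+1 a = X n a + psi_deg a (g n) b v.
Proof. by move=> E vg; rewrite /X E Xm_rcons ?wf_path// /psi_deg addrA. Qed.

Lemma T0_gt0 : 0 < T0. Proof. exact: (@Xm_total_gt0 K a0 R s (g 0%N) wg0 (single_path 0)). Qed.

Lemma X_ge0 n a : 0 <= X n a. Proof. exact/Xm_ge0/wf_path. Qed.

Lemma X_total n : \sum_a X n a = T0 + 2 * n%:R.
Proof.
elim: n => [|n IH]; first by rewrite mulr0 addr0.
have [b [v [vg E]]] := steps n.
under eq_bigr do rewrite (X_rcons _ E vg).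
rewrite big_split/= IH /psi_deg big_split/= -[n.+1%:R]natr1.
have sum1 (c : 'I_K) : \sum_a (c == a)%:R = 1 :> R.
  by rewrite (bigD1 c)//= eqxx big1 ?addr0// => a ac; rewrite eq_sym (negbTE ac).
by rewrite !sum1; ring.
Qed.

Lemma X_noise n a : X n.+1 a =
  X n a + (p a + \sum_b p b * (kappa a b * X n a / \sum_c kappa c b * X n c)) +
  (S n.+1 a - S n a).
Proof.
have [b [v [vg E]]] := steps n; rewrite (X_rcons _ E vg) /S (dev_rcons _ E).
by rewrite (drift_deg (wf_path n) (single_path n)) -/(X n a) /Zmass /X; ring.
Qed.

Lemma X_mono n a : X n a <= X n.+1 a.
Proof. by have [b [v [vg E]]] := steps n; rewrite (X_rcons _ E vg) lerDl addr_ge0. Qed.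

Lemma X_incr n a : X n.+1 a <= X n a + 2.
Proof.
have [b [v [vg E]]] := steps n; rewrite (X_rcons _ E vg) lerD2l.
exact: le_trans (ler_norm _) (psi_deg_le _ _ _ _).
Qed.

Lemma path_rate_cvg a b :
  (fun n => p b * kappa a b / (Zm s (g n) b / n.+1%:R)) @ \oo --> ph a b / 2.
Proof.
exact: (rate_cvg p_gt0 p1 kappa_gt0 eta_min T0_gt0 X_ge0 X_total X_noise X_mono X_incr deg_noise).
Qed.

Lemma path_first_order a : \sum_b ph a b = 2 - p a / eta a.
Proof.
exact: (first_order p_gt0 p1 kappa_gt0 eta_min T0_gt0 X_ge0 X_total X_noise X_mono X_incr deg_noise).
Qed.

Lemma phi_gt0 a b : 0 < ph a b.
Proof.
have [e0 _] := eta_min.1; pose c0 := b.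
rewrite mulr_gt0// divr_gt0//; apply: (@lt_le_trans _ _ (kappa c0 b * eta c0)).
  by rewrite mulr_gt0.
by rewrite (bigD1 c0)//= lerDl sumr_ge0// => l _; rewrite mulr_ge0// ltW.
Qed.

Lemma Zm_pos n b : 0 < Zm s (g n) b.
Proof. exact: (Zm_gt0 a0 kappa_gt0 b (wf_path n) (single_path n)). Qed.

Let cc h n : R := n.+1%:R * \sum_b p b * outq s (g n) h b.

Lemma out_cvg h : cc h @ \oo --> lam a0 ph h / 2.
Proof.
have -> : cc h = fun n => \sum_(0 <= i < size h) \sum_b
    p b * kappa (ty h i) b / (Zm s (g n) b / n.+1%:R) * (nch h i).+1%:R.
  apply/funext => n; rewrite /cc /outq mulr_sumr exchange_big; apply: eq_bigr => b _.
  rewrite !mulr_sumr; apply: eq_bigr => i _.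
  have := lt0r_neq0 (Zm_pos n b).
  by move: (Zm _ _ _) => z z0; field; rewrite z0 gt_eqF.
have -> : lam a0 ph h / 2 = \sum_(0 <= i < size h) \sum_b ph (ty h i) b / 2 * (nch h i).+1%:R.
  rewrite lamE mulr_suml; apply: eq_bigr => i _; rewrite mulr_suml; apply: eq_bigr => b _.
  by rewrite /rt mulrAC.
apply: cvg_sum_seq => i; apply: cvg_sum_seq => b; apply: cvgMr_tmp; exact: path_rate_cvg.
Qed.

Lemma cc_ge0 h n : 0 <= cc h n.
Proof.
rewrite mulr_ge0//; apply: sumr_ge0 => b _; rewrite mulr_ge0 ?(ltW (p_gt0 _))//.
apply: sumr_ge0 => i _; rewrite divr_ge0 ?mulr_ge0 ?(ltW (kappa_gt0 _ _))//.
exact/ltW/(Zm_pos n b).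
Qed.

Lemma cnt_recursion h (bt : nat -> R) (b0 : R) :
  (forall n, ((size h).+1 <= n)%N -> drift (psi_cnt h) s (g n) =
     bt n - (cnt h (g n))%:R * \sum_b p b * outq s (g n) h b) ->
  bt @ \oo --> b0 ->
  (fun n => (cnt h (g n))%:R / n.+1%:R) @ \oo --> b0 / (1 + lam a0 ph h / 2).
Proof.
move=> dE bb; have [B HB] := cnt_noise h.
apply: (@linear_recursion _ _ (cc h) bt (dev (psi_cnt h)) _ _ (size h).+1 _ (cc_ge0 h)) => //.
- by rewrite divr_ge0// (lam_ge0 a0 phi_gt0).
- move=> n hn; have [b [v [vg E]]] := steps n.
  rewrite (dev_rcons _ E) dE// /psi_cnt E /cc.
  by move: (\sum_b _) => w; field; rewrite gt_eqF.
- exact: (dev_small (fun n => dev_incr n (psi_cnt_le h)) HB).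
- exact: out_cvg.
Qed.

Lemma cnt_cvg h : wf h -> par h 0 = 0%N ->
  (fun n => (cnt h (g n))%:R / n.+1%:R) @ \oo --> vph a0 p ph h.
Proof.
have pg n m : (m < n)%N -> (m < size (g n))%N by rewrite size_path; lia.
move: h; apply: wf_ind => [[a k]|h c j wh jh IH].
  rewrite /par /= => ->.
  have -> : vph a0 p ph [:: (a, 0%N)] = p a / (1 + lam a0 ph [:: (a, 0%N)] / 2).
    have l0 : 0 <= lam a0 ph [:: (a, 0%N)] by exact: (lam_ge0 a0 phi_gt0).
    by rewrite /vph rho1 /=; field; lra.
  apply: (@cnt_recursion _ (fun=> p a)) (cvg_cst _) => n hn.
  by rewrite (drift_cnt1 (wf_path n) (single_path n))//; apply: pg; apply: leq_trans hn.
have h0 : (0 < size h)%N by lia.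
have -> : par (rcons h (c, j)) 0 = par h 0 by rewrite par_rcons h0.
move=> /IH{}IH.
have -> : vph a0 p ph (rcons h (c, j)) =
    vph a0 p ph h * (ph (ty h j) c / 2 * (nch h j).+1%:R) / (1 + lam a0 ph (rcons h (c, j)) / 2).
  have l0 : 0 <= lam a0 ph (rcons h (c, j)) by exact: (lam_ge0 a0 phi_gt0).
  have l1 : 0 <= lam a0 ph h by exact: (lam_ge0 a0 phi_gt0).
  rewrite /vph rho_rcons// /rt [(c, j).1]/= [(c, j).2]/=; move: (nch h j).+1%:R (lam _ _ (rcons _ _)) (lam _ _ h) l0 l1 => m l l' l0 l1.
  by field; apply/andP; split; lra.
apply: (@cnt_recursion _ (fun n => (cnt h (g n))%:R / n.+1%:R *
   (p c * kappa (ty h j) c / (Zm s (g n) c / n.+1%:R) * (nch h j).+1%:R))).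
  move=> n; rewrite size_rcons => hn.
  rewrite (drift_cnt_rcons (wf_path n) (single_path n))//; last first.
    by rewrite size_path; have /(wfP a0)[] := wg0; lia.
  congr (_ - _); have := lt0r_neq0 (Zm_pos n c).
  by move: (Zm _ _ _) => z z0; field; rewrite z0 gt_eqF.
by apply: cvgM => //; apply: cvgMr_tmp; exact: path_rate_cvg.
Qed.

End AlongPath.

End Path.

(** * Discrete random variables *)

Section DiscreteVariable.
Context d (O : measurableType d) (R : realType) (P : probability O R).
Variables (T : countType) (Y : O -> T).
Hypothesis mY : forall x, measurable [set w | Y w = x].
Local Notation pr := (pr P).

Lemma measurable_value (A : set T) : measurable [set w | A (Y w)].
Proof.
exact: (@measurable_discrete _ _ _ Y (fun x => [set w | A x]) mY (fun x => measurable_prop _ _)).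
Qed.

Lemma sum_pr_value (s : seq T) : uniq s ->
  \sum_(x <- s) pr [set w | Y w = x] = pr [set w | Y w \in s].
Proof.
elim: s => [_|x s IH /= /andP[xs us]].
  by rewrite big_nil (_ : [set w | Y w \in [::]] = set0) ?pr0//; apply/seteqP; split.
rewrite big_cons IH//.
rewrite (pr_split P (measurable_value [set y | y \in x :: s]) (mY x)) addrC.
congr (_ + _); congr pr; apply/seteqP; split=> w /=; rewrite ?inE.
- move=> ys; split; first by rewrite ys orbT.
  by move=> yx; move: xs; rewrite -yx ys.
- by move=> [/predU1P[->|//] []].
- by move=> ->; rewrite eqxx.
- by case.
Qed.

Lemma value_total e : 0 < e -> exists2 s, uniq s & 1 - e <= \sum_(x <- s) pr [set w | Y w = x].
Proof.
move=> e0; pose F n := [set w | (pickle (Y w) < n)%N].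
have mF n : measurable (F n) by exact: (measurable_value [set y | (pickle y < n)%N]).
have UF : \bigcup_n F n = setT.
  by apply/seteqP; split=> // w _; exists (pickle (Y w)).+1 => //=; exact: ltnSn.
have : (fun n => P (F n)) @ \oo --> P (\bigcup_n F n).
  apply: nondecreasing_cvg_mu => //; first by rewrite UF.
  move=> n m nm; apply/subsetPset => w /= h; exact: leq_trans h nm.
rewrite UF probability_setT (_ : (fun n => P (F n)) = fun n => (pr (F n))%:E); last first.
  by apply/funext => n; exact: (prE P (mF n)).
move/fine_cvgP => [_]; rewrite (_ : fine \o _ = fun n => pr (F n)); last by apply/funext.
move=> /cvgrPdist_le /(_ e e0) [N _ /(_ N (leqnn N)) /=].
rewrite ler_norml => /andP[_ FN].
pose s : seq T := undup (pmap unpickle (iota 0 N)).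
exists s; first exact: undup_uniq.
rewrite sum_pr_value ?undup_uniq//.
have : pr (F N) <= pr [set w | Y w \in s].
  apply: pr_le => //; first exact: (measurable_value [set y | y \in s]).
  move=> w /= wN; rewrite mem_undup mem_pmap; apply/mapP; exists (pickle (Y w)).
    by rewrite mem_iota.
  by rewrite pickleK.
lra.
Qed.

Lemma expectation_close (f : T -> R) C : (forall x, `|f x| <= C) ->
  exists2 E : R, ('E_P[fun w => f (Y w)] = E%:E)%E &
  forall s, uniq s -> `|E - \sum_(x <- s) pr [set w | Y w = x] * f x| <=
    C * (1 - \sum_(x <- s) pr [set w | Y w = x]).
Proof.
move=> fC.
have mf D : measurable_fun D (fun w => f (Y w)).
  apply: (@measurable_funS _ _ _ _ setT) => // _ B mB; rewrite setTI.
  exact: (measurable_value (f @^-1` B)).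
have fint : P.-integrable setT (EFin \o (fun w => f (Y w))).
  apply: measurable_bounded_integrable => //; first by rewrite ltey_eq fin_num_measure.
  by exists C; split; [exact: num_real|move=> M CM w _; apply: le_trans (ltW CM)].
have Efin : ('E_P[fun w => f (Y w)] \is a fin_num)%E.
  by rewrite unlock; exact: integrable_fin_num fint.
exists (fine ('E_P[fun w => f (Y w)])%E); first by rewrite fineK.
move=> s us; set D := [set w | Y w \in s].
have mD : measurable D by exact: (measurable_value [set y | y \in s]).
have ED : (\int[P]_(w in D) (f (Y w))%:E = (\sum_(x <- s) pr [set w | Y w = x] * f x)%:E)%E.
  have -> : D = \big[setU/set0]_(x <- s) [set w | Y w = x].
    rewrite -bigcup_seq; apply/seteqP; split=> w /=; first by move=> ws; exists (Y w).
    by move=> [x /= xs yx]; rewrite /D /= yx.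
  rewrite integral_bigsetU_EFin//; last first.
  - exact/measurable_realfun.measurable_EFinP/mf.
  - by move=> i j _ _ [w [/= <- <-]].
  rewrite -sumEFin; apply: eq_bigr => x _.
  transitivity (\int[P]_(w in [set w | Y w = x]) (cst (f x)%:E w))%E.
    by apply: eq_integral => w; rewrite inE /= => ->.
  by rewrite integral_cst// EFinM muleC; congr (_ * _)%E; exact: prE.
have Ec : (`|\int[P]_(w in ~` D) (f (Y w))%:E| <= (C * pr (~` D))%:E)%E.
  have mDc : measurable (~` D) by exact: measurableC.
  apply: (le_trans (le_abse_integral _ mDc _)); first exact/measurable_realfun.measurable_EFinP/mf.
  rewrite EFinM (_ : (pr (~` D))%:E = P (~` D)); last exact/esym/prE.
  rewrite -integral_cst//; apply: ge0_le_integral => //.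
  - by apply/measurable_realfun.measurable_EFinP; apply: measurableT_comp => //; exact: mf.
  - by move=> w _; rewrite lee_fin; apply: le_trans (fC (Y w)).
have : ('E_P[fun w => f (Y w)] = (\sum_(x <- s) pr [set w | Y w = x] * f x)%:E +
    \int[P]_(w in ~` D) (f (Y w))%:E)%E.
  rewrite unlock -ED -integral_setU ?setUv//; first exact: measurableC.
  - exact/measurable_realfun.measurable_EFinP/mf.
  - by rewrite disj_set2E setICr.
case: (\int[P]_(w in ~` D) (f (Y w))%:E)%E Ec => [c| |] //= cC ->.
rewrite /= addrAC subrr add0r; move: cC; rewrite lee_fin => /le_trans; apply.
have := pr_split P measurableT mD; rewrite prT setTD setTI sum_pr_value// -/D => ->.
by rewrite addrK.
Qed.

End DiscreteVariable.

(** * Convergence of the fringe *)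

Lemma sum_fibers (I : finType) (T : eqType) (F : I -> T) (s : seq T) : uniq s ->
  (\sum_(t <- s) #|[set u | F u == t]%SET| = #|[set u | F u \in s]%SET|)%N.
Proof.
elim: s => [_|t s IH /= /andP[ts us]].
  by rewrite big_nil; apply/esym/eqP; rewrite cards_eq0; apply/eqP/setP => u; rewrite !inE.
rewrite big_cons IH// -cardsUI.
have -> : ([set u | F u == t] :&: [set u | F u \in s] = finset.set0)%SET.
  apply/setP => u; rewrite !inE; apply/negbTE/negP => /andP[/eqP ->]; exact/negP.
by rewrite cards0 addn0; apply: eq_card => u; rewrite !inE.
Qed.

Lemma empirical_close (R : realType) (I : finType) (T : eqType) (F : I -> T) (s : seq T)
    (f : T -> R) (C : R) : (0 < #|I|)%N -> uniq s -> (forall x, `|f x| <= C) ->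
  `|#|I|%:R^-1 * \sum_u f (F u) - \sum_(x <- s) #|[set u | F u == x]%SET|%:R / #|I|%:R * f x|
    <= C * (1 - \sum_(x <- s) #|[set u | F u == x]%SET|%:R / #|I|%:R).
Proof.
move=> I0 us fC; have N0 : 0 < #|I|%:R :> R by rewrite ltr0n.
have pick y : \sum_(x <- s) (y == x)%:R * f x = if y \in s then f y else 0.
  case: ifP => ys; last first.
    rewrite big1_seq// => x /andP[_ xs]; case: eqP => [yx|_]; last by rewrite mul0r.
    by rewrite yx xs in ys.
  rewrite (bigD1_seq y)//= eqxx mul1r big1 ?addr0// => x xy.
  by rewrite eq_sym (negbTE xy) mul0r.
have -> : \sum_(x <- s) #|[set u | F u == x]%SET|%:R / #|I|%:R * f x =
    #|I|%:R^-1 * \sum_u (if F u \in s then f (F u) else 0).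
  under [in RHS]eq_bigr do rewrite -pick.
  rewrite exchange_big mulr_sumr; apply: eq_bigr => x _; rewrite mulrAC mulrC; congr (_ * _).
  rewrite -mulr_suml -natr_sum; congr (_%:R * _); rewrite -sum1_card big_mkcond.
  by apply: eq_bigr => u _; rewrite inE.
rewrite -mulrBr -sumrB normrM gtr0_norm ?invr_gt0//.
have -> : C * (1 - \sum_(x <- s) #|[set u | F u == x]%SET|%:R / #|I|%:R) =
    #|I|%:R^-1 * \sum_u (if F u \in s then 0 else C).
  rewrite -mulr_suml -natr_sum sum_fibers//.
  have -> : \sum_u (if F u \in s then 0 else C) = C * (#|I|%:R - #|[set u | F u \in s]%SET|%:R).
    have -> : #|I|%:R = \sum_(u : I) 1 :> R by rewrite sumr_const.
    have -> : #|[set u | F u \in s]%SET|%:R = \sum_u (F u \in s)%:R :> R.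
      rewrite -natr_sum -sum1_card big_mkcond; congr (_%:R).
      by apply: eq_bigr => u _; rewrite inE; case: ifP.
    rewrite -sumrB mulr_sumr; apply: eq_bigr => u _.
    by case: (_ \in _); rewrite /=; ring.
  by field; rewrite gt_eqF.
apply: ler_wpM2l; first by rewrite invr_ge0 ltW.
apply: (le_trans (ler_norm_sum _ _ _)); apply: ler_sum => u _.
by case: ifP => _; rewrite ?subrr ?normr0// subr0.
Qed.

Section Scheffe.
Variables (R : realType) (T : eqType) (M : nat -> T -> R) (w : T -> R).
Hypothesis w_ge0 : forall t, 0 <= w t.
Hypothesis M_le1 : forall n s, uniq s -> \sum_(t <- s) M n t <= 1.
Hypothesis M_liminf : forall t e, 0 < e -> exists N, forall n, (N <= n)%N -> w t - e <= M n t.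
Hypothesis w_total : forall e, 0 < e -> exists2 s, uniq s & 1 - e <= \sum_(t <- s) w t.

Lemma sum_liminf s e : 0 < e -> exists N, forall n, (N <= n)%N ->
  \sum_(t <- s) w t - e <= \sum_(t <- s) M n t.
Proof.
elim: s e => [|t s IH] e e0; first by exists 0%N => n _; rewrite !big_nil; lra.
have e2 : 0 < e / 2 by lra.
have [N1 H1] := IH _ e2; have [N2 H2] := M_liminf t e2.
exists (maxn N1 N2) => n; rewrite geq_max => /andP[n1 n2]; rewrite !big_cons.
by move: (H1 n n1) (H2 n n2); lra.
Qed.

Lemma scheffe t : (fun n => M n t) @ \oo --> w t.
Proof.
apply/cvgrPdist_le => e e0; have e2 : 0 < e / 2 by lra.
have [s us ws] := w_total e2.
have [N1 H1] := sum_liminf (rem t s) e2; have [N2 H2] := M_liminf t e0.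
exists (maxn N1 N2) => // n /=; rewrite geq_max => /andP[n1 n2].
have wt : \sum_(x <- s) w x <= w t + \sum_(x <- rem t s) w x.
  have [ts|ts] := boolP (t \in s); first by rewrite (perm_big _ (perm_to_rem ts)) big_cons.
  by rewrite rem_id// lerDr.
have := @M_le1 n (t :: rem t s); rewrite /= mem_rem_uniqF// rem_uniq// => /(_ isT).
rewrite big_cons ler_norml => M1; apply/andP; split; move: (H1 n n1) (H2 n n2); lra.
Qed.

Lemma sum_cvg (f : T -> R) s :
  (fun n => \sum_(t <- s) M n t * f t) @ \oo --> \sum_(t <- s) w t * f t.
Proof. by apply: cvg_sum_seq => t; apply: cvgMr_tmp; exact: scheffe. Qed.

End Scheffe.

Section FringeFrequencies.
Variables (R : realType) (K : nat) (a0 : 'I_K) (v : rtree K -> R) (w : utree K -> R).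
Hypothesis w_ge0 : forall t, 0 <= w t.
Hypothesis w_hist : forall t e, 0 < e -> exists n, w t - e <= \sum_(h <- hsl K n | cls a0 h == t) v h.
Hypothesis w_le1 : forall s, uniq s -> \sum_(t <- s) w t <= 1.
Hypothesis w_total : forall e, 0 < e -> exists2 s, uniq s & 1 - e <= \sum_(t <- s) w t.
Variables (g : nat -> rtree K) (m0 : nat).
Hypotheses (wg : forall n, wf (g n)) (size_g : forall n, size (g n) = (m0 + n)%N).
Hypothesis cnt_lim : forall h, wf h -> par a0 h 0 = 0%N ->
  (fun n => (cnt h (g n))%:R / n.+1%:R) @ \oo --> v h.

Definition fq n t : R := #|[set u : 'I_(size (g n)) | fr a0 u == t]%SET|%:R / (size (g n))%:R.

Let sg n : 0 < (size (g n))%:R :> R.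
Proof. by rewrite ltr0n; have /(wfP a0)[] := wg n. Qed.

Lemma fq_le1 n s : uniq s -> \sum_(t <- s) fq n t <= 1.
Proof.
move=> us; rewrite -mulr_suml -natr_sum sum_fibers// ler_pdivrMr// mul1r ler_nat.
by rewrite -[leqRHS]card_ord max_card.
Qed.

Lemma sum_cnt_le n m t :
  (\sum_(h <- hsl K m | cls a0 h == t) cnt h (g n) <= #|[set u : 'I_(size (g n)) | fr a0 u == t]%SET|)%N.
Proof.
rewrite -sum1_card [leqRHS]big_mkcond/=; under [leqLHS]eq_bigr do rewrite /cnt big_mkord.
rewrite exchange_big; apply: leq_sum => u _; rewrite inE (fr_hist a0 u (wg n)).
have [ut|ut] := eqVneq; last first.
  by rewrite big1// => h /eqP ht; case: eqP => // uh; move: ut; rewrite uh ht eqxx.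
rewrite big_mkcond; apply: (@leq_trans (count (pred1 (hist u (g n))) (hsl K m))).
  rewrite -sum1_count [leqRHS]big_mkcond; apply: leq_sum => h _ /=.
  by rewrite [h == _]eq_sym; case: ifP => // _; case: eqP.
by rewrite count_uniq_mem ?uniq_hsl//; case: (_ \in _).
Qed.

Lemma size_cvg : (fun n => n.+1%:R / (size (g n))%:R : R) @ \oo --> (1 : R).
Proof.
have -> : (fun n => n.+1%:R / (size (g n))%:R : R) =
    (fun n => (1 + (m0%:R - 1) / n.+1%:R)^-1).
  apply/funext => n; have s0 := sg n; move: s0; rewrite size_g natrD -[n.+1%:R]natr1.
  have n0 : 0 <= n%:R :> R by []. 
  move: (n%:R) n0 => x x0 s0; field; rewrite !gt_eqF//; lra.
rewrite -[X in _ --> X]invr1; apply: cvgV => //.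
rewrite -[X in _ --> X]addr0; apply: cvgD; first exact: cvg_cst.
rewrite -[X in _ --> X](mulr0 (m0%:R - 1)); apply: cvgMl_tmp; exact: cvg_harmonic.
Qed.

Lemma fq_liminf t e : 0 < e -> exists N, forall n, (N <= n)%N -> w t - e <= fq n t.
Proof.
move=> e0; have e2 : 0 < e / 2 by lra.
have [m wm] := w_hist t e2.
have hslE (F : rtree K -> R) : \sum_(h <- hsl K m | cls a0 h == t) F h =
    \sum_(h <- hsl K m) (if [&& wf h, par a0 h 0 == 0%N & cls a0 h == t] then F h else 0).
  rewrite big_mkcond; apply: eq_big_seq => h /(mem_hsl a0)[-> _ ->].
  by rewrite eqxx.
have H : (fun n => \sum_(h <- hsl K m | cls a0 h == t) (cnt h (g n))%:R / (size (g n))%:R)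
     @ \oo --> \sum_(h <- hsl K m | cls a0 h == t) v h.
  rewrite hslE; under eq_fun do rewrite hslE.
  apply: cvg_sum_seq => h; case: and3P => [[wh /eqP ph _]|_]; last exact: cvg_cst.
  have -> : (fun n => (cnt h (g n))%:R / (size (g n))%:R) =
      (fun n => (cnt h (g n))%:R / n.+1%:R * (n.+1%:R / (size (g n))%:R) : R).
    by apply/funext => n; rewrite mulrA divfK// gt_eqF.
  by rewrite -[X in _ --> X]mulr1; apply: cvgM; [exact: cnt_lim|exact: size_cvg].
have [N _ HN] := (cvgrPdist_le _ _).1 H _ e2; exists N => n Nn.
have := HN n Nn; rewrite ler_norml => /andP[_] /= h1.
have h2 : \sum_(h <- hsl K m | cls a0 h == t) (cnt h (g n))%:R / (size (g n))%:R <= fq n t.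
  rewrite -mulr_suml ler_pM2r ?invr_gt0// -natr_sum ler_nat; exact: sum_cnt_le.
by move: wm h1 h2; move: (\sum_(_ <- _ | _) _) (\sum_(_ <- _ | _) _) (fq _ _) => x y z; lra.
Qed.

Lemma fq_cvg t : (fun n => fq n t) @ \oo --> w t.
Proof. exact: (scheffe w_ge0 fq_le1 fq_liminf w_total). Qed.

(* A child of a vertex with fringe tree s is again a vertex, so that the
   fringe equation holds as an inequality; it is an equality since both sides
   have total mass 1. *)
Lemma fringe_le s t : uniq s -> \sum_(x <- s) w x * (Q x t)%:R <= w t.
Proof.
move=> us; have H : (fun n => \sum_(x <- s) fq n x * (Q x t)%:R) @ \oo --> \sum_(x <- s) w x * (Q x t)%:R.
  exact: (sum_cvg w_ge0 fq_le1 fq_liminf w_total).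
apply: (ler_cvg_to H (@fq_cvg t)).
apply: nearW => n; under eq_bigr do rewrite mulrAC -natrM.
rewrite -mulr_suml ler_pM2r ?invr_gt0// -natr_sum ler_nat.
pose F (u : 'I_(size (g n))) := if fr a0 u == t then omap (fr a0 (g := g n)) (parent u) else None.
apply: (@leq_trans (\sum_(y <- map Some s) #|[set u | F u == y]%SET|)).
  rewrite big_map; apply: leq_sum => x _.
  have := card_chain a0 (wg n) 1 (fun i => if i is 0 then t else x).
  rewrite big_nat1/= => <-; apply: subset_leq_card; apply/fintype.subsetP => u; rewrite !inE /F.
  by case: eqP => //= _; case: (parent u) => //= z; rewrite andbT => /eqP ->.
rewrite sum_fibers; last by rewrite map_inj_uniq// => ? ? [].
apply: subset_leq_card; apply/fintype.subsetP => u; rewrite !inE /F.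
by case: eqP => // _ /mapP[].
Qed.

Lemma fringe_ge : (forall e, 0 < e -> exists2 s, uniq s & 1 - e <= \sum_(t <- s) w t * (size (kids t))%:R) ->
  forall t e, 0 < e -> exists2 s, uniq s & w t - e <= \sum_(x <- s) w x * (Q x t)%:R.
Proof.
move=> w_kids t e e0; have [s us hs] := w_kids _ e0; exists s => //.
pose L := undup (t :: flatten (map (@kids K) s)).
have uL : uniq L by exact: undup_uniq.
have tL : t \in L by rewrite mem_undup mem_head.
have EL : \sum_(t' <- L) \sum_(x <- s) w x * (Q x t')%:R = \sum_(x <- s) w x * (size (kids x))%:R.
  rewrite exchange_big; apply: eq_big_seq => x xs; rewrite -mulr_sumr -natr_sum; congr (_ * _%:R).
  under eq_bigr do rewrite QE -sum1_count.
  rewrite (exchange_big_dep xpredT)//= -sum1_size; apply: eq_big_seq => k kx.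
  rewrite sum1_count (eq_count (a2 := pred1 k)); last by move=> y; rewrite /= eq_sym.
  rewrite count_uniq_mem// mem_undup inE; apply/eqP; rewrite eqb1; apply/orP; right.
  by apply/flattenP; exists (kids x) => //; apply/mapP; exists x.
have H1 := w_le1 uL; rewrite (perm_big _ (perm_to_rem tL)) big_cons in H1.
rewrite (perm_big _ (perm_to_rem tL)) big_cons in EL.
have H2 : \sum_(t' <- rem t L) \sum_(x <- s) w x * (Q x t')%:R <= \sum_(t' <- rem t L) w t'.
  by apply: ler_sum => t' _; exact: fringe_le.
have aux (a b c x y : R) : x + a = c -> 1 - e <= c -> a <= b -> y + b <= 1 -> y - e <= x by lra.
exact: aux EL hs H2 H1.
Qed.

(* Frequencies of the extended fringes: those of the trees, multiplied by the
   number of ways to choose the path. *)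
Definition efq n k (x : k.+1.-tuple (option (utree K))) : R :=
  #|[set u : 'I_(size (g n)) | extended_fringe k u == x]%SET|%:R / (size (g n))%:R.

Lemma efq_cvg k (T : sin_tree K) : (fun n => efq n (extended_fringe_sin k T)) @ \oo -->
  w (tbar T k) * \prod_(1 <= j < k.+1) (Q (tbar T j) (tbar T j.-1))%:R.
Proof.
have -> : (fun n => efq n (extended_fringe_sin k T)) =
    (fun n => fq n (tbar T k) * \prod_(1 <= j < k.+1) (Q (tbar T j) (tbar T j.-1))%:R).
  apply/funext => n; rewrite /efq /fq mulrAC; congr (_ / _).
  rewrite -natr_prod -natrM; congr (_%:R); rewrite -card_chain//; apply: eq_card => u.
  by rewrite !inE (extended_fringe_chain a0 (wg n)).
apply: cvgMr_tmp; exact: fq_cvg.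
Qed.

Context d (O : measurableType d) (P : probability O R) (T : O -> sin_tree K).
Hypothesis mT : random_sin_tree T.
Hypothesis T_law : forall i (s : nat -> utree K),
  pr P [set x | forall j, (j <= i)%N -> tbar (T x) j = s j] =
  w (s i) * \prod_(1 <= j < i.+1) (Q (s j) (s j.-1))%:R.

Let Y k x := extended_fringe_sin k (T x).

Lemma extended_fringe_sin_eq k (T1 T2 : sin_tree K) :
  extended_fringe_sin k T1 = extended_fringe_sin k T2 <->
  forall j, (j <= k)%N -> tbar T1 j = tbar T2 j.
Proof.
split=> [E|/tbar_inj E].
  apply/tbar_inj => j jk; have /(congr1 (fun t => tnth t (Ordinal (jk : (j < k.+1)%N)))) := E.
  by rewrite !tnth_mktuple => -[].
by apply: eq_from_tnth => j; rewrite !tnth_mktuple E// -ltnS.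
Qed.

Lemma measurable_Y k x : measurable [set o | Y k o = x].
Proof.
have -> : [set o | Y k o = x] = [set o | forall j, (fun j => [set o | Some (T o (j : 'I_k.+1)) = tnth x j]) j o].
  apply/seteqP; split=> o /=; first by move=> <- j; rewrite tnth_mktuple.
  by move=> E; apply: eq_from_tnth => j; rewrite tnth_mktuple.
apply: measurable_forall => j; case: (tnth x j) => [t|]; last first.
  by rewrite (_ : mkset _ = set0); [exact: measurable0|apply/seteqP; split].
rewrite (_ : mkset _ = [set o | T o j = t]); first exact: mT.
by apply/seteqP; split=> o /= => [[]|->].
Qed.

Lemma efq_ge0 n k (x : k.+1.-tuple _) : 0 <= efq n x. Proof. by rewrite divr_ge0. Qed.

Lemma efq_le1 k n s : uniq s -> \sum_(x <- s) efq n (k := k) x <= 1.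
Proof.
move=> us; rewrite -mulr_suml -natr_sum sum_fibers// ler_pdivrMr// mul1r ler_nat.
by rewrite -[leqRHS]card_ord max_card.
Qed.

Lemma efq_liminf k x e : 0 < e -> exists N, forall n, (N <= n)%N ->
  pr P [set o | Y k o = x] - e <= efq n x.
Proof.
move=> e0; have [[z ox]|no] := pselect (exists z, Y k z = x); last first.
  exists 0%N => n _; rewrite (_ : mkset _ = set0); last by apply/seteqP; split=> // z ox; case: no; exists z.
  by rewrite pr0; have := efq_ge0 n x; lra.
have [N _ HN] := (cvgrPdist_le _ _).1 (@efq_cvg k (T z)) _ e0.
exists N => n Nn; have := HN n Nn; rewrite /= -(T_law k (tbar (T z))).
have -> : [set x | forall j, (j <= k)%N -> tbar (T x) j = tbar (T z) j] = [set o | Y k o = x].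
  by apply/seteqP; split=> o' /=; rewrite -ox => /extended_fringe_sin_eq.
by rewrite -/(Y k z) ox ler_norml; move: (pr _ _) (efq _ _) => a b; lra.
Qed.

Lemma efringe_cvg k (f : k.+1.-tuple (option (utree K)) -> R) C : (forall x, `|f x| <= C) ->
  (fun n => ((size (g n))%:R^-1 * \sum_(v < size (g n)) f (extended_fringe k v))%:E) @ \oo
      --> ('E_P[fun o => f (Y k o)])%E.
Proof.
move=> fC; have C0 : 0 <= C by apply: le_trans (fC [tuple of nseq _ None]).
have [E -> HE] := expectation_close P (@measurable_Y k) fC.
apply: cvg_EFin; first exact: nearW.
apply/cvgrPdist_le => e e0; pose e1 := e / (3 * C + 1).
have c1 : 0 < 3 * C + 1 by lra.
have e10 : 0 < e1 by exact: divr_gt0.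
have [s us sP] := value_total P (@measurable_Y k) e10.
have [N1 H1] := sum_liminf (@efq_liminf k) s e10.
have S : (fun n => \sum_(x <- s) efq n x * f x) @ \oo --> \sum_(x <- s) pr P [set o | Y k o = x] * f x.
  exact: (@sum_cvg _ _ _ _ (fun x => pr_ge0 P _) (@efq_le1 k) (@efq_liminf k) (value_total P (@measurable_Y k))).
have [N2 _ H2] := (cvgrPdist_le _ _).1 S _ e10.
exists (maxn N1 N2) => // n /=; rewrite geq_max => /andP[n1 n2].
have := HE s us; move: (H1 n n1) (H2 n n2) sP => /=.
have n0 : (0 < #|'I_(size (g n))|)%N by rewrite card_ord -(ltr0n R).
have := empirical_close (fun v : 'I_(size (g n)) => extended_fringe k v) n0 us fC.
rewrite card_ord -/(efq _ _).
move: (_^-1 * _) => a; move: (\sum_(x <- s) _ * f x) (\sum_(x <- s) _ * f x) => b c.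
move: (\sum_(x <- s) _) (\sum_(x <- s) _) => u v' h1 h2 h3 h4 h5.
have -> : E - a = (E - b) + (b - c) + (c - a) by ring.
apply: (le_trans (ler_normD _ _)); rewrite [`|c - a|]distrC.
have -> : e = C * e1 + e1 + C * (2 * e1) by rewrite /e1; field; lra.
apply: lerD.
  apply: (le_trans (ler_normD _ _)); apply: lerD => //; apply: (le_trans h5).
  by apply: ler_wpM2l => //; lra.
by apply: (le_trans h1); apply: ler_wpM2l => //; lra.
Qed.

End FringeFrequencies.

(** * Uniqueness of the sin-tree *)

Section Uniqueness.
Variables (R : realType) (K : nat) (varpi : utree K -> \bar R).
Context d1 (O1 : measurableType d1) (P1 : probability O1 R) (T1 : O1 -> sin_tree K).
Context d2 (O2 : measurableType d2) (P2 : probability O2 R) (T2 : O2 -> sin_tree K).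
Hypothesis H1 : sin_tree_with_fringe P1 T1 varpi.
Hypothesis H2 : sin_tree_with_fringe P2 T2 varpi.

Definition prefix_cylinder n (t : nat -> utree K) : set (sin_tree K) :=
  [set T | forall j, (j <= n)%N -> T j = t j].

Definition prefix_cylinders : set (set (sin_tree K)) :=
  [set C | C = set0 \/ exists n t, C = prefix_cylinder n t].

Lemma prefix_cylinders_setI : setI_closed prefix_cylinders.
Proof.
have H n m t s : (n <= m)%N ->
    prefix_cylinders (prefix_cylinder n t `&` prefix_cylinder m s).
  move=> nm; have [e|ne] := pselect (forall j, (j <= n)%N -> s j = t j).
    right; exists m, s; apply/seteqP; split=> [T [] //|T Ts]; split=> // j jn.
    by rewrite Ts ?e// (leq_trans jn).
  left; apply/seteqP; split=> // T [Tt Ts]; case: ne => j jn.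
  by rewrite -Ts ?Tt// (leq_trans jn).
move=> A B [->|[n [t ->]]]; first by rewrite set0I; left.
move=> [->|[m [s ->]]]; first by rewrite setI0; left.
by case: (leqP n m) => [/H//|/ltnW/H]; rewrite setIC.
Qed.

Lemma cylinders_sub : <<s @sin_tree_cylinders K >> `<=` <<s prefix_cylinders >>.
Proof.
apply: smallest_sub; first exact: smallest_sigma_algebra.
move=> _ [i [t ->]].
pose F n := if @unpickle (seq (utree K)) n is Some L then
  (if nth t L i == t then prefix_cylinder i (nth t L) else set0) else set0.
have -> : [set T : sin_tree K | T i = t] = \bigcup_n F n.
  apply/seteqP; split=> [T /= Ti|T [n _]]; last first.
    rewrite /F; case: (unpickle n) => // L; case: ifP => // /eqP Lt TL.
    by rewrite /= TL.
  exists (pickle (mkseq T i.+1)) => //; rewrite /F pickleK nth_mkseq// Ti eqxx.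
  by move=> j ji; rewrite nth_mkseq.
have [_ _ U] := smallest_sigma_algebra setT prefix_cylinders.
apply: U => n; apply: sub_gen_smallest; rewrite /F.
case: (unpickle n) => [L|]; last by left.
by case: ifP => _; [right; exists i, (nth t L)|left].
Qed.

Lemma prefix_cylinderE d (O : measurableType d) (T : O -> sin_tree K) n t :
  T @^-1` prefix_cylinder n t = [set w | forall j, (j <= n)%N -> tbar (T w) j = tbar t j].
Proof. by apply/seteqP; split=> w /= /tbar_inj. Qed.

Lemma measurable_prefix d (O : measurableType d) (T : O -> sin_tree K) n t :
  random_sin_tree T -> measurable (T @^-1` prefix_cylinder n t).
Proof.
move=> mT; rewrite (_ : _ @^-1` _ =
    [set w | forall j, (fun j => [set w | (j <= n)%N -> T w j = t j]) j w]); last by [].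
apply: measurable_forall => j; case: (leqP j n) => jn.
  rewrite (_ : mkset _ = [set w | T w j = t j]); first exact: mT.
  by apply/seteqP; split=> w /= => [/(_ isT)|->].
by rewrite (_ : mkset _ = setT); [exact: measurableT|apply/seteqP; split].
Qed.

Lemma sin_tree_law_unique : same_law P1 T1 P2 T2.
Proof.
pose H := [set B | [/\ measurable (T1 @^-1` B), measurable (T2 @^-1` B) &
   P1 (T1 @^-1` B) = P2 (T2 @^-1` B)]].
suff : <<s prefix_cylinders >> `<=` H by move=> sub B /cylinders_sub /sub[].
apply: lambda_system_subset => //; first exact: prefix_cylinders_setI.
  split=> //.
  - by split; rewrite !preimage_setT ?probability_setT//; exact: measurableT.
  - move=> A B BA [mA1 mA2 EA] [mB1 mB2 EB].
    have D (O : Type) (T : O -> sin_tree K) : T @^-1` (A `\` B) = T @^-1` A `\` T @^-1` B by [].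
    have I (O : Type) (T : O -> sin_tree K) : T @^-1` A `&` T @^-1` B = T @^-1` B.
      by apply: setIidr => w /BA.
    rewrite /H /= !D; split; [exact: measurableD|exact: measurableD|].
    rewrite !measureD//; last 2 first.
    + by rewrite ltey_eq fin_num_measure.
    + by rewrite ltey_eq fin_num_measure.
    by rewrite !I; congr (_ - _)%E.
  move=> F ndF HF; split.
  - by rewrite preimage_bigcup; apply: bigcup_measurable => n _; case: (HF n).
  - by rewrite preimage_bigcup; apply: bigcup_measurable => n _; case: (HF n).
  have C1 : (fun n => P1 (T1 @^-1` F n)) @ \oo --> P1 (T1 @^-1` (\bigcup_n F n)).
    rewrite preimage_bigcup; apply: nondecreasing_cvg_mu.
    + by move=> n; case: (HF n).
    + by apply: bigcup_measurable => n _; case: (HF n).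
    + by move=> n m nm; apply/subsetPset => w /=; have /subsetPset := ndF _ _ nm; exact.
  have C2 : (fun n => P2 (T2 @^-1` F n)) @ \oo --> P2 (T2 @^-1` (\bigcup_n F n)).
    rewrite preimage_bigcup; apply: nondecreasing_cvg_mu.
    + by move=> n; case: (HF n).
    + by apply: bigcup_measurable => n _; case: (HF n).
    + by move=> n m nm; apply/subsetPset => w /=; have /subsetPset := ndF _ _ nm; exact.
  have E : (fun n => P1 (T1 @^-1` F n)) = (fun n => P2 (T2 @^-1` F n)).
    by apply/funext => n; case: (HF n).
  by rewrite -(cvg_lim (@ereal_hausdorff _) C1) -(cvg_lim (@ereal_hausdorff _) C2) E.
move=> _ [->|[n [t ->]]].
  by split; rewrite ?preimage_set0 ?measure0//; exact: measurable0.
split; [exact: measurable_prefix H1.1|exact: measurable_prefix H2.1|].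
by rewrite !prefix_cylinderE H1.2 H2.2.
Qed.

End Uniqueness.

(** * Existence of the sin-tree *)

Section Digits.
Variables (R : realType) (C : countType) (c0 : C).

(* [0, 1[ is cut into consecutive intervals of lengths q c; [digit q x] is the
   label of the one that contains x and [residue q x] the relative position of
   x in it. *)
Definition cumul (q : C -> R) n : R :=
  \sum_(0 <= m < n) (if pickle_inv m is Some c then q c else 0).
Definition digit q x : C := xget c0 [set c | cumul q (pickle c) <= x < cumul q (pickle c) + q c].
Definition residue q x : R := (x - cumul q (pickle (digit q x))) / q (digit q x).

Variable q : C -> R.
Hypothesis q_ge0 : forall c, 0 <= q c.
Hypothesis q_le1 : forall s, uniq s -> \sum_(c <- s) q c <= 1.
Hypothesis q_total : forall e, 0 < e -> exists2 s, uniq s & 1 - e <= \sum_(c <- s) q c.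

Lemma cumul_pickle c : cumul q (pickle c).+1 = cumul q (pickle c) + q c.
Proof. by rewrite /cumul big_nat_recr//= pickleK_inv. Qed.

Lemma cumul_sum n : cumul q n = \sum_(c <- pmap pickle_inv (iota 0 n)) q c.
Proof.
rewrite /cumul /index_iota subn0; elim: (iota 0 n) => [|m l IH]; first by rewrite !big_nil.
by rewrite big_cons IH /=; case: (pickle_inv m) => [c|]; rewrite /= ?big_cons ?add0r.
Qed.

Lemma cumul_mono n m : (n <= m)%N -> cumul q n <= cumul q m.
Proof.
move=> nm; rewrite /cumul (big_cat_nat (leq0n n) nm)/= lerDl.
by apply: sumr_ge0 => k _; case: (pickle_inv k).
Qed.

Lemma cumul_ge0 n : 0 <= cumul q n.
Proof. by have := cumul_mono (leq0n n); rewrite {1}/cumul big_geq. Qed.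

Lemma cumul_le1 n : cumul q n <= 1.
Proof. by rewrite cumul_sum q_le1// (pmap_uniq (@pickle_invK C))// iota_uniq. Qed.

Lemma cumul_total x : x < 1 -> exists n, x < cumul q n.
Proof.
move=> x1; have [|s us sq] := @q_total ((1 - x) / 2); first by lra.
exists (\max_(c <- s) (pickle c)).+1; apply: (@lt_le_trans _ _ (\sum_(c <- s) q c)); first by lra.
rewrite cumul_sum; set l := pmap _ _.
have ul : uniq l by rewrite (pmap_uniq (@pickle_invK C))// iota_uniq.
have sl : {subset s <= l}.
  move=> c cs; rewrite mem_pmap; apply/mapP; exists (pickle c); last by rewrite pickleK_inv.
  by rewrite mem_iota/= add0n ltnS; apply: leq_bigmax_seq.
have -> : \sum_(c <- l) q c = \sum_(c <- s ++ [seq c <- l | c \notin s]) q c.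
  apply/perm_big/uniq_perm => // [|c].
    rewrite cat_uniq us filter_uniq// andbT; apply/hasPn => c.
    by rewrite mem_filter => /andP[].
  by rewrite mem_cat mem_filter; case cs : (c \in s) => //=; rewrite sl.
by rewrite big_cat/= lerDl sumr_ge0.
Qed.

Lemma digit_unique x c : cumul q (pickle c) <= x < cumul q (pickle c) + q c -> digit q x = c.
Proof.
move=> xc; have := @xgetI _ c0 [set c | cumul q (pickle c) <= x < cumul q (pickle c) + q c] c xc.
rewrite -/(digit q x) /=; move: (digit q x) => c' xc'.
apply: (pcan_inj (@pickleK_inv C)).
move: xc xc'; rewrite -!cumul_pickle => /andP[a b] /andP[a' b'].
have [h|h|//] := ltngtP (pickle c') (pickle c).
  by have H := cumul_mono h; have := lt_le_trans b' (le_trans H a); rewrite ltxx.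
by have H := cumul_mono h; have := lt_le_trans b (le_trans H a'); rewrite ltxx.
Qed.

Lemma digitP x : 0 <= x < 1 ->
  cumul q (pickle (digit q x)) <= x < cumul q (pickle (digit q x)) + q (digit q x).
Proof.
move=> /andP[x0 x1]; have ex : exists n, x < cumul q n by exact: cumul_total.
case: (ex_minnP ex) => -[|m] xm mn.
  by move: xm; rewrite /cumul big_geq//; lra.
have mx : cumul q m <= x by rewrite leNgt; apply/negP => /mn; rewrite ltnn.
case E : (@pickle_inv C m) => [c|]; last first.
  by move: xm; rewrite /cumul big_nat_recr//= E addr0 -/(cumul q m); lra.
have pc : pickle c = m by have := @pickle_invK C m; rewrite E.
have xc : cumul q (pickle c) <= x < cumul q (pickle c) + q c by rewrite -cumul_pickle pc mx.
by rewrite (digit_unique xc).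
Qed.

Lemma digit_gt0 x : 0 <= x < 1 -> 0 < q (digit q x).
Proof. by move=> /digitP; lra. Qed.

Lemma residue_bound x : 0 <= x < 1 -> 0 <= residue q x < 1.
Proof.
move=> x01; have q0 := digit_gt0 x01; have /andP[a b] := digitP x01.
rewrite /residue divr_ge0 ?subr_ge0 ?(ltW q0)//=.
by rewrite ltr_pdivrMr// mul1r; lra.
Qed.

End Digits.

Section Existence.
Variables (R : realType) (K : nat) (t0 : utree K) (w : utree K -> R).
Hypothesis w_ge0 : forall t, 0 <= w t.
Hypothesis w_le1 : forall s, uniq s -> \sum_(t <- s) w t <= 1.
Hypothesis w_total : forall e, 0 < e -> exists2 s, uniq s & 1 - e <= \sum_(t <- s) w t.
Hypothesis fringe_le : forall s t, uniq s -> \sum_(x <- s) w x * (Q x t)%:R <= w t.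
Hypothesis fringe_ge : forall t e, 0 < e ->
  exists2 s, uniq s & w t - e <= \sum_(x <- s) w x * (Q x t)%:R.

(* The transition probabilities of the Markov chain tbar_0, tbar_1, ... *)
Definition kern s s' : R := w s' * (Q s' s)%:R / w s.

Lemma kern_ge0 s s' : 0 <= kern s s'. Proof. by rewrite divr_ge0 ?mulr_ge0. Qed.

Lemma kern_le1 s l : 0 < w s -> uniq l -> \sum_(s' <- l) kern s s' <= 1.
Proof. by move=> ws ul; rewrite -mulr_suml ler_pdivrMr// mul1r fringe_le. Qed.

Lemma kern_total s e : 0 < w s -> 0 < e -> exists2 l, uniq l & 1 - e <= \sum_(s' <- l) kern s s'.
Proof.
move=> ws e0; have [|l ul le] := @fringe_ge s (e * w s); first exact: mulr_gt0.
by exists l => //; rewrite -mulr_suml ler_pdivlMr// mulrBl mul1r.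
Qed.

Local Notation digit := (digit t0).
Local Notation residue := (residue t0).

Fixpoint state x n : utree K * R :=
  if n is n'.+1 then let: (s, y) := state x n' in (digit (kern s) y, residue (kern s) y)
  else (digit w x, residue w x).

Lemma stateS x n : state x n.+1 =
  (digit (kern (state x n).1) (state x n).2, residue (kern (state x n).1) (state x n).2).
Proof. by rewrite /=; case: (state x n). Qed.

Lemma state_inv x n : 0 <= x < 1 -> 0 < w (state x n).1 /\ 0 <= (state x n).2 < 1.
Proof.
move=> x01; elim: n => [|n [ws IH]].
  by split; [exact: (digit_gt0 t0 w_ge0 w_total)|exact: (residue_bound t0 w_ge0 w_total)].
have k0 := kern_ge0 (state x n).1; have k1 := fun l => @kern_le1 _ l ws.
have kt := fun e => @kern_total _ e ws.
rewrite stateS /=; split; last exact: (residue_bound t0 k0 kt).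
have := digit_gt0 t0 k0 kt IH; rewrite /kern pmulr_lgt0 ?invr_gt0//.
by move=> h; rewrite lt_neqAle w_ge0 andbT eq_sym; apply/eqP => z; rewrite z mul0r ltxx in h.
Qed.

Lemma state_Q x n : 0 <= x < 1 -> (0 < Q (state x n.+1).1 (state x n).1)%N.
Proof.
move=> x01; have [ws y01] := state_inv n x01.
have k0 := kern_ge0 (state x n).1; have k1 := fun l => @kern_le1 _ l ws.
have kt := fun e => @kern_total _ e ws.
have := digit_gt0 t0 k0 kt y01; rewrite stateS /=.
by rewrite /kern; case: (Q _ _) => //; rewrite mulr0 mul0r ltxx.
Qed.

Definition cyl_len (s : nat -> utree K) n : R :=
  w (s n) * \prod_(1 <= j < n.+1) (Q (s j) (s j.-1))%:R.

Lemma cyl_len_ge0 s n : 0 <= cyl_len s n.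
Proof. by rewrite mulr_ge0// prodr_ge0. Qed.

Lemma cyl_lenS s n : cyl_len s n.+1 = cyl_len s n * kern (s n) (s n.+1).
Proof.
rewrite /cyl_len big_nat_recr//= /kern; have [w0|w0] := eqVneq (w (s n)) 0.
  have := @fringe_le [:: s n.+1] (s n) isT; rewrite big_seq1 w0 => h.
  have -> : w (s n.+1) * (\prod_(1 <= i < n.+1) (Q (s i) (s i.-1))%:R * (Q (s n.+1) (s n))%:R) =
      (w (s n.+1) * (Q (s n.+1) (s n))%:R) * \prod_(1 <= i < n.+1) (Q (s i) (s i.-1))%:R by ring.
  have -> : w (s n.+1) * (Q (s n.+1) (s n))%:R = 0 by apply/eqP; rewrite eq_le h mulr_ge0.
  by rewrite !mul0r.
by field.
Qed.

Lemma state_cylinder s n : exists l, [/\ 0 <= l, l + cyl_len s n <= 1 & forall x, 0 <= x < 1 ->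
  ((forall j, (j <= n)%N -> (state x j).1 = s j) <-> l <= x < l + cyl_len s n) /\
  ((forall j, (j <= n)%N -> (state x j).1 = s j) -> (state x n).2 = (x - l) / cyl_len s n)].
Proof.
elim: n => [|n [l [l0 l1 IH]]].
  have c0 : cyl_len s 0 = w (s 0%N) by rewrite /cyl_len big_geq// mulr1.
  exists (cumul w (pickle (s 0%N))); rewrite c0; split.
  - exact: cumul_ge0.
  - by rewrite -cumul_pickle; exact: cumul_le1.
  move=> x x01; split.
    split=> [/(_ 0%N isT) <-|xs j]; first exact: digitP.
    by rewrite leqn0 => /eqP ->; exact: digit_unique.
  by move=> /(_ 0%N isT) /= E; rewrite /residue E.
pose m := cyl_len s n.
have m0 : 0 <= m by exact: cyl_len_ge0.
have [mz|mz] := eqVneq m 0.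
  exists 0; rewrite cyl_lenS -/m mz mul0r addr0; split=> // x x01; have [H _] := IH x x01.
  have no : ~ (forall j, (j <= n.+1)%N -> (state x j).1 = s j).
    by move=> E; have /H : forall j, (j <= n)%N -> (state x j).1 = s j; [move=> j jn; apply: E; lia|rewrite -/m mz; lra].
  by split=> //; split=> //; lra.
have mp : 0 < m by lra.
have ws : 0 < w (s n).
  rewrite lt_neqAle w_ge0 andbT eq_sym; apply/eqP => z; move: mz; rewrite /m /cyl_len z mul0r.
  by rewrite eqxx.
have k0 := kern_ge0 (s n); have k1 := fun l => @kern_le1 _ l ws.
have kt := fun e => @kern_total _ e ws.
set c := cumul (kern (s n)) (pickle (s n.+1)).
have c0 : 0 <= c by exact: cumul_ge0.
have c1 : c + kern (s n) (s n.+1) <= 1 by rewrite -cumul_pickle; exact: cumul_le1.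
exists (l + m * c); rewrite cyl_lenS -/m; split.
- by rewrite addr_ge0// mulr_ge0.
- by apply: le_trans l1; rewrite -addrA -mulrDr lerD2l ger_pMr.
move=> x x01; have [H1 H2] := IH x x01.
set y := (x - l) / m in H2.
have yE : (c <= y < c + kern (s n) (s n.+1)) =
    (l + m * c <= x < l + m * c + m * kern (s n) (s n.+1)).
  by rewrite /y ler_pdivlMr// ltr_pdivrMr//; congr (_ && _); lra.
have E : (forall j, (j <= n.+1)%N -> (state x j).1 = s j) <->
    (forall j, (j <= n)%N -> (state x j).1 = s j) /\ digit (kern (s n)) y = s n.+1.
  split=> [E|[E En] j].
    have En j : (j <= n)%N -> (state x j).1 = s j by move=> jn; apply/E/leqW.
    by split=> //; rewrite -(E n.+1)// stateS (En n)//= (H2 En).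
  rewrite leq_eqVlt => /predU1P[->|]; last by rewrite ltnS; exact: E.
  by rewrite stateS (E n)//= (H2 E).
split.
  rewrite -yE; apply: (iff_trans E); split=> [[/H1 xl Es]|yc].
    rewrite /c -Es; apply: (digitP t0 k0 kt); move: xl; rewrite -/m => xl.
    by rewrite /y ler_pdivlMr// ltr_pdivrMr// mul0r mul1r; lra.
  split; last exact: digit_unique.
  apply/H1; move: yc; rewrite yE -/m => /andP[a b]; apply/andP; split.
    by apply: le_trans a; rewrite lerDl mulr_ge0.
  by apply: (lt_le_trans b); rewrite -addrA -mulrDr lerD2l ger_pMr.
move=> /E[En Es]; rewrite stateS (En n)//= (H2 En) /residue Es -/c.
have kp : 0 < kern (s n) (s n.+1).
  rewrite -Es; apply: (digit_gt0 t0 k0 kt); move/H1: En; rewrite -/m => xl.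
  by rewrite /y ler_pdivlMr// ltr_pdivrMr// mul0r mul1r; lra.
by rewrite /y; field; rewrite mz gt_eqF.
Qed.

Let clamp (x : R) := if 0 <= x < 1 then x else 0.
Let clampP x : 0 <= clamp x < 1.
Proof. by rewrite /clamp; case: ifP => // _; rewrite lexx ltr01. Qed.

Let S x n := (state (clamp x) n).1.

Definition uniform_sin_tree (x : R) : sin_tree K := fun j =>
  if j is i.+1 then xget t0 [set t | graft t (S x i) = S x i.+1] else S x 0.

Lemma tbar_uniform x j : tbar (uniform_sin_tree x) j = S x j.
Proof.
elim: j => // j IH; rewrite [LHS]/= IH.
have [t tS] := Q_gt0 (state_Q j (clampP x)).
exact: (@xgetI _ t0 [set t | graft t (S x j) = S x j.+1] t tS).
Qed.

Let U := uniform_prob (@ltr01 R).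

Lemma uniform_probE (A : set R) : measurable A -> U A = lebesgue_measure (A `&` `[0, 1]).
Proof.
move=> mA; transitivity (\int[U]_x (\1_A x)%:E)%E.
  by rewrite integral_indic// setIT.
rewrite integral_uniform//; last first.
  by apply/measurable_realfun.measurable_EFinP; exact: measurable_realfun.measurable_indic.
by rewrite subr0 invr1 mul1e integral_indic.
Qed.

Lemma S_cylinder s n : exists l, [/\ 0 <= l, l + cyl_len s n <= 1 & forall x, 0 <= x < 1 ->
  (forall j, (j <= n)%N -> S x j = s j) <-> l <= x < l + cyl_len s n].
Proof.
have [l [l0 l1 H]] := state_cylinder s n; exists l; split=> // x x01.
by have [H1 _] := H x x01; rewrite /S /clamp x01.
Qed.

Lemma measurable_S_cylinder s n : measurable [set x : R | forall j, (j <= n)%N -> S x j = s j].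
Proof.
have [l [l0 l1 H]] := S_cylinder s n.
rewrite (_ : mkset _ = (`[l, l + cyl_len s n[ `&` `[0, 1[) `|`
    (~` `[0, 1[ `&` [set _ | forall j, (j <= n)%N -> (state 0 j).1 = s j])).
  apply: measurableU; apply: measurableI => //; [exact: measurableC|exact: measurable_prop].
apply/seteqP; split=> x /=.
  have [x01|x01] := boolP (0 <= x < 1).
    by move=> /(H x x01) xl; left; rewrite !in_itv/=.
  move=> E; right; split; first by rewrite in_itv/=; exact/negP.
  by move=> j jn; rewrite -(E j jn) /S /clamp (negbTE x01).
move=> [[]|[]]; rewrite !in_itv/=; first by move=> xl x01; exact/(H x x01).
by move=> /negP x01 E j jn; rewrite -(E j jn) /S /clamp (negbTE x01).
Qed.

Lemma S_cylinder_prob s n :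
  U [set x : R | forall j, (j <= n)%N -> S x j = s j] = (cyl_len s n)%:E.
Proof.
have mE := measurable_S_cylinder s n.
rewrite uniform_probE//; have [l [l0 l1 H]] := S_cylinder s n.
have add1 (A : set R) : measurable A -> lebesgue_measure (A `|` [set (1 : R)]) = lebesgue_measure A.
  by move=> mA; apply: measureU0 => //; exact: lebesgue_measure_set1.
rewrite -add1; last exact: measurableI.
rewrite (_ : _ `|` _ = `[l, l + cyl_len s n[ `|` [set (1 : R)]).
  rewrite add1//.
  rewrite lebesgue_measure_itv/= lte_fin ltrDl; case: ltP => c0.
    by rewrite -EFinD addrAC subrr add0r.
  by congr EFin; apply/eqP; rewrite eq_le cyl_len_ge0.
apply/seteqP; split=> x /= [|->]; [|by right| |by right].
  move=> [E]; rewrite in_itv/= => /andP[x0 x1].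
  have [->|ne] := eqVneq x 1; [by right|left].
  by rewrite in_itv/=; apply/(H x) => //; rewrite x0 lt_neqAle ne.
rewrite in_itv/= => /andP[a b]; have x01 : 0 <= x < 1 by lra.
by left; rewrite in_itv/=; split; [apply/(H x x01); rewrite a b|lra].
Qed.

Lemma measurable_S n s : measurable [set x : R | S x n = s].
Proof.
rewrite (_ : mkset _ = [set x | exists L : seq (utree K),
    (fun L => [set x | nth s L n = s] `&` [set x | forall j, (j <= n)%N -> S x j = nth s L j]) L x]).
  apply: measurable_exists => L; apply: measurableI; first exact: measurable_prop.
  exact: measurable_S_cylinder.
apply/seteqP; split=> x /=; last by move=> [L [Ls ->//]].
move=> Sn; exists (mkseq (S x) n.+1); split; first by rewrite /= nth_mkseq.
by move=> j jn; rewrite nth_mkseq.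
Qed.

Lemma uniform_sin_tree_law : sin_tree_with_fringe U uniform_sin_tree (fun t => (w t)%:E).
Proof.
split=> [[|i] t|i s]; first exact: measurable_S.
  apply: (@measurable_discrete_pair _ _ _ _ (S^~ i) (S^~ i.+1)
    (fun a b => [set x | xget t0 [set t | graft t a = b] = t])) => *;
  [exact: measurable_S|exact: measurable_S|exact: measurable_prop].
rewrite -EFinM -/(cyl_len s i) -S_cylinder_prob; congr (U _).
by apply/seteqP; split=> x /= E j ji; rewrite -E// tbar_uniform.
Qed.

End Existence.

(** * Conclusion *)

Lemma esum_eq (R : realType) (T : choiceType) (f : T -> R) (c : R) :
  (forall s, uniq s -> \sum_(t <- s) f t <= c) ->
  (forall e, 0 < e -> exists2 s, uniq s & c - e <= \sum_(t <- s) f t) ->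
  (\esum_(t in [set: T]) (f t)%:E = c%:E)%E.
Proof.
move=> f_le f_ge; apply/eqP; rewrite eq_le; apply/andP; split.
  apply: ge_ereal_sup => _ [X [finX _] <-].
  by rewrite fsbig_finite//= sumEFin lee_fin f_le.
apply/lee_addgt0Pr => e e0; have [s us hs] := f_ge e e0.
apply: (@le_trans _ _ ((\sum_(t <- s) f t)%:E + e%:E)%E).
  by rewrite -EFinD lee_fin -lerBlDr.
apply: leeD2r; apply: esum_ge; exists [set` s].
  by split=> //; exact: finite_seq.
by rewrite -sumEFin fsbig_seq.
Qed.

Lemma ae_ex d (T : measurableType d) (R : realType) (P : probability T R) (A : T -> Prop) :
  (\forall w \ae P, A w) -> exists w, A w.
Proof.
move=> [N [mN N0 AN]]; apply/not_existsP => nA.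
have NT : N = setT by apply/seteqP; split=> // w _; apply: AN => /nA.
by move: N0; rewrite NT probability_setT => -[/eqP]; rewrite oner_eq0.
Qed.

Section GoodPaths.
Variables (R : realType) (K : nat) (a0 : 'I_K).
Variables (p : 'I_K -> R) (p_gt0 : forall a, 0 < p a) (p1 : \sum_a p a = 1).
Variables (kappa : 'I_K -> 'I_K -> R) (kappa_gt0 : forall a b, 0 < kappa a b).

Definition good_path (g : nat -> rtree K) : Prop :=
  [/\ wf (g 0%N), forall n, step (g n) (g n.+1),
      forall a, exists B, forall n, vdev a0 p kappa (psi_deg R a0 a) g n <= B
    & forall h, exists B, forall n, vdev a0 p kappa (psi_cnt R h) g n <= B].

Lemma good_path_ae d (T : measurableType d) (P : probability T R) (G : nat -> T -> rtree K) :
  network_process p kappa P G -> \forall w \ae P, good_path (G^~ w).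
Proof.
move=> HG; have H1 := steps_ae a0 p1 kappa_gt0 HG.
have H2 : \forall w \ae P, forall a, exists B, forall n, vdev a0 p kappa (psi_deg R a0 a) (G^~ w) n <= B.
  apply: ae_countable => a.
  by apply: (vdev_ae a0 p_gt0 p1 kappa_gt0 HG (psi := psi_deg R a0 a) (C := 2)) => g b v _ _; exact: psi_deg_le.
have H3 : \forall w \ae P, forall h, exists B, forall n, vdev a0 p kappa (psi_cnt R h) (G^~ w) n <= B.
  apply: ae_countable => h.
  by apply: (vdev_ae a0 p_gt0 p1 kappa_gt0 HG (psi := psi_cnt R h) (C := 2)) => g b v _ _; exact: psi_cnt_le.
apply: filterS (ae_and H1 (ae_and H2 H3)) => w [h1 [h2 h3]]; split=> //.
by case: HG.
Qed.

End GoodPaths.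
Theorem theorem3p5 (R : realType) (K : nat) (hK : (0 < K)%N)
  (p : 'I_K -> R) (p_gt0 : forall a, 0 < p a) (p_sum : \sum_a p a = 1)
  (kappa : 'I_K -> 'I_K -> R) (kappa_gt0 : forall a b, 0 < kappa a b)
  (eta : 'I_K -> R) (eta_min : Vpi_minimizer p kappa eta)
  (d : measure_display) (Omega : measurableType d) (P : probability Omega R)
  (G : nat -> Omega -> rtree K) (HG : network_process p kappa P G)
  (d' : measure_display) (Omega' : measurableType d')
  (P' : probability Omega' R)
  (A : Omega' -> 'I_K) (tau : {RV P' >-> R})
  (xi : seq nat -> 'I_K -> nat -> 'I_K -> {RV P' >-> R})
  (HBP : branching_setup p (phi p kappa eta) A tau xi) :
  let varpi := varpi_infty A tau xi in
  [/\ fringe_distribution varpi,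
      exists (dT : measure_display) (OmegaT : measurableType dT)
             (PT : probability OmegaT R) (T : OmegaT -> sin_tree K),
        sin_tree_with_fringe PT T varpi /\ extended_fringe_cvg P G PT T
    & forall (d1 : measure_display) (O1 : measurableType d1)
             (P1 : probability O1 R) (T1 : O1 -> sin_tree K)
             (d2 : measure_display) (O2 : measurableType d2)
             (P2 : probability O2 R) (T2 : O2 -> sin_tree K),
        sin_tree_with_fringe P1 T1 varpi -> sin_tree_with_fringe P2 T2 varpi ->
        same_law P1 T1 P2 T2].
Proof.
pose a0 := Ordinal hK; pose w := vr A tau xi.
have [eta_gt0 eta1] := eta_min.1.
have ph_gt0 := phi_gt0 p_gt0 kappa_gt0 eta_min.
have w0 : forall t, 0 <= w t by exact: vr_ge0.
have wE : varpi_infty A tau xi = fun t => (w t)%:E by apply/funext => t; exact: (varpiE HBP t).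
have w_le1 := vr_sum_le1 HBP.
have w_total := vr_total a0 p_gt0 p_sum ph_gt0 HBP.
have w_hist := vr_sum_le a0 p_gt0 p_sum ph_gt0 HBP.
have good := good_path_ae a0 p_gt0 p_sum kappa_gt0 HG.
have [z [wf_z steps_z deg_z cnt_z]] := ae_ex good.
have w_kids e := vr_kids a0 p_gt0 p_sum ph_gt0 HBP (e := e) eta_gt0 eta1
  (path_first_order p_gt0 p_sum kappa_gt0 eta_min wf_z steps_z deg_z).
have cnt_lim g : good_path a0 p kappa g -> forall h, wf h -> par a0 h 0 = 0%N ->
    (fun n => (cnt h (g n))%:R / n.+1%:R) @ \oo --> vph a0 p (phi p kappa eta) h.
  by case=> wg steps deg_g cnt_g h; exact: (cnt_cvg p_gt0 p_sum kappa_gt0 eta_min wg steps deg_g cnt_g).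
have lim_z := cnt_lim _ (And4 wf_z steps_z deg_z cnt_z).
have f_le : forall s t, uniq s -> \sum_(x <- s) w x * (Q x t)%:R <= w t.
  exact: (fringe_le w0 w_hist w_total (wf_path wf_z steps_z) (size_path steps_z) lim_z).
have f_ge := fringe_ge w0 w_hist w_le1 w_total (wf_path wf_z steps_z) (size_path steps_z) lim_z w_kids.
pose t0 := mktree a0 [::].
have law := uniform_sin_tree_law t0 w0 w_le1 w_total f_le f_ge.
rewrite wE => varpi; split.
- split=> [t||t]; rewrite /varpi ?lee_fin//.
  + exact: (esum_eq w_le1 w_total).
  + under eq_esum do rewrite -EFinM.
    exact: (esum_eq (fun s us => f_le s t us) (f_ge t)).
- exists _, _, (uniform_prob ltr01), (uniform_sin_tree t0 w); split=> // k.
  apply: filterS good => x [wf_x steps_x deg_x cnt_x] f [M fM].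
  have [mT lawT] := law.
  have lim_x := cnt_lim _ (And4 wf_x steps_x deg_x cnt_x).
  apply: (efringe_cvg w0 w_hist w_total (wf_path wf_x steps_x) (size_path steps_x) lim_x mT _ fM).
  by move=> i s; rewrite /pr lawT.
- by move=> d1 O1 P1 T1 d2 O2 P2 T2 law1 law2; exact: (sin_tree_law_unique law1 law2).
Qed.
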